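(* The maps with non-empty boundary in the classes $T=1$, $2$, $2^*$ and $2^P$ are, up to isomorphism, as follows: (i) $T=1$: $\mathcal{A}_n$ and $\mathcal{C}_n=D(\mathcal{A}_n)$ for $n\in\mathbb{N}\cup\{\infty\}$, $\mathcal{B}=\mathcal{N}(3)$, the three quotients of $\mathcal{B}$ by subgroups $C_2\le\mathrm{Aut}\,\mathcal{B}$, isomorphic to $\mathcal{N}(2)$, $\mathcal{N}(2^* )$ and $\mathcal{N}(2^P)$, the map $\mathcal{D}$, and $\mathcal{T}=\mathcal{N}(1)$; (ii) $T=2$: $\mathcal{M}_{2,n}$ for $n\in\mathbb{N}\cup\{\infty\}$, and $\mathcal{M}_{2,0}$; (iii) $T=2^*$: $\mathcal{M}_{2^*,n}=D(\mathcal{M}_{2,n})$ for $n\in\mathbb{N}\cup\{\infty\}$, and $\mathcal{M}_{2^*,0}=D(\mathcal{M}_{2,0})$; (iv) $T=2^P$: $\mathcal{M}_{2^P,n}=P(\mathcal{M}_{2^*,n})$ for $n\in\mathbb{N}\cup\{\infty\}$, and $\mathcal{M}_{2^P,0}=P(\mathcal{M}_{2^*,0})$. All are on the closed disc $\overline{\mathbb{D}}$, apart from $\mathcal{M}_{2^P,n}$, which is on the annulus or the Möbius band for even or odd $n\ge 1$ respectively, and on the doubly infinite strip for $n=\infty$.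
   Context: Let $\Gamma=\langle R_0,R_1,R_2\mid R_i^2=(R_0R_2)^2=1\rangle$ and $E=\langle R_0,R_2\rangle\cong V_4$. A (connected) map $\mathcal{M}$ (possibly non-orientable, non-compact, or with non-empty boundary) is identified, up to isomorphism, with a transitive permutation representation of $\Gamma$ on a set $\Phi$ of flags, or equivalently with a conjugacy class of subgroups $M\le\Gamma$ (its map subgroups, the stabilisers of flags). $\mathrm{Aut}\,\mathcal{M}$ is the centraliser of $\Gamma$ in $\mathrm{Sym}\,\Phi$, isomorphic to $N_\Gamma(M)/M$. The map has non-empty boundary if and only if $M$ contains a conjugate of some $R_i$. Let $N(1)=\Gamma$; let $N(2)$, $N(2^* )$, $N(2^P)$ be the subgroups of index $2$ in $\Gamma$ containing, among $R_0,R_1,R_2$, exactly $R_1,R_2$, exactly $R_0,R_1$, and exactly $R_1$, respectively; let $N(3)$ be the normal closure of $R_1$ in $\Gamma$ (of index $4$). $\mathcal{N}(T)$ denotes the map with map subgroup $N(T)$. For $T=1,2,2^*,2^P$, a map is in class $T$ if its map subgroups $M$ satisfy $N_\Gamma(M)=N(T)$ (so class $1$ consists of the regular maps). $D$ is the classical duality of maps, replacing map subgroups $M$ with $\delta(M)$ where $\delta$ is the automorphism of $\Gamma$ fixing $R_1$ and transposing $R_0$ and $R_2$. $P$ is Petrie duality, replacing $M$ with $\pi(M)$ where $\pi$ is the automorphism of $\Gamma$ fixing $R_1$ and $R_2$ and transposing $R_0$ and $R_0R_2$. $\mathbb{N}=\{1,2,\ldots\}$. The maps named are as follows. $\mathcal{A}_n$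 (finite $n$) embeds in the closed disc a semi-star: one interior vertex with $n$ semi-edges joining it to the boundary, with $n$ boundary faces; $\mathcal{A}_\infty$ embeds a semi-star of countably infinite valency in the closed disc, with its vertex on the boundary and its semi-edges ending at boundary points accumulating at the vertex. The map subgroup of $\mathcal{A}_n$ is the normal closure in $\Gamma$ of $R_0$ and $(R_1R_2)^n$ (of $R_0$ alone if $n=\infty$). $\mathcal{C}_n$ embeds a circuit of $n$ vertices and edges around the boundary of the closed disc, with one face (a doubly infinite path along the boundary, with vertices accumulating at one boundary point, if $n=\infty$). $\mathcal{B}$ embeds $K_2$ as a diameter of the closed disc. $\mathcal{D}$ embeds one vertex and two half-edges along the boundary of the closed disc; its map subgroup is the normal closure of $R_0$ and $R_2$ in $\Gamma$. $\mathcal{T}$ embeds one vertex and one half-edge along the boundary of the closed disc. Put $S_1=R_1$, $S_2=R_1^{R_0}$, $S_3=R_2$, so $N(2)=\langle S_1,S_2,S_3\mid S_i^2=1\rangle$. $\mathcal{M}_{2,n}$ (finite $n\ge1$) is the map on the closed disc with a central vertex joined by $n$ interior edges to $n$ boundary vertices (infinitely many if $n=\infty$, with boundary vertices accumulating at one boundary point); its map subgroup is the normal closure in $N(2)$ of $S_1$ and $(S_2S_3)^n$ (of $S_1$ alone if $n=\infty$). $\mathcal{M}_{2,0}$ embeds a path of three vertices and two edges along the boundary of the closed disc; its map subgroup is the normal closure of $S_1$ and $S_3$ in $N(2)$. *)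

(* Defs.v *)
From HB Require Import structures.
From mathcomp Require Import all_boot all_order all_algebra.
From mathcomp Require Import all_classical all_reals all_analysis.

Set Implicit Arguments.
Unset Strict Implicit.
Unset Printing Implicit Defensive.

Import numFieldNormedType.Exports.
Local Open Scope classical_set_scope.
Local Open Scope quotient_scope.
Local Open Scope group_scope.

(** Gamma = < R_0, R_1, R_2 | R_i^2 = (R_0 R_2)^2 = 1 > *)

Definition i0 : 'I_3 := @Ordinal 3 0 isT.
Definition i1 : 'I_3 := @Ordinal 3 1 isT.
Definition i2 : 'I_3 := @Ordinal 3 2 isT.

Lemma I3E (P : 'I_3 -> Prop) : P i0 -> P i1 -> P i2 -> forall i, P i.
Proof.
move=> P0 P1 P2 [[|[|[|//]]] Hi].
- by have -> : Ordinal Hi = i0 by exact: val_inj.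
- by have -> : Ordinal Hi = i1 by exact: val_inj.
- by have -> : Ordinal Hi = i2 by exact: val_inj.
Qed.

(* The generators being involutions, every element of Gamma is a positive word
   in them, and Gamma is a quotient of the free monoid on the generators. *)
Inductive weq : seq 'I_3 -> seq 'I_3 -> Prop :=
| weq_refl u : weq u u
| weq_sym u v : weq u v -> weq v u
| weq_trans u v w : weq u v -> weq v w -> weq u w
| weq_cat u u' v v' : weq u u' -> weq v v' -> weq (u ++ v) (u' ++ v')
| weq_sq i : weq [:: i; i] [::]
| weq_02 : weq [:: i0; i2; i0; i2] [::].

Definition weqb (u v : seq 'I_3) : bool := `[< weq u v >].

Lemma weqb_refl : reflexive weqb.
Proof. by move=> u; apply/asboolP; exact: weq_refl. Qed.

Lemma weqb_sym : symmetric weqb.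
Proof. by move=> u v; apply/asboolP/asboolP; exact: weq_sym. Qed.

Lemma weqb_trans : transitive weqb.
Proof.
by move=> v u w /asboolP uv /asboolP vw; apply/asboolP; exact: weq_trans vw.
Qed.

Canonical weqb_equiv := EquivRel weqb weqb_refl weqb_sym weqb_trans.

Definition Gamma := {eq_quot weqb}.
HB.instance Definition _ := Choice.on Gamma.
HB.instance Definition _ := EqQuotient.on Gamma.

Definition word (u : seq 'I_3) : Gamma := \pi_Gamma u.

Lemma word_eqP u v : word u = word v <-> weq u v.
Proof. by split=> [/eqmodP/asboolP|uv]//; apply/eqmodP/asboolP. Qed.

Lemma weq_repr u : weq (repr (word u)) u.
Proof. by apply/word_eqP; rewrite /word reprK. Qed.

Lemma wordP (g : Gamma) : exists u, g = word u.
Proof. by exists (repr g); rewrite /word reprK. Qed.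

Lemma weq_rev u v : weq u v -> weq (rev u) (rev v).
Proof.
elim=> {u v} [u|u v _ ?|u v w _ uv _ vw|u u' v v' _ uu' _ vv'|i|].
- exact: weq_refl.
- exact: weq_sym.
- exact: weq_trans vw.
- by rewrite !rev_cat; exact: weq_cat.
- exact: (weq_sq i).
- apply: (@weq_trans _ ([:: i2] ++ ([:: i0; i2; i0; i2] ++ [:: i2]))).
    rewrite -[rev _]/([:: i2; i0; i2] ++ [:: i0]).
    apply: (@weq_cat [:: i2; i0; i2] [:: i2; i0; i2] [:: i0] [:: i0; i2; i2]).
      exact: weq_refl.
    apply: weq_sym; apply: (@weq_cat [:: i0] [:: i0] [:: i2; i2] [::]).
      exact: weq_refl.
    exact: weq_sq.
  apply: (@weq_trans _ ([:: i2] ++ ([::] ++ [:: i2]))).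
    do !apply: weq_cat; [exact: weq_refl|exact: weq_02|exact: weq_refl].
  exact: weq_sq.
Qed.

Lemma weq_catrev u : weq (rev u ++ u) [::].
Proof.
elim: u => [|i u IH]; first exact: weq_refl.
rewrite rev_cons cat_rcons -[i :: i :: u]/([:: i; i] ++ u).
apply: weq_trans IH; apply: weq_cat; first exact: weq_refl.
rewrite -[X in weq _ X]/([::] ++ u).
by apply: weq_cat; [exact: weq_sq|exact: weq_refl].
Qed.

Definition Gone : Gamma := word [::].
Definition Gmul (g h : Gamma) : Gamma := word (repr g ++ repr h).
Definition Ginv (g : Gamma) : Gamma := word (rev (repr g)).

Lemma GmulE u v : Gmul (word u) (word v) = word (u ++ v).
Proof. by apply/word_eqP; apply: weq_cat; exact: weq_repr. Qed.

Lemma GinvE u : Ginv (word u) = word (rev u).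
Proof. by apply/word_eqP; apply: weq_rev; exact: weq_repr. Qed.

Lemma GmulA : associative Gmul.
Proof.
move=> x y z; have [u ->] := wordP x; have [v ->] := wordP y.
by have [w ->] := wordP z; rewrite !GmulE catA.
Qed.

Lemma Gmul1g : left_id Gone Gmul.
Proof. by move=> x; have [u ->] := wordP x; rewrite GmulE. Qed.

Lemma Gmulg1 : right_id Gone Gmul.
Proof. by move=> x; have [u ->] := wordP x; rewrite GmulE cats0. Qed.

Lemma GmulVg : left_inverse Gone Ginv Gmul.
Proof.
move=> x; have [u ->] := wordP x; rewrite GinvE GmulE.
by apply/word_eqP; exact: weq_catrev.
Qed.

Lemma GmulgV : right_inverse Gone Ginv Gmul.
Proof.
move=> x; have [u ->] := wordP x; rewrite GinvE GmulE.
by apply/word_eqP; rewrite -{1}[u]revK; exact: weq_catrev.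
Qed.

HB.instance Definition _ :=
  isGroup.Build Gamma GmulA Gmul1g Gmulg1 GmulVg GmulgV.

Definition gen (i : 'I_3) : Gamma := word [:: i].
Notation R0 := (gen i0).
Notation R1 := (gen i1).
Notation R2 := (gen i2).

Lemma wordM u v : word (u ++ v) = word u * word v.
Proof. by rewrite -[RHS]/(Gmul _ _) GmulE. Qed.

Lemma word_cons i u : word (i :: u) = gen i * word u.
Proof. by rewrite -wordM. Qed.

Lemma gen_sq i : gen i * gen i = 1.
Proof. by rewrite /gen -wordM; apply/word_eqP; exact: weq_sq. Qed.

Lemma gen_02 : (R0 * R2) ^+ 2 = 1.
Proof. by rewrite expg2 /gen -!wordM; apply/word_eqP; exact: weq_02. Qed.

(** von Dyck's extension of f : {R_0, R_1, R_2} -> G to Gamma *)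
Definition Gamma_lift (G : groupType) (f : 'I_3 -> G) (g : Gamma) : G :=
  \prod_(i <- repr g) f i.

Definition respects_relators (G : groupType) (f : 'I_3 -> G) :=
  (forall i, f i * f i = 1) /\ (f i0 * f i2) ^+ 2 = 1.

Lemma Gamma_lift_word (G : groupType) (f : 'I_3 -> G) u :
  respects_relators f -> Gamma_lift f (word u) = \prod_(i <- u) f i.
Proof.
move=> [fsq f02]; rewrite /Gamma_lift.
suff E v w : weq v w -> \prod_(i <- v) f i = \prod_(i <- w) f i.
  exact/E/weq_repr.
elim=> {u v w} [u|u v _ ->|u v w _ -> _ ->|u u' v v' _ IH _ IH'|i|] //.
- by rewrite !big_cat IH IH'.
- by rewrite !big_cons big_nil mulg1 fsq.
- by rewrite !big_cons big_nil mulg1 -f02 expg2 !mulgA.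
Qed.

Lemma Gamma_liftM (G : groupType) (f : 'I_3 -> G) :
  respects_relators f -> {morph Gamma_lift f : x y / x * y}.
Proof.
move=> fR x y; have [u ->] := wordP x; have [v ->] := wordP y.
by rewrite -wordM !Gamma_lift_word// big_cat.
Qed.

Lemma Gamma_lift_gen (G : groupType) (f : 'I_3 -> G) i :
  respects_relators f -> Gamma_lift f (gen i) = f i.
Proof. by move=> fR; rewrite Gamma_lift_word// big_seq1. Qed.

Lemma Gamma_lift1 (G : groupType) (f : 'I_3 -> G) :
  respects_relators f -> Gamma_lift f 1 = 1.
Proof. by move=> fR; rewrite -[1]/(word [::]) Gamma_lift_word// big_nil. Qed.


Lemma gen_02sq : R0 * R2 * (R0 * R2) = 1.
Proof. by rewrite -gen_02 expg2. Qed.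

Lemma gen_20 : R2 * R0 = R0 * R2.
Proof.
apply: (mulgI R2); rewrite mulgA gen_sq mul1g; apply: (mulgI R0).
by rewrite gen_sq mulgA -[R0 * R2 * _]mulgA mulgA gen_02sq.
Qed.

Definition delta_gen (i : 'I_3) : Gamma :=
  if i == i0 then R2 else if i == i1 then R1 else R0.

Definition petrie_gen (i : 'I_3) : Gamma :=
  if i == i0 then R0 * R2 else gen i.

Lemma delta_gen_relators : respects_relators delta_gen.
Proof.
split; first by apply: I3E; rewrite gen_sq.
by rewrite /delta_gen /= gen_20 gen_02.
Qed.

Lemma petrie_gen_relators : respects_relators petrie_gen.
Proof.
split; first by apply: I3E; rewrite ?gen_02sq ?gen_sq.
by rewrite /petrie_gen /= -mulgA gen_sq mulg1 expg2 gen_sq.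
Qed.

Definition delta : Gamma -> Gamma := Gamma_lift delta_gen.
Definition petrie : Gamma -> Gamma := Gamma_lift petrie_gen.

Lemma deltaM : {morph delta : x y / x * y}.
Proof. exact: Gamma_liftM delta_gen_relators. Qed.

Lemma petrieM : {morph petrie : x y / x * y}.
Proof. exact: Gamma_liftM petrie_gen_relators. Qed.

Lemma delta1 : delta 1 = 1.
Proof. exact: Gamma_lift1 delta_gen_relators. Qed.

Lemma petrie1 : petrie 1 = 1.
Proof. exact: Gamma_lift1 petrie_gen_relators. Qed.

Lemma delta_genE i : delta (gen i) = delta_gen i.
Proof. exact: Gamma_lift_gen delta_gen_relators. Qed.

Lemma petrie_genE i : petrie (gen i) = petrie_gen i.
Proof. exact: Gamma_lift_gen petrie_gen_relators. Qed.

Lemma morph_invol (f : Gamma -> Gamma) : f 1 = 1 ->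
  {morph f : x y / x * y} -> (forall i, f (f (gen i)) = gen i) -> involutive f.
Proof.
move=> f1 fM fg x; have [u ->] := wordP x.
elim: u => [|i u IH]; first by rewrite -[word [::]]/(1 : Gamma) !f1.
by rewrite word_cons !fM fg IH.
Qed.

Lemma deltaK : involutive delta.
Proof.
apply: (morph_invol delta1 deltaM).
by apply: I3E; rewrite delta_genE /delta_gen /= delta_genE.
Qed.

Lemma petrieK : involutive petrie.
Proof.
apply: (morph_invol petrie1 petrieM).
apply: I3E; rewrite petrie_genE /petrie_gen /= ?petrieM !petrie_genE //.
by rewrite /petrie_gen /= -mulgA gen_sq mulg1.
Qed.

Definition subgroup (H : set Gamma) :=
  H 1 /\ forall x y, H x -> H y -> H (x / y).

Definition right_coset (H : set Gamma) (g : Gamma) : set Gamma :=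
  [set h * g | h in H].

Definition right_cosets (H : set Gamma) : set (set Gamma) :=
  range (right_coset H).

Definition conj_set (H : set Gamma) (g : Gamma) : set Gamma :=
  [set h ^ g | h in H].

Definition normaliser (H : set Gamma) : set Gamma :=
  [set g | conj_set H g = H].

Definition generated (A : set Gamma) : set Gamma :=
  \bigcap_(H in [set H | subgroup H /\ A `<=` H]) H.

(** normal closure of A in the subgroup K *)
Definition ncl (K A : set Gamma) : set Gamma :=
  \bigcap_(H in [set H | [/\ subgroup H, A `<=` H & K `<=` normaliser H]]) H.

(* a transitive permutation representation of Gamma, acting on the right *)
Record emap := EMap {
  flag :> Type;
  act : flag -> Gamma -> flag;
  act1 : forall x, act x 1 = x;
  actM : forall x g h, act x (g * h) = act (act x g) h;
  flag_inh : inhabited flag;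
  act_trans : forall x y, exists g, act x g = y }.

Definition stab (M : emap) (x : M) : set Gamma := [set g | act x g = x].

Definition equivariant (M M' : emap) (f : M -> M') :=
  forall x g, f (act x g) = act (f x) g.

Definition map_iso (M M' : emap) :=
  exists f : M -> M', bijective f /\ equivariant f.

Definition has_boundary (M : emap) :=
  exists (x : M) (i : 'I_3) (g : Gamma), stab x (gen i ^ g).

Section CosetMap.
Variable H : set Gamma.

Definition coset_flag : Type := {A : set Gamma | right_cosets H A}.

Lemma right_cosetM g h :
  [set a * h | a in right_coset H g] = right_coset H (g * h).
Proof.
apply/seteqP; split=> [_ [_ [a Ha <-] <-]|_ [a Ha <-]].
  by exists a => //; rewrite mulgA.
by exists (a * g); [exists a|rewrite mulgA].
Qed.

Lemma coset_act_subproof (A : coset_flag) (g : Gamma) :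
  right_cosets H [set a * g | a in sval A].
Proof. by case: A => A0 /= [h _ <-]; rewrite right_cosetM; exists (h * g). Qed.

Definition coset_act (A : coset_flag) (g : Gamma) : coset_flag :=
  exist _ [set a * g | a in sval A] (coset_act_subproof A g).

Lemma coset_flag_inj (A B : coset_flag) : sval A = sval B -> A = B.
Proof.
by case: A B => [A hA] [B hB] /= AB; subst B; congr exist; exact: Prop_irrelevance.
Qed.

Lemma coset_act1 A : coset_act A 1 = A.
Proof.
apply: coset_flag_inj; case: A => A0 /= [h _ <-].
by rewrite right_cosetM mulg1.
Qed.

Lemma coset_actM A g h : coset_act A (g * h) = coset_act (coset_act A g) h.
Proof.
apply: coset_flag_inj; case: A => A0 /= [k _ <-].
by rewrite !right_cosetM mulgA.
Qed.

Lemma coset_inh : inhabited coset_flag.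
Proof. by constructor; exists (right_coset H 1); exists 1. Qed.

Lemma coset_trans A B : exists g, coset_act A g = B.
Proof.
case: A B => [A hA] [B hB]; have [h _ hE] := hA; have [k _ kE] := hB.
exists (h^-1 * k); apply: coset_flag_inj => /=.
by rewrite -hE -kE right_cosetM mulgA mulgV mul1g.
Qed.

Definition coset_map : emap :=
  EMap coset_act1 coset_actM coset_inh coset_trans.

Lemma stab_coset_map : subgroup H -> exists x : coset_map, stab x = H.
Proof.
move=> [H1 HV].
have HVx x : H x -> H x^-1 by move=> Hx; rewrite -[x^-1]mul1g; exact: HV.
have Hc : right_cosets H (right_coset H 1) by exists 1.
exists (exist _ _ Hc : coset_map); apply/seteqP; split=> g.
  move=> /(congr1 sval) /=; rewrite right_cosetM mul1g => E.
  have : right_coset H g (1 * g) by exists 1.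
  by rewrite E mul1g => -[h Hh]; rewrite mulg1 => <-.
move=> Hg; apply: coset_flag_inj; rewrite /= right_cosetM mul1g.
apply/seteqP; split=> _ [h Hh <-].
  by exists (h * g); rewrite ?mulg1// -[g]invgK; apply: HV => //; exact: HVx.
by exists (h / g); [exact: HV|rewrite mulg1 mulgVK].
Qed.

End CosetMap.

Section Twist.
Variables (s : Gamma -> Gamma) (s1 : s 1 = 1).
Variables (sM : {morph s : x y / x * y}) (sK : involutive s) (M : emap).

Definition twist_act (x : M) (g : Gamma) : M := act x (s g).

Lemma twist_act1 x : twist_act x 1 = x.
Proof. by rewrite /twist_act s1 act1. Qed.

Lemma twist_actM x g h : twist_act x (g * h) = twist_act (twist_act x g) h.
Proof. by rewrite /twist_act sM actM. Qed.

Lemma twist_trans x y : exists g, twist_act x g = y.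
Proof.
by have [g <-] := act_trans x y; exists (s g); rewrite /twist_act sK.
Qed.

Definition twist : emap := EMap twist_act1 twist_actM (flag_inh M) twist_trans.

Lemma stab_twist (x : M) : @stab twist x = s @` stab x.
Proof.
apply/seteqP; split=> [g gx|_ [g gx <-]]; last by rewrite /stab /= /twist_act sK.
by exists (s g); rewrite ?sK.
Qed.

End Twist.

Definition dual_map : emap -> emap := twist delta1 deltaM deltaK.
Definition petrie_map : emap -> emap := twist petrie1 petrieM petrieK.

Lemma stab_dual (M : emap) (x : M) : @stab (dual_map M) x = delta @` stab x.
Proof. exact: stab_twist. Qed.

Lemma stab_petrie (M : emap) (x : M) : @stab (petrie_map M) x = petrie @` stab x.
Proof. exact: stab_twist. Qed.

Section InvolMap.
Variables (F : Type) (r : 'I_3 -> F -> F).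

Definition invol_act (x : F) (g : Gamma) : F :=
  foldl (fun y i => r i y) x (repr g).

Hypothesis rsq : forall i x, r i (r i x) = x.
Hypothesis r02 : forall x, r i2 (r i0 x) = r i0 (r i2 x).

Lemma invol_act_word x u :
  invol_act x (word u) = foldl (fun y i => r i y) x u.
Proof.
rewrite /invol_act.
suff E v w : weq v w ->
    forall z, foldl (fun y i => r i y) z v = foldl (fun y i => r i y) z w.
  exact/E/weq_repr.
elim=> {x u v w} [u|u v _ IH|u v w _ IH _ IH'|u u' v v' _ IH _ IH'|i|] x //=.
- by rewrite IH IH'.
- by rewrite !foldl_cat IH IH'.
- by rewrite r02 !rsq.
Qed.

Lemma invol_act1 x : invol_act x 1 = x.
Proof. exact: (invol_act_word x [::]). Qed.

Lemma invol_actM x g h : invol_act x (g * h) = invol_act (invol_act x g) h.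
Proof.
have [u ->] := wordP g; have [v ->] := wordP h.
by rewrite -wordM !invol_act_word foldl_cat.
Qed.

Hypothesis F_inh : inhabited F.
Hypothesis r_trans : forall x y, exists u, foldl (fun y i => r i y) x u = y.

Lemma invol_trans x y : exists g, invol_act x g = y.
Proof. by have [u <-] := r_trans x y; exists (word u); rewrite invol_act_word. Qed.

Definition invol_map : emap := EMap invol_act1 invol_actM F_inh invol_trans.

Lemma invol_map_gen (x : invol_map) i : act x (gen i) = r i x.
Proof. exact: invol_act_word. Qed.

End InvolMap.

Definition aut (M : emap) : set (M -> M) :=
  [set f | bijective f /\ equivariant f].
Arguments aut M : clear implicits.

Record autgroup (M : emap) := AutGroup {
  agset :> set (M -> M);
  ag_aut : agset `<=` aut M;
  ag1 : agset id;
  agM : forall f g, agset f -> agset g -> agset (f \o g);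
  agV : forall f, agset f -> exists2 g, agset g & cancel f g }.

Section Quotient.
Variables (M : emap) (A : autgroup M).

Definition orbit_of (x : M) : set M := [set f x | f in agset A].

Definition quo_flag : Type := {B : set M | range orbit_of B}.

Lemma orbit_ofM x g : [set act y g | y in orbit_of x] = orbit_of (act x g).
Proof.
apply/seteqP; split=> [_ [_ [f Af <-] <-]|_ [f Af <-]].
  by exists f => //; have [_ ->] := ag_aut Af.
by exists (f x); [exists f|have [_ ->] := ag_aut Af].
Qed.

Lemma quo_act_subproof (B : quo_flag) (g : Gamma) :
  range orbit_of [set act y g | y in sval B].
Proof. by case: B => B0 /= [x _ <-]; rewrite orbit_ofM; exists (act x g). Qed.

Definition quo_act (B : quo_flag) (g : Gamma) : quo_flag :=
  exist _ [set act y g | y in sval B] (quo_act_subproof B g).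

Lemma quo_flag_inj (B B' : quo_flag) : sval B = sval B' -> B = B'.
Proof.
by case: B B' => [C hC] [C' hC'] /= CC'; subst C'; congr exist; exact: Prop_irrelevance.
Qed.

Lemma quo_act1 B : quo_act B 1 = B.
Proof.
by apply: quo_flag_inj; case: B => B0 /= [x _ <-]; rewrite orbit_ofM act1.
Qed.

Lemma quo_actM B g h : quo_act B (g * h) = quo_act (quo_act B g) h.
Proof.
by apply: quo_flag_inj; case: B => B0 /= [x _ <-]; rewrite !orbit_ofM actM.
Qed.

Lemma quo_inh : inhabited quo_flag.
Proof. by have [x] := flag_inh M; constructor; exists (orbit_of x); exists x. Qed.

Lemma quo_trans B B' : exists g, quo_act B g = B'.
Proof.
case: B B' => [B hB] [B' hB']; have [x _ xE] := hB; have [y _ yE] := hB'.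
have [g gE] := act_trans x y; exists g; apply: quo_flag_inj => /=.
by rewrite -xE -yE orbit_ofM gE.
Qed.

Definition quotient_map : emap := EMap quo_act1 quo_actM quo_inh quo_trans.

End Quotient.

(* a group of order 2 is a C_2 *)
Definition C2_of (M : emap) (A : autgroup M) : Prop := (agset A #= `I_2)%card.

Definition index2_with (a : seq 'I_3) (H : set Gamma) : Prop :=
  [/\ subgroup H, (right_cosets H #= `I_2)%card & forall i, H (gen i) <-> i \in a].

(* the unique such subgroup, by index2P and index2_unique below *)
Definition index2 (a : seq 'I_3) : set Gamma := xget setT (index2_with a).

Variant map_class := T1 | T2 | T2s | T2P.

Definition N (T : map_class) : set Gamma :=
  match T with
  | T1 => setT
  | T2 => index2 [:: i1; i2]
  | T2s => index2 [:: i0; i1]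
  | T2P => index2 [:: i1]
  end.

Definition N3 : set Gamma := ncl setT [set R1].

Definition in_class (T : map_class) (M : emap) : Prop :=
  forall x : M, normaliser (stab x) = N T.

Lemma subgroupV (H : set Gamma) x : subgroup H -> H x -> H x^-1.
Proof. by move=> [H1 HV] Hx; rewrite -[x^-1]mul1g; exact: HV. Qed.

Lemma subgroupM (H : set Gamma) x y : subgroup H -> H x -> H y -> H (x * y).
Proof.
by move=> sH Hx Hy; rewrite -[y]invgK; apply: sH.2 => //; exact: subgroupV.
Qed.

Lemma right_coset_eq (H : set Gamma) x y : subgroup H ->
  right_coset H x = right_coset H y <-> H (x / y).
Proof.
move=> sH; split=> [E|Hxy].
  have : right_coset H x x by exists 1; rewrite ?mul1g//; exact: sH.1.
  by rewrite E => -[h Hh <-]; rewrite mulgK.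
apply/seteqP; split=> _ [h Hh <-].
  by exists (h * (x / y)); [exact: subgroupM|rewrite mulgA mulgVK].
exists (h * (x / y)^-1); last by rewrite invgF mulgA mulgVK.
by apply: subgroupM => //; exact: subgroupV.
Qed.

Lemma index2_out (H : set Gamma) x y : subgroup H ->
  (right_cosets H #= `I_2)%card -> ~ H x -> ~ H y -> H (x * y).
Proof.
move=> sH /card_set_bijP[f [fI finj _]] Hx Hy.
have cos g : right_cosets H (right_coset H g) by exists g.
have NE g : ~ H g -> f (right_coset H g) <> f (right_coset H 1).
  move=> Hg /finj; rewrite !inE => /(_ (cos _) (cos _)) /right_coset_eq.
  by rewrite divg1 => /(_ sH).
have HyV : ~ H y^-1 by move=> /(subgroupV sH); rewrite invgK.
have := finj (right_coset H x) (right_coset H y^-1).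
rewrite !inE => /(_ (cos _) (cos _)).
have := NE _ Hx; have := NE _ HyV.
have := fI _ (cos x); have := fI _ (cos y^-1); have := fI _ (cos 1).
move: (f (right_coset H x)) (f (right_coset H y^-1)) (f (right_coset H 1)) => /=.
move=> [|[|//]] [|[|//]] [|[|//]] //= _ _ _ _ _ /(_ erefl)/right_coset_eq;
  by rewrite invgK; exact.
Qed.

Definition out_parity (a : seq 'I_3) (u : seq 'I_3) : bool :=
  odd (count (fun i => i \notin a) u).

Lemma out_parityP a u v : weq u v -> out_parity a u = out_parity a v.
Proof.
rewrite /out_parity; elim=> {u v} [u|u v _ ->|u v w _ -> _ ->|u u' v v' _ IH _ IH'|i|] //=.
- by rewrite !count_cat !oddD IH IH'.
- by rewrite addn0 addnn odd_double.
- by case: (_ \in _); case: (_ \in _).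
Qed.

Lemma index2_unique a (H K : set Gamma) :
  index2_with a H -> index2_with a K -> H = K.
Proof.
suff E H' : index2_with a H' -> forall u, H' (word u) <-> ~~ out_parity a u.
  move=> hH hK; have EH := E _ hH; have EK := E _ hK; apply/seteqP; split=> g; have [u ->] := wordP g.
    by move=> /EH/EK.
  by move=> /EK/EH.
move=> [sH iH Ha]; elim=> [|i u IH]; first by split=> // _; exact: sH.1.
rewrite word_cons /out_parity /= oddD -/(out_parity a u).
have [ia|ia] := boolP (i \in a); rewrite /= ?oddb /=.
  have Hi : H' (gen i) by exact/Ha.
  split=> [Hiu|/IH]; last exact: subgroupM.
  apply/IH; rewrite -[word u]mul1g -(gen_sq i) -mulgA; exact: subgroupM.
have Hi : ~ H' (gen i) by move/Ha; apply/negP.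
split=> [Hiu|].
  rewrite negbK; apply/negPn/negP => /IH Hu; apply: Hi.
  by rewrite -[gen i](mulgK (word u)); exact: sH.2.
rewrite negbK => pu; apply: index2_out => //.
by move/IH; rewrite pu.
Qed.

Lemma index2P a i : i \notin a -> index2_with a (index2 a).
Proof.
move=> ia; apply: xgetPex; pose p (g : Gamma) := out_parity a (repr g).
have pE u : p (word u) = out_parity a u by exact/out_parityP/weq_repr.
have p1 : p 1 = false := pE [::].
have pM g h : p (g * h) = p g (+) p h.
  have [u ->] := wordP g; have [v ->] := wordP h.
  by rewrite -wordM !pE /out_parity count_cat oddD.
have pV g : p g^-1 = p g.
  by move: (pM g^-1 g); rewrite mulVg p1; do 2 case: (p _).
exists [set g | ~~ p g].
have sH : subgroup [set g | ~~ p g].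
  split=> [|x y] /=; first by rewrite p1.
  by rewrite pM pV; do 2 case: (p _).
have pi : p (gen i) by rewrite pE /out_parity /= ia.
split=> //; last first.
  by move=> j; rewrite /= pE /out_parity /=; case: (j \in a).
apply/card_set_bijP.
exists (fun A => if 1 \in A then 0%N else 1%N); split.
- by move=> A _ /=; case: ifP.
- move=> A B; rewrite !inE => -[g _ <-] [h _ <-] E; apply/right_coset_eq => //=.
  have mem k : (1 \in right_coset [set g | ~~ p g] k) = ~~ p k.
    apply/idP/idP; first by rewrite inE => -[l /= + /(congr1 p)]; rewrite pM p1; do 2 case: (p _).
    by move=> pk; rewrite inE; exists k^-1; rewrite /= ?pV// mulVg.
  by move: E; rewrite !mem pM pV; do 2 case: (p _).
- move=> [|[|//]] _.
    exists (right_coset [set g | ~~ p g] 1); first by exists 1.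
    by rewrite ifT// inE; exists 1; rewrite ?mulg1//=; exact: sH.1.
  exists (right_coset [set g | ~~ p g] (gen i)); first by exists (gen i).
  rewrite ifF//; apply/negbTE/negP; rewrite inE => -[l /= + /(congr1 p)].
  by rewrite pM p1 pi; case: (p l).
Qed.

(* An index in {1, 2, ...} or infinity; None stands for infinity. *)
Definition natinf := option nat.
Definition natinf_pos (n : natinf) : bool := if n is Some k then (0 < k)%N else true.

Definition power_relator (x : Gamma) (n : natinf) : set Gamma :=
  if n is Some k then [set x ^+ k] else set0.

Definition mapA (n : natinf) : emap :=
  coset_map (ncl setT (R0 |` power_relator (R1 * R2) n)).

(* A flag (v, b) of the circuit is a vertex v with the edge joining it to its
   successor (b = true) or predecessor (b = false); there is only one face, and
   R_2 fixes every flag since all edges lie along the boundary. *)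
Section Circuit.
Variables (V : Type) (v0 : V) (next prev : V -> V).
Hypotheses (nextK : cancel next prev) (prevK : cancel prev next).
Hypothesis conn : forall v w, exists k, iter k next v = w \/ iter k prev v = w.

Definition circuit_gen (i : 'I_3) (x : V * bool) : V * bool :=
  let: (v, b) := x in
  if i == i0 then (if b then (next v, false) else (prev v, true))
  else if i == i1 then (v, ~~ b)
  else x.

Lemma circuit_sq i x : circuit_gen i (circuit_gen i x) = x.
Proof.
by case: x => v b; elim/I3E: i; case: b; rewrite /circuit_gen /= ?nextK ?prevK.
Qed.

Lemma circuit_02 x :
  circuit_gen i2 (circuit_gen i0 x) = circuit_gen i0 (circuit_gen i2 x).
Proof. by case: x => v []. Qed.

Lemma circuit_inh : inhabited (V * bool).
Proof. by constructor; exact: (v0, true). Qed.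

Lemma circuit_trans x y :
  exists u, foldl (fun z i => circuit_gen i z) x u = y.
Proof.
pose reach x y := exists u, foldl (fun z i => circuit_gen i z) x u = y.
have tr x' y' z' : reach x' y' -> reach y' z' -> reach x' z'.
  by move=> [u <-] [w <-]; exists (u ++ w); rewrite foldl_cat.
have flip v b c : reach (v, b) (v, c).
  by case: b c => [] []; by [exists [::] | exists [:: i1]].
have up k v : reach (v, true) (iter k next v, true).
  elim: k => [|k IH]; first exact: flip.
  by apply: tr IH _; exists [:: i0; i1].
have down k v : reach (v, false) (iter k prev v, false).
  elim: k => [|k IH]; first exact: flip.
  by apply: tr IH _; exists [:: i0; i1].
case: x y => [v b] [w c]; have [k [<-|<-]] := conn v w.
  exact: tr (flip v b true) (tr _ _ _ (up k v) (flip _ _ _)).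
exact: tr (flip v b false) (tr _ _ _ (down k v) (flip _ _ _)).
Qed.

Definition circuit : emap :=
  invol_map circuit_sq circuit_02 circuit_inh circuit_trans.

End Circuit.

Lemma ordS_conn n (v w : 'I_n.+1) :
  exists k, iter k (@ordS n.+1) v = w \/ iter k (@ord_pred n.+1) v = w.
Proof.
have up k : val (iter k (@ordS n.+1) v) = ((v + k) %% n.+1)%N.
  elim: k => [|k IH]; first by rewrite addn0 modn_small.
  by rewrite iterS /= IH -addn1 modnDml -addnA addn1.
exists (w + (n.+1 - v))%N; left; apply: val_inj; rewrite /= up addnCA subnKC.
  by rewrite modnDr modn_small.
exact: ltnW.
Qed.

Lemma int_conn (v w : int) :
  exists k, iter k (fun z => z + 1)%R v = w \/ iter k (fun z => z - 1)%R v = w.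
Proof.
have up k : iter k (fun z : int => z + 1)%R v = (v + k%:Z)%R.
  by elim: k => [|k IH]; rewrite ?GRing.addr0// iterS IH -GRing.addrA -addn1.
have down k : iter k (fun z : int => z - 1)%R v = (v - k%:Z)%R.
  elim: k => [|k IH]; rewrite ?GRing.subr0// iterS IH -addn1 PoszD.
  by rewrite GRing.opprD GRing.addrA.
have : (w - v = (w - v))%R by []; case: {2}(w - v)%R => k E.
  by exists k; left; rewrite up -E GRing.addrC GRing.subrK.
exists k.+1; right; rewrite down -[X in (_ + X)%R]/(Negz k) -E.
by rewrite GRing.addrC GRing.subrK.
Qed.

(* For finite n >= 1 the type 'I_n.-1.+1 is 'I_n. *)
Definition mapC (n : natinf) : emap :=
  match n with
  | Some k => circuit ord0 (@ordSK k.-1.+1) (@ord_predK k.-1.+1) (@ordS_conn k.-1)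
  | None => circuit 0%R (@GRing.addrK int 1%R) (@GRing.subrK int 1%R) int_conn
  end.

(* The four flags of K_2 embedded as a diameter: an end of the edge and a side
   of it; every flag abuts the boundary along its edge from vertex to face. *)
Definition K2_gen (i : 'I_3) (x : bool * bool) : bool * bool :=
  if i == i0 then (~~ x.1, x.2) else if i == i2 then (x.1, ~~ x.2) else x.

Lemma K2_sq i x : K2_gen i (K2_gen i x) = x.
Proof. by elim/I3E: i; case: x => [[] []]. Qed.

Lemma K2_02 x : K2_gen i2 (K2_gen i0 x) = K2_gen i0 (K2_gen i2 x).
Proof. by []. Qed.

Lemma K2_inh : inhabited (bool * bool).
Proof. by constructor; exact: (true, true). Qed.

Lemma K2_trans x y : exists u, foldl (fun z i => K2_gen i z) x u = y.
Proof.
case: x y => [[] []] [[] []];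
  by [exists [::] | exists [:: i0] | exists [:: i2] | exists [:: i0; i2]].
Qed.

Definition mapB : emap := invol_map K2_sq K2_02 K2_inh K2_trans.

Definition mapD : emap := coset_map (ncl setT [set R0; R2]).

(* One vertex and one half-edge along the boundary: a single flag. *)
Lemma unit_trans (x y : unit) : exists u : seq 'I_3, foldl (fun z _ => z) x u = y.
Proof. by exists [::]; case: x y => -[]. Qed.

Definition mapT : emap :=
  invol_map (r := fun _ z => z) (fun _ (x : unit) => erefl x) (@erefl unit)
    (inhabits tt) unit_trans.

Definition mapN (T : map_class) : emap := coset_map (N T).

Definition mapN3 : emap := coset_map N3.

Definition S1 : Gamma := R1.
Definition S2 : Gamma := R1 ^ R0.
Definition S3 : Gamma := R2.

Definition mapM2 (n : natinf) : emap :=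
  coset_map (ncl (N T2) (S1 |` power_relator (S2 * S3) n)).

Definition mapM20 : emap := coset_map (ncl (N T2) [set S1; S3]).

Definition mapM2s (n : natinf) : emap := dual_map (mapM2 n).
Definition mapM2s0 : emap := dual_map mapM20.
Definition mapM2P (n : natinf) : emap := petrie_map (mapM2s n).
Definition mapM2P0 : emap := petrie_map mapM2s0.

Local Close Scope group_scope.
Local Open Scope ring_scope.

(** standard triangle, in barycentric coordinates; the corners 0, 1, 2 of a
    flag are its vertex, edge midpoint and face centre, and side i is opposite
    to corner i *)
Definition triangle (R : realType) : set 'rV[R]_3 :=
  [set x | (forall i, 0 <= x ord0 i) /\ \sum_i x ord0 i = 1].

(** the points with coordinates t in the triangles of x and y coincide: the
    triangles of x and x R_i share their side i *)
Definition glued (R : realType) (M : emap) (t : 'rV[R]_3) (x y : M) : Prop :=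
  exists2 g, generated [set gen i | i in [set i | t ord0 i = 0]] g & act x g = y.

(** M embeds in the surface S, h being the barycentric subdivision of the
    embedded map. Away from the points lying in infinitely many triangles,
    i.e. the vertices of infinite valency and the centres of faces with
    infinitely many sides, the subdivision is locally finite, so that S has
    there the topology obtained by gluing the triangles. *)
Definition lies_on (R : realType) (M : emap) (X : topologicalType) (S : set X) :=
  exists h : M -> 'rV[R]_3 -> X,
  [/\ forall x, {within @triangle R, continuous (h x)},
      forall x y s t, triangle s -> triangle t ->
        (h x s = h y t <-> s = t /\ glued s x y),
      \bigcup_x h x @` @triangle R = S &
      forall p, S p -> finite_set [set x | (h x @` @triangle R) p] ->
        exists2 U, nbhs p U &
          finite_set [set x | h x @` @triangle R `&` U !=set0]].

Arguments lies_on R M {X} S : rename.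

Definition closed_disc (R : realType) : set (R * R) :=
  [set p | p.1 ^+ 2 + p.2 ^+ 2 <= 1].

Definition annulus (R : realType) : set (R * R) :=
  [set p | 1 <= p.1 ^+ 2 + p.2 ^+ 2 <= 4].

Definition strip (R : realType) : set (R * R) := [set p | 0 <= p.2 <= 1].

Definition moebius_param (R : realType) (p : R * R) : R * R * R :=
  let: (u, v) := p in
  let r := 2 + v * cos (u / 2) in (r * cos u, r * sin u, v * sin (u / 2)).

Definition moebius_band (R : realType) : set (R * R * R) :=
  @moebius_param R @` [set p | 0 <= p.1 <= 2 * pi /\ -1 <= p.2 <= 1].

Arguments closed_disc R : clear implicits.
Arguments annulus R : clear implicits.
Arguments strip R : clear implicits.
Arguments moebius_band R : clear implicits.

(* Main.v *)
Require Import Defs.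
From mathcomp Require Import all_boot all_order all_algebra.
From mathcomp Require Import all_classical all_reals all_analysis.
From mathcomp Require Import zify lra.

Import numFieldNormedType.Exports.
Set Implicit Arguments.
Unset Strict Implicit.
Unset Printing Implicit Defensive.

(** A map is studied through the stabiliser H of one of its flags. Equal
    stabilisers mean isomorphic maps ([map_iso_of_stab]), the map has a boundary
    when some stabiliser contains some R_i, and its class is the normaliser of H.
    So the classification is about subgroups H of Gamma which contain an R_i and
    are normal in N(T).

    For T = 1, a normal subgroup containing R_1 lies above N(3), whose quotient is
    a four-group: this gives B, its three quotients and T. A normal subgroup
    containing R_0 comes from the infinite dihedral group which R_1 and R_2
    generate modulo R_0, and the normal subgroups of that group are known
    ([dih_traceP]): this gives the maps A_n and D. Duality settles R_2.

    For T = 2, N(2) is generated by the involutions S_1, S_2 and S_3, and R_0, which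
    lies outside N(2), exchanges S_1 and S_2 and fixes S_3 by conjugation. Since R_0
    does not normalise H, one may assume that H contains S_1 but not S_2; then
    N(2) / H is generated by the images of S_2 and S_3, and again H comes from a
    dihedral group ([class2_iso]). Duality and Petrie duality carry this to the
    classes 2* and 2P, because R_1 always belongs to a stabiliser. The subgroups
    found are told apart by explicit actions: the circuits for A_n, and, for
    M_(2,n), the map [double] obtained from A_n by splitting its edges.

    For the surfaces, an embedding is an explicit family of parametrised triangles,
    which must agree on the sides that are glued and overlap nowhere else
    ([tiling]). Most maps are reduced to others: renaming corners covers
    isomorphism, duality and the quotients of B ([lies_on_corners]), and splitting
    triangles covers M_(2,n) and M_(2,0) ([lies_on_double]). There remain a few
    models. The maps with one, two or four triangles are tiled by square roots of
    barycentric coordinates. The flags of A_n are pieces of a line, wrapped round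
    the centre of the disc when n is finite, and seen in a half-plane with the
    vertex at infinity when n is infinite ([cayley]). The Petrie dual of the dual of
    M_(2,infinity) is a row of squares cut along their diagonals. Its finite
    analogues are quotients by the glide reflections of length n, hence annuli or
    Moebius bands according to the parity of n ([lies_on_strip_quotient]). *)


(** * Integer powers and pairs of involutions *)

Section Dihedral.
Local Open Scope classical_set_scope.
Local Open Scope group_scope.

Definition zpow (G : groupType) (x : G) (k : int) : G :=
  match k with Posz n => x ^+ n | Negz n => x^-1 ^+ n.+1 end.

Lemma zpowS (G : groupType) (x : G) (k : int) : zpow x (k + 1)%R = zpow x k * x.
Proof.
case: k => [n|[|n]].
- by rewrite -[(_ + _)%R]/(Posz (n + 1)) /= addn1 expgSr.
- by rewrite /= expg1 mulVg.
- have -> : (Negz n.+1 + 1 = Negz n)%R.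
    by rewrite !NegzE -[n.+2]addn1 PoszD GRing.opprD GRing.subrK.
  by rewrite /= [in RHS]expgSr mulgVK.
Qed.

Lemma zpowB1 (G : groupType) (x : G) (k : int) : zpow x (k - 1)%R = zpow x k * x^-1.
Proof. by rewrite -[in RHS](GRing.subrK 1%R k) zpowS mulgK. Qed.

Lemma zpowD (G : groupType) (x : G) (k l : int) :
  zpow x (k + l)%R = zpow x k * zpow x l.
Proof.
elim/int_rect: l => [|n IH|n IH].
- by rewrite GRing.addr0 mulg1.
- by rewrite -addn1 PoszD GRing.addrA !zpowS IH mulgA.
- by rewrite -addn1 PoszD GRing.opprD GRing.addrA !zpowB1 IH mulgA.
Qed.

Lemma zpowN (G : groupType) (x : G) (k : int) : zpow x (- k)%R = (zpow x k)^-1.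
Proof. by apply: (mulgI (zpow x k)); rewrite -zpowD GRing.subrr mulgV. Qed.

Lemma zpowM (G : groupType) (x : G) (k l : int) :
  zpow x (k * l)%R = zpow (zpow x k) l.
Proof.
elim/int_rect: l => [|n IH|n IH].
- by rewrite GRing.mulr0.
- by rewrite -addn1 PoszD GRing.mulrDr GRing.mulr1 zpowS zpowD IH.
- rewrite -addn1 PoszD GRing.opprD GRing.mulrDr GRing.mulrN1 zpowB1 zpowD IH.
  by rewrite (zpowN x k).
Qed.

Lemma zpowJ (G : groupType) (x y : G) (k : int) : zpow (x ^ y) k = zpow x k ^ y.
Proof. by case: k => n; rewrite /= -?conjVg -conjXg. Qed.

Lemma zpowV (G : groupType) (x : G) (k : int) : zpow x^-1 k = zpow x (- k)%R.
Proof.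
elim/int_rect: k => [|n IH|n IH] //.
by rewrite -addn1 PoszD GRing.opprD zpowB1 IH GRing.opprD zpowD invgK.
Qed.

(** The infinite dihedral group generated by a and b is listed by int * bool:
    (k, true) stands for (a b) ^ k and (k, false) for (a b) ^ k b. *)
Definition alt (G : groupType) (a b : G) (l : int * bool) : G :=
  zpow (a * b) l.1 * (if l.2 then 1 else b).

Definition step_a (l : int * bool) : int * bool :=
  (if l.2 then (l.1 + 1)%R else (l.1 - 1)%R, ~~ l.2).

Definition step_b (l : int * bool) : int * bool := (l.1, ~~ l.2).

Lemma step_aK l : step_a (step_a l) = l.
Proof.
by case: l => k []; rewrite /step_a /= ?GRing.addrK ?GRing.subrK.
Qed.

Lemma step_bK l : step_b (step_b l) = l.
Proof. by case: l => k []. Qed.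

Section Involutions.
Variables (G : groupType) (a b : G).
Hypotheses (aa : a * a = 1) (bb : b * b = 1).

Lemma invol_inv : b^-1 = b.
Proof. by apply: (mulgI b); rewrite mulgV bb. Qed.

Lemma alt_step_b l : alt a b l * b = alt a b (step_b l).
Proof. by case: l => k []; rewrite /alt /= ?mulg1 // -mulgA bb mulg1. Qed.

Lemma alt_step_a l : alt a b l * a = alt a b (step_a l).
Proof.
case: l => k []; rewrite /alt /= ?mulg1.
  by rewrite zpowS -!mulgA bb mulg1.
rewrite zpowB1 -mulgA; congr (_ * _); apply: (mulgI (a * b)).
by rewrite mulgV !mulgA -[a * b * b]mulgA bb mulg1 aa.
Qed.

Lemma zpow_invol m : b * zpow (a * b) m = zpow (a * b) (- m)%R * b.
Proof.
have -> : (zpow (a * b) (- m)%R = zpow (a * b) m ^ b).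
  rewrite -zpowJ -zpowV; congr zpow; apply: (mulgI (a * b)).
  by rewrite mulgV conjgE invol_inv !mulgA -[a * b * b]mulgA bb mulg1 aa mul1g.
by rewrite conjgE invol_inv -!mulgA bb mulg1.
Qed.

Lemma alt_shift k m :
  alt a b (k, false) ^ zpow (a * b) m = alt a b (k - m - m, false)%R.
Proof.
rewrite /alt /= conjgE -zpowN -mulgA zpow_invol !mulgA -!zpowD.
by rewrite [(- m + k)%R]GRing.addrC.
Qed.

End Involutions.

Lemma alt_swap (G : groupType) (a b : G) l : a * a = 1 -> b * b = 1 ->
  alt b a l = alt a b (if l.2 then (- l.1, true)%R else step_a (- l.1, true)%R).
Proof.
move=> aa bb; have -> : alt b a l = zpow (a * b) (- l.1)%R * (if l.2 then 1 else a).
  rewrite /alt -zpowV; congr (zpow _ _ * _).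
  by apply: (mulgI (a * b)); rewrite mulgV !mulgA -[a * b * b]mulgA bb mulg1 aa.
case: l => k [] /=; first by rewrite /alt.
by rewrite -(alt_step_a aa bb) /alt /= mulg1.
Qed.

End Dihedral.

(** * Subgroups of the group Gamma *)

Section Subgroups.
Local Open Scope classical_set_scope.
Local Open Scope group_scope.
Implicit Types (H K A : set Gamma) (g h : Gamma).

Lemma normaliserP H g : normaliser H g <-> (forall h, H (h ^ g) <-> H h).
Proof.
split=> [E h|E]; last first.
  apply/seteqP; split=> [_ [h Hh <-]|h Hh]; first exact/E.
  by exists (h ^ g^-1); [apply/E|]; rewrite -conjgM mulVg conjg1.
split=> [|Hh]; last by rewrite -E; exists h.
by rewrite -[in X in X -> _]E => -[k Hk /conjg_inj <-].
Qed.

Lemma normaliser_subgroup H : subgroup (normaliser H).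
Proof.
split=> [|x y /normaliserP Nx /normaliserP Ny]; apply/normaliserP => h.
  by rewrite conjg1.
by move: (Ny (h ^ (x / y))) (Nx h); rewrite -conjgM mulgVK; tauto.
Qed.

Lemma normaliserJ H h g : normaliser H g -> H h -> H (h ^ g).
Proof. by move=> /normaliserP->. Qed.

Lemma sub_normaliser H : subgroup H -> H `<=` normaliser H.
Proof.
move=> sH g Hg; apply/normaliserP => h; split=> Hh; last first.
  by rewrite conjgE; apply: subgroupM (subgroupM _ _ _) => //; apply: subgroupV.
rewrite -[h](mulgK g) -[h * g](mulVKg g) -mulgA -conjgE mulgA.
by apply: sH.2 => //; apply: subgroupM.
Qed.

Lemma subgroupI H K : subgroup H -> subgroup K -> subgroup (H `&` K).
Proof.
move=> sH sK; split=> [|x y [Hx Kx] [Hy Ky]]; split;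
  by [exact: sH.1|exact: sK.1|exact: sH.2|exact: sK.2].
Qed.

Lemma normaliserI H K g :
  normaliser H g -> normaliser K g -> normaliser (H `&` K) g.
Proof.
move=> /normaliserP nH /normaliserP nK; apply/normaliserP => h.
by split=> -[/nH ? /nK ?].
Qed.

Lemma subgroup_zpow H x k : subgroup H -> H x -> H (zpow x k).
Proof.
move=> sH Hx; elim/int_rect: k => [|n IH|n IH]; first exact: sH.1.
  by rewrite -addn1 PoszD zpowS; apply: subgroupM.
by rewrite -addn1 PoszD GRing.opprD zpowB1; apply: sH.2.
Qed.

Lemma subgroupVE H x : subgroup H -> H x^-1 <-> H x.
Proof. by move=> sH; split=> /(subgroupV sH); rewrite ?invgK. Qed.

Lemma subgroup_alt H a b l : subgroup H -> H a -> H b -> H (alt a b l).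
Proof.
move=> sH Ha Hb; apply: subgroupM => //.
  by apply: subgroup_zpow => //; apply: subgroupM.
by case: l.2 => //; exact: sH.1.
Qed.

Lemma ncl_subgroup K A : subgroup (ncl K A).
Proof.
split=> [H [[]]//|x y Cx Cy H HA]; have [sH _ _] := HA.
by apply: sH.2; [exact: Cx|exact: Cy].
Qed.

Lemma sub_ncl K A : A `<=` ncl K A.
Proof. by move=> g Ag H [_ AH _]; exact: AH. Qed.

Lemma ncl_norm K A : K `<=` normaliser (ncl K A).
Proof.
move=> k Kk; apply/normaliserP => h.
by split=> C H HA; have [sH _ KH] := HA; have /normaliserP E := KH _ Kk;
  apply/E; apply: C.
Qed.

Lemma ncl_min K A H :
  subgroup H -> A `<=` H -> K `<=` normaliser H -> ncl K A `<=` H.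
Proof. by move=> sH AH KH g; apply. Qed.

Lemma same_coset H g h : subgroup H -> H (g / h) -> H g <-> H h.
Proof.
move=> sH Hgh; split=> Hx; last by rewrite -[g](mulgVK h); exact: subgroupM.
by rewrite -[h](mulgVK g) -invgF; apply: subgroupM => //; exact: subgroupV.
Qed.

(** All the identifications of subgroups below go through this criterion: modulo
    a normal closure contained in both, only finitely many elements, or those of
    a dihedral group, remain to be compared. *)
Lemma eq_by_transversal (T : set Gamma) H H' : subgroup H -> subgroup H' ->
  (forall g, H g \/ H' g -> exists2 t, T t & (H `&` H') (g / t)) ->
  (forall t, T t -> H t <-> H' t) -> H = H'.
Proof.
move=> sH sH' cov TE; apply/seteqP; split=> g Hg.
  have [t Tt [Ht H't]] := cov g (or_introl Hg).
  exact/(same_coset sH' H't)/(TE t Tt)/(same_coset sH Ht).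
have [t Tt [Ht H't]] := cov g (or_intror Hg).
exact/(same_coset sH Ht)/(TE t Tt)/(same_coset sH' H't).
Qed.

Lemma gamma_ind (P : Gamma -> Prop) :
  P 1 -> (forall g i, P g -> P (g * gen i)) -> forall g, P g.
Proof.
move=> P1 PM g; have [u ->] := wordP g; elim/last_ind: u => [|u i IH] //.
by rewrite -cats1 wordM; exact: PM.
Qed.

(** Schreier's argument: a set T of representatives closed, modulo a subgroup
    on the left, under right multiplication by the generators meets all the
    right cosets. *)
Lemma cosets_cover (T K : set Gamma) : subgroup K -> T 1 ->
  (forall t i, T t -> exists2 t', T t' & K (t * gen i / t')) ->
  forall g, exists2 t, T t & K (g / t).
Proof.
move=> sK T1 TM; elim/gamma_ind => [|g i [t Tt Kt]].
  by exists 1 => //; rewrite divg1; exact: sK.1.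
have [t' Tt' Kt'] := TM t i Tt; exists t' => //.
by rewrite -[g](mulgVK t) -!mulgA mulgA; apply: subgroupM => //; rewrite mulgA.
Qed.

(** For s in K, the element t represents the coset of t s as well; this settles
    the generators lying in K when Schreier's argument is applied. *)
Lemma absorb K t s : normaliser K t -> K s -> K (t * s / t).
Proof.
move=> Nt Ks.
have NV := subgroupV (normaliser_subgroup K) Nt.
by have := normaliserJ NV Ks; rewrite conjgE invgK mulgA.
Qed.

End Subgroups.

(** * Maps and their stabilisers *)

Section Maps.
Local Open Scope classical_set_scope.
Local Open Scope group_scope.
Implicit Types (M : emap) (H K : set Gamma).

Lemma actK M (x : M) g : act (act x g) g^-1 = x.
Proof. by rewrite -actM mulgV act1. Qed.

Lemma actVK M (x : M) g : act (act x g^-1) g = x.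
Proof. by rewrite -actM mulVg act1. Qed.

Lemma act_gen_sq M (x : M) i : act (act x (gen i)) (gen i) = x.
Proof. by rewrite -actM gen_sq act1. Qed.

Lemma stab_subgroup M (x : M) : subgroup (stab x).
Proof.
split=> [|g h gx hx]; rewrite /stab /=; first exact: act1.
by rewrite actM gx -[X in act X _]hx actK.
Qed.

Lemma stab_act M (x : M) g : stab (act x g) = conj_set (stab x) g.
Proof.
apply/seteqP; split=> [h hx|_ [h hx <-]].
  exists (h ^ g^-1); last by rewrite -conjgM mulVg conjg1.
  by rewrite /stab /= conjgE invgK !actM hx actK.
by rewrite /stab /= conjgE -actM mulVKg actM hx.
Qed.

(** The stabiliser of a flag determines everything about the map seen from that
    flag: an inclusion of stabilisers is the same thing as a covering. *)
Lemma covering_of_stab M M' (x : M) (y : M') : stab x `<=` stab y ->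
  exists2 f : M -> M', equivariant f & f x = y.
Proof.
move=> xy.
have wd g h : act x g = act x h -> act y g = act y h.
  move=> E; have : stab y (g / h) by apply: xy; rewrite /stab /= actM E actK.
  by rewrite /stab /= actM => E'; rewrite -[in RHS]E' actVK.
pose w z := projT1 (cid (act_trans x z)).
have wE z : act x (w z) = z by rewrite /w; case: cid.
exists (fun z => act y (w z)) => [z g|].
  by rewrite -actM; apply: wd; rewrite actM !wE.
by rewrite -[RHS]act1; apply: wd; rewrite wE act1.
Qed.

Lemma equivariant_eq M M' (f g : M -> M') (x : M) :
  equivariant f -> equivariant g -> f x = g x -> f =1 g.
Proof. by move=> fE gE E y; have [h <-] := act_trans x y; rewrite fE gE E. Qed.

Lemma map_iso_of_stab M M' (x : M) (y : M') : stab x = stab y -> map_iso M M'.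
Proof.
move=> E; have [f fE fx] : exists2 f : M -> M', equivariant f & f x = y.
  by apply: covering_of_stab; rewrite E.
have [g gE gy] : exists2 g : M' -> M, equivariant g & g y = x.
  by apply: covering_of_stab; rewrite E.
exists f; split => //; exists g => z.
  by apply: (@equivariant_eq M M (g \o f) id x) => // [u h|];
    rewrite /= ?fE ?gE ?fx.
by apply: (@equivariant_eq M' M' (f \o g) id y) => // [u h|];
  rewrite /= ?gE ?fE ?gy.
Qed.

Lemma map_iso_stab M M' (y : M') : map_iso M M' -> exists x : M, stab x = stab y.
Proof.
move=> [f [[g fg gf] fE]]; exists (g y).
apply/seteqP; split=> h; rewrite /stab /= => E.
  by rewrite -[y]gf -fE E.
by rewrite -[LHS]fg fE gf E.
Qed.

Lemma map_isoP M M' (y : M') : map_iso M M' <-> exists x : M, stab x = stab y.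
Proof.
by split=> [/(map_iso_stab y)//|[x /map_iso_of_stab]].
Qed.

Lemma map_iso_sym M M' : map_iso M M' -> map_iso M' M.
Proof.
have [x] := flag_inh M => i.
have [y] := flag_inh M'; have [z E] := map_iso_stab y i.
exact: map_iso_of_stab (esym E).
Qed.

Lemma map_iso_trans M M' M'' : map_iso M M' -> map_iso M' M'' -> map_iso M M''.
Proof.
have [z] := flag_inh M'' => i i'; have [y yz] := map_iso_stab z i'.
have [x xy] := map_iso_stab y i; apply: (@map_iso_of_stab _ _ x z).
by rewrite xy.
Qed.

Lemma map_iso_coset M H : subgroup H ->
  map_iso M (coset_map H) <-> exists x : M, stab x = H.
Proof.
by move=> sH; have [y yE] := stab_coset_map sH; rewrite (map_isoP M y) yE.
Qed.

Lemma map_iso_dual M M' :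
  map_iso M (dual_map M') <-> map_iso (dual_map M) M'.
Proof.
have [y] := flag_inh M'.
rewrite (map_isoP M (y : dual_map M')) (map_isoP (dual_map M) y) stab_dual.
split=> -[x E]; exists x; first by rewrite stab_dual E image_comp;
  apply: eq_image_id => g /=; rewrite deltaK.
by rewrite -E stab_dual image_comp eq_image_id// => g /=; rewrite deltaK.
Qed.

Lemma map_iso_petrie M M' :
  map_iso M (petrie_map M') <-> map_iso (petrie_map M) M'.
Proof.
have [y] := flag_inh M'.
rewrite (map_isoP M (y : petrie_map M')) (map_isoP (petrie_map M) y) stab_petrie.
split=> -[x E]; exists x; first by rewrite stab_petrie E image_comp;
  apply: eq_image_id => g /=; rewrite petrieK.
by rewrite -E stab_petrie image_comp eq_image_id// => g /=; rewrite petrieK.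
Qed.

Lemma has_boundaryP M :
  has_boundary M <-> exists (x : M) (i : 'I_3), stab x (gen i).
Proof.
split=> [[x [i [g xg]]]|[x [i xi]]]; last by exists x, i, 1; rewrite conjg1.
exists (act x g^-1), i; move: xg; rewrite /stab /= conjgE !actM => E.
by rewrite -{2}E actK.
Qed.

Lemma has_boundary_iso M M' (y : M') i :
  map_iso M M' -> stab y (gen i) -> has_boundary M.
Proof.
by move=> /(map_iso_stab y)[x E] yi; apply/has_boundaryP; exists x, i; rewrite E.
Qed.

Lemma normaliser_conj H g : normaliser (conj_set H g) = conj_set (normaliser H) g.
Proof.
have mem A h : conj_set A g h <-> A (h ^ g^-1).
  split=> [[k Ak <-]|Ah]; first by rewrite -conjgM mulgV conjg1.
  by exists (h ^ g^-1) => //; rewrite -conjgM mulVg conjg1.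
apply/seteqP; split=> h.
  move=> /normaliserP E; apply/mem/normaliserP => k.
  move: (E (k ^ g)); rewrite !mem -!conjgM mulgV conjg1 => <-.
  by rewrite [h ^ _]conjgE invgK.
move=> /mem/normaliserP E; apply/normaliserP => k; rewrite !mem.
by move: (E (k ^ g^-1)); rewrite -!conjgM [h ^ _]conjgE invgK mulKg.
Qed.

Lemma in_classP T M (x : M) : setT `<=` normaliser (N T) ->
  in_class T M <-> normaliser (stab x) = N T.
Proof.
move=> nN; split=> [|E y]; first exact.
by have [g <-] := act_trans x y; rewrite stab_act normaliser_conj E nN.
Qed.

End Maps.

(** * The subgroups N(T) *)

Section IndexTwo.
Local Open Scope classical_set_scope.
Local Open Scope group_scope.
Implicit Types (H K : set Gamma).
Arguments N T : simpl never.

Lemma index2_mul a j g i : j \notin a ->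
  index2 a (g * gen i) <-> (if i \in a then index2 a g else ~ index2 a g).
Proof.
move=> /index2P[sN cN aN]; case: ifPn => ia.
  have Ni : index2 a (gen i) by apply/aN.
  split=> [Ngi|Ng]; last exact: subgroupM.
  by rewrite -[g](mulgK (gen i)); exact: sN.2.
have Ni : ~ index2 a (gen i) by move/aN; exact/negP.
split=> [Ngi Ng|Ng]; last exact: index2_out.
by apply: Ni; rewrite -[gen i](mulKg g); apply: subgroupM => //; exact: subgroupV.
Qed.

Lemma index2_subgroup a j : j \notin a -> subgroup (index2 a).
Proof. by case/index2P. Qed.

Lemma index2_gen a j i : j \notin a -> index2 a (gen i) <-> i \in a.
Proof. by case/index2P. Qed.

Lemma index2_normal a j : j \notin a -> setT `<=` normaliser (index2 a).
Proof.
move=> ja; have [sN cN _] := index2P ja.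
move=> g _; apply/normaliserP => h.
suff E x y : index2 a x -> index2 a (x ^ y).
  by split=> [/(E _ g^-1)|/E//]; rewrite -conjgM mulgV conjg1.
move=> Nx; have [Ny|Ny] := pselect (index2 a y).
  by rewrite conjgE; apply: subgroupM (subgroupM _ _ _) => //; exact: subgroupV.
rewrite conjgE; apply: index2_out => //; first by rewrite subgroupVE.
by move=> Nxy; apply: Ny; rewrite -[y](mulKg x); apply: subgroupM => //;
  exact: subgroupV.
Qed.

Lemma N_normal T : setT `<=` normaliser (N T).
Proof.
case: T; [|exact: (@index2_normal _ i0)|exact: (@index2_normal _ i2)|
  exact: (@index2_normal _ i0)].
by move=> g _; apply/normaliserP.
Qed.

Lemma N2_mul g i :
  N T2 (g * gen i) <-> (if i == i0 then ~ N T2 g else N T2 g).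
Proof. by rewrite /N (@index2_mul _ i0)//; elim/I3E: i. Qed.

Lemma N2s_mul g i :
  N T2s (g * gen i) <-> (if i == i2 then ~ N T2s g else N T2s g).
Proof. by rewrite /N (@index2_mul _ i2)//; elim/I3E: i. Qed.

Lemma N2P_mul g i :
  N T2P (g * gen i) <-> (if i == i1 then N T2P g else ~ N T2P g).
Proof. by rewrite /N (@index2_mul _ i0)//; elim/I3E: i. Qed.

Lemma N2_subgroup : subgroup (N T2).
Proof. exact: (@index2_subgroup _ i0). Qed.

Lemma N2_1 : N T2 1.
Proof. exact: N2_subgroup.1. Qed.

Lemma N2_R0 : ~ N T2 R0.
Proof. by rewrite -[R0]mul1g N2_mul /= => /(_ N2_1). Qed.

Lemma N2_R1 : N T2 R1.
Proof. by rewrite -[R1]mul1g N2_mul /=; exact: N2_1. Qed.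

Lemma N2_R2 : N T2 R2.
Proof. by rewrite -[R2]mul1g N2_mul /=; exact: N2_1. Qed.

Lemma N2_S2 : N T2 S2.
Proof. by apply: normaliserJ N2_R1; exact: (@N_normal T2). Qed.

Lemma N2_delta g : N T2 (delta g) <-> N T2s g.
Proof.
elim/gamma_ind: g => [|g i IH].
  by rewrite delta1; split=> _; [exact: (@index2_subgroup _ i2 _).1|exact: N2_1].
rewrite deltaM delta_genE; elim/I3E: i; rewrite /delta_gen N2_mul N2s_mul /=;
  tauto.
Qed.

Lemma N2s_petrie g : N T2P (petrie g) <-> N T2s g.
Proof.
elim/gamma_ind: g => [|g i IH].
  by rewrite petrie1; split=> _;
    [exact: (@index2_subgroup _ i2 _).1|exact: (@index2_subgroup _ i0 _).1].
rewrite petrieM petrie_genE N2s_mul; elim/I3E: i => /=.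
- by rewrite -[petrie_gen i0]/(R0 * R2) mulgA N2P_mul /= N2P_mul /= notK.
- by rewrite -[petrie_gen i1]/R1 N2P_mul.
- by rewrite -[petrie_gen i2]/R2 N2P_mul /=; tauto.
Qed.

(** N(2) is generated by S_1, S_2 and S_3: Schreier's argument for the
    transversal {1, R_0}. *)
Lemma N2_cover (T K : set Gamma) : subgroup K -> T 1 ->
  (forall t, T t -> [/\ exists2 t', T t' & K (t * S1 / t'),
     exists2 t', T t' & K (t * S2 / t') & exists2 t', T t' & K (t * S3 / t')]) ->
  forall g, N T2 g -> exists2 t, T t & K (g / t).
Proof.
move=> sK T1 TM.
pose P g := exists2 t, T t & K (g / t).
have PM g s : P g -> (forall t, T t -> exists2 t',
  T t' & K (t * s / t')) -> P (g * s).
  move=> [t Tt Kt] /(_ t Tt)[t' Tt' Kt']; exists t' => //.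
  by rewrite -[g](mulgVK t) -!mulgA mulgA; apply: subgroupM => //; rewrite mulgA.
have P1 g : P g -> P (g * S1) by move=> /PM; apply=> t /TM[].
have P2 g : P g -> P (g * S2) by move=> /PM; apply=> t /TM[].
have P3 g : P g -> P (g * S3) by move=> /PM; apply=> t /TM[].
suff E g : (N T2 g -> P g) /\ (~ N T2 g -> P (g * R0)) by move=> g; case: (E g).
have RR h : h * R0 * R0 = h by rewrite -mulgA gen_sq mulg1.
elim/gamma_ind: g => [|g i [IH IH']].
  by split=> [_|/(_ N2_1)//]; exists 1 => //; rewrite divg1; exact: sK.1.
elim/I3E: i; rewrite N2_mul /=; split.
- exact: IH'.
- by move=> /contrapT Ng; rewrite RR; exact: IH.
- by move=> /IH/P1.
- move=> /IH'/P2; congr P.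
  by rewrite /S2 conjgE (invol_inv (gen_sq _)) !mulgA RR.
- by move=> /IH/P3.
- by move=> /IH'/P3; rewrite -!mulgA gen_20.
Qed.

(** N(2) having index 2, any element outside it which normalises H is the product
    of R_0 and of an element of N(2). *)
Lemma normaliser_eq_N2 H : subgroup H -> N T2 `<=` normaliser H ->
  ~ normaliser H R0 -> normaliser H = N T2.
Proof.
move=> sH nH nR0; apply/seteqP; split=> // g ng.
apply: contrapT => Ng; apply: nR0; rewrite -[R0](mulKg g).
apply: subgroupM; [exact: normaliser_subgroup| |].
  by apply: subgroupV => //; exact: normaliser_subgroup.
by apply: nH; rewrite N2_mul.
Qed.

(** Gamma / N(3) is the four-group generated by R_0 and R_2, so that 1, R_0, R_2
    and R_0 R_2 represent all the cosets of N(3). *)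
Lemma eq_above_N3 H H' : subgroup H -> subgroup H' ->
  N3 `<=` H -> N3 `<=` H' -> (H R0 <-> H' R0) -> (H R2 <-> H' R2) ->
  (H (R0 * R2) <-> H' (R0 * R2)) -> H = H'.
Proof.
move=> sH sH' NH NH' E0 E2 E02.
apply: (@eq_by_transversal [set 1; R0; R2; R0 * R2]) => // [g _|t]; last first.
  by move=> [[[]|]|] ->//; split=> _; [exact: sH'.1|exact: sH.1].
have [t Tt Nt] : exists2 t, [set 1; R0; R2; R0 * R2] t & N3 (g / t); last first.
  by exists t => //; split; [exact: NH|exact: NH'].
apply: cosets_cover; first exact: ncl_subgroup.
  by left; left; left.
have N1 : N3 1 by exact: (@ncl_subgroup _ _).1.
have NR1 t : N3 (t * R1 / t).
  by apply: (@absorb N3); [exact: (@ncl_norm setT)|exact: sub_ncl].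
have ex (s t : Gamma) : [set 1; R0; R2; R0 * R2] t -> s = t ->
    exists2 t', [set 1; R0; R2; R0 * R2] t' & N3 (s / t').
  by move=> Tt ->; exists t; rewrite ?divgg.
have RR h j : h * gen j * gen j = h by rewrite -mulgA gen_sq mulg1.
move=> {}t i Tt; elim/I3E: i; last 1 first.
- case: Tt => [[[]|]|] ->.
  + by apply: (ex _ R2); rewrite ?mul1g//; left; right.
  + by apply: (ex _ (R0 * R2)) => //; right.
  + by apply: (ex _ 1); rewrite ?gen_sq//; left; left; left.
  + by apply: (ex _ R0); rewrite ?RR//; left; left; right.
- case: Tt => [[[]|]|] ->.
  + by apply: (ex _ R0); rewrite ?mul1g//; left; left; right.
  + by apply: (ex _ 1); rewrite ?gen_sq//; left; left; left.
  + by apply: (ex _ (R0 * R2)); rewrite ?gen_20//; right.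
  + by apply: (ex _ R2); [left; right|rewrite -gen_20 RR].
- by exists t.
Qed.

End IndexTwo.

(** * Normal subgroups modulo a dihedral quotient *)

Section DihedralQuotients.
Local Open Scope classical_set_scope.
Local Open Scope group_scope.
Implicit Types (H K : set Gamma).
Arguments N T : simpl never.

(** The elements of the infinite dihedral group which vanish in its quotient of
    order 2 n, or in the group itself when n is infinite. *)
Definition dih_cong (n : natinf) (l : int * bool) : Prop :=
  l.2 /\ (if n is Some k then (Posz k %| l.1)%Z : Prop else l.1 = 0%R).

Definition dih_trace H a b n := forall l, H (alt a b l) <-> dih_cong n l.

(** Every reflection (a b) ^ k b is conjugate, inside the dihedral group, to a or
    to b according to the parity of k. *)
Lemma no_reflection H a b k : a * a = 1 -> b * b = 1 ->
  normaliser H (a * b) -> ~ H a -> ~ H b -> ~ H (alt a b (k, false)).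
Proof.
move=> aa bb nab Ha Hb Hk.
have nz m : normaliser H (zpow (a * b) m).
  exact: subgroup_zpow (normaliser_subgroup H) nab.
have Hm m : H (alt a b (k - m - m, false)%R).
  by rewrite -alt_shift//; exact: normaliserJ (nz m) Hk.
have [m [E|E]] : exists m : int, (k - m - m = 0 \/ k - m - m = 1)%R.
  by exists (k %/ 2)%Z; lia.
- by apply: Hb; have := Hm m; rewrite E /alt /= mul1g.
- apply: Ha; have := Hm m; rewrite E /alt /= expg1.
  by rewrite -mulgA bb mulg1.
Qed.

(** A normal subgroup containing neither a nor b contains no reflection, and a
    group of rotations consists of the powers of its least positive one. *)
Lemma dih_traceP H a b : subgroup H -> a * a = 1 -> b * b = 1 ->
  normaliser H a -> normaliser H b -> ~ H a -> ~ H b ->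
  exists2 n, natinf_pos n & dih_trace H a b n.
Proof.
move=> sH aa bb na nb Ha Hb.
have nab : normaliser H (a * b) by apply: subgroupM => //;
  exact: normaliser_subgroup.
have refl k : ~ H (alt a b (k, false)) by exact: no_reflection.
have [[j jP]|none] := pselect (exists j, `[< (0 < j)%N /\ H ((a * b) ^+ j) >]).
  have exj : exists j, `[< (0 < j)%N /\ H ((a * b) ^+ j) >] by exists j.
  case: (ex_minnP exj) => n /asboolP[n0 Hn] nmin.
  exists (Some n) => // -[k []]; last by split=> [/refl//|[]].
  have Hq q : H (zpow (a * b) (q * Posz n)%R).
    by rewrite GRing.mulrC zpowM; exact: subgroup_zpow.
  rewrite /alt /= mulg1 /dih_cong /=; split=> [Hk|[_ /dvdzP[q ->]]//].
  have n0' : (Posz n != 0)%R by case: (n) n0.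
  split=> //; apply/dvdz_mod0P; have := modz_ge0 k n0'; have := ltz_mod k n0'.
  have Hr : H (zpow (a * b) (k %% Posz n)%Z).
    have -> : (k %% Posz n)%Z = (k + - ((k %/ Posz n)%Z * Posz n))%R.
      by rewrite {2}(divz_eq k (Posz n)) GRing.addrAC GRing.subrr GRing.add0r.
    by rewrite zpowD zpowN; exact: sH.2.
  case: (k %% Posz n)%Z Hr => // -[|r] Hr // rn _.
  by have := nmin r.+1 (introT (asboolP _) (conj isT Hr)); lia.
exists None => // -[k []]; last by split=> [/refl//|[]].
rewrite /alt /= mulg1; split=> [Hk|[_ /= ->]]; last exact: sH.1.
split=> //=; case: k Hk => [[|k] Hk|k Hk] //; exfalso; apply: none;
  exists k.+1; apply/asboolP; split=> //.
by rewrite -subgroupVE// -expVgn.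
Qed.

(** Killing R_0 leaves the free product of <R_1> and <R_2>, an infinite dihedral
    group. *)
Lemma R0_normal_cover K g : subgroup K -> setT `<=` normaliser K -> K R0 ->
  exists2 t, range (alt R1 R2) t & K (g / t).
Proof.
move=> sK nK KR0; apply: cosets_cover => //.
  by exists (0%R, true) => //; rewrite /alt mulg1.
have step l l' s : alt R1 R2 l * s = alt R1 R2 l' ->
    exists2 t', range (alt R1 R2) t' & K (alt R1 R2 l * s / t').
  by move=> ->; exists (alt R1 R2 l'); [exists l'|rewrite divgg; exact: sK.1].
move=> t i [l _ <-]; elim/I3E: i.
- by exists (alt R1 R2 l); [exists l|apply: (@absorb K) => //; exact: nK].
- by apply/step/alt_step_a; exact: gen_sq.
- by apply/step/alt_step_b; exact: gen_sq.
Qed.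

Lemma power_relator_sub H a b n : dih_trace H a b n ->
  power_relator (a * b) n `<=` H.
Proof.
case: n => [k|] HE g //= ->.
by have := (HE (Posz k, true)).2; rewrite /alt mulg1; apply; split.
Qed.

Lemma trace_in K a b n l : subgroup K -> power_relator (a * b) n `<=` K ->
  dih_cong n l -> K (alt a b l).
Proof.
move=> sK; case: n l => [n|] [k []] nK [//= _]; rewrite /alt mulg1 /=.
  by case/dvdzP => q ->; rewrite GRing.mulrC zpowM; apply: subgroup_zpow => //;
    exact: nK.
by move=> ->; exact: sK.1.
Qed.

Lemma mapA_subgroupP H n : subgroup H -> setT `<=` normaliser H -> H R0 ->
  dih_trace H R1 R2 n ->
  H = ncl setT (R0 |` power_relator (R1 * R2) n).
Proof.
move=> sH nH HR0 HE; set K := ncl _ _.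
have sK : subgroup K by exact: ncl_subgroup.
have KH : K `<=` H.
  by apply: ncl_min => // g [->//|]; exact: power_relator_sub.
have RK : R0 |` power_relator (R1 * R2) n `<=` K by exact: sub_ncl.
apply: (@eq_by_transversal (range (alt R1 R2))) => // [g _|t [l _ <-]].
  have [] := @R0_normal_cover K g => //; first exact: ncl_norm.
    by apply: RK; left.
  by move=> t Tt Kt; exists t => //; split=> //; exact: KH.
split=> [/HE|/KH//]; apply: trace_in => //.
by move=> g ng; apply: RK; right.
Qed.

Lemma mapD_subgroupP H : subgroup H -> setT `<=` normaliser H -> H R0 ->
  H R2 -> ~ H R1 -> H = ncl setT [set R0; R2].
Proof.
move=> sH nH HR0 HR2 HR1; set K := ncl _ _.
have sK : subgroup K by exact: ncl_subgroup.
have KH : K `<=` H by apply: ncl_min => // g [] ->.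
have nK : setT `<=` normaliser K by exact: ncl_norm.
have [KR0 KR2] : K R0 /\ K R2 by split; apply: sub_ncl; [left|right].
apply: (@eq_by_transversal [set 1; R1]) => // [g _|t [] ->]; last 2 first.
- by split=> _; [exact: sK.1|exact: sH.1].
- by split=> // /KH.
have [t Tt Kt] : exists2 t, [set 1; R1] t & K (g / t); last first.
  by exists t => //; split=> //; exact: KH.
apply: cosets_cover => //; first by left.
have ex (s t : Gamma) : [set 1; R1] t -> s = t ->
    exists2 t', [set 1; R1] t' & K (s / t').
  by move=> Tt ->; exists t; rewrite ?divgg//; exact: sK.1.
move=> t i Tt; elim/I3E: i.
- by exists t => //; apply: (@absorb K) => //; exact: nK.
- case: Tt => ->; first by apply: (ex _ R1); [right|rewrite mul1g].
  by apply: (ex _ 1); [left|rewrite gen_sq].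
- by exists t => //; apply: (@absorb K) => //; exact: nK.
Qed.

Lemma S2_sq : S2 * S2 = 1.
Proof. by rewrite -conjMg gen_sq conj1g. Qed.

Lemma N2_alt23 l : N T2 (alt S2 S3 l).
Proof. exact: subgroup_alt N2_subgroup N2_S2 N2_R2. Qed.

Lemma N2_alt12 l : N T2 (alt S1 S2 l).
Proof. exact: subgroup_alt N2_subgroup N2_R1 N2_S2. Qed.

(** Killing S_1 in N(2), the free product of the three <S_i>, leaves the infinite
    dihedral group generated by S_2 and S_3. *)
Lemma mapM2_subgroupP H n : subgroup H -> H `<=` N T2 ->
  N T2 `<=` normaliser H -> H S1 -> dih_trace H S2 S3 n ->
  H = ncl (N T2) (S1 |` power_relator (S2 * S3) n).
Proof.
move=> sH HN nH HS1 HE; set K := ncl _ _.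
have sK : subgroup K by exact: ncl_subgroup.
have KH : K `<=` H.
  by apply: ncl_min => // g [->//|]; exact: power_relator_sub.
have RK : S1 |` power_relator (S2 * S3) n `<=` K by exact: sub_ncl.
apply: (@eq_by_transversal (range (alt S2 S3))) => // [g Hg|t [l _ <-]]; last first.
  split=> [/HE|/KH//]; apply: trace_in => //.
  by move=> g ng; apply: RK; right.
have Ng : N T2 g by case: Hg => [/HN//|/KH/HN].
have [t Tt Kt] : exists2 t, range (alt S2 S3) t & K (g / t); last first.
  by exists t => //; split=> //; exact: KH.
apply: N2_cover Ng => //.
  by exists (0%R, true) => //; rewrite /alt mulg1.
have step l l' s : alt S2 S3 l * s = alt S2 S3 l' ->
    exists2 t', range (alt S2 S3) t' & K (alt S2 S3 l * s / t').
  by move=> ->; exists (alt S2 S3 l'); [exists l'|rewrite divgg; exact: sK.1].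
move=> t [l _ <-]; split.
- exists (alt S2 S3 l); [by exists l|apply: (@absorb K)].
    by apply: ncl_norm; exact: N2_alt23.
  by apply: RK; left.
- by apply/step/alt_step_a; [exact: S2_sq|exact: gen_sq].
- by apply/step/alt_step_b; exact: gen_sq.
Qed.

Lemma mapM20_subgroupP H : subgroup H -> H `<=` N T2 ->
  N T2 `<=` normaliser H -> H S1 -> H S3 -> ~ H S2 ->
  H = ncl (N T2) [set S1; S3].
Proof.
move=> sH HN nH HS1 HS3 HS2; set K := ncl _ _.
have sK : subgroup K by exact: ncl_subgroup.
have KH : K `<=` H by apply: ncl_min => // g [] ->.
have nK : N T2 `<=` normaliser K by exact: ncl_norm.
have [KS1 KS3] : K S1 /\ K S3 by split; apply: sub_ncl; [left|right].
apply: (@eq_by_transversal [set 1; S2]) => // [g Hg|t [] ->]; last 2 first.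
- by split=> _; [exact: sK.1|exact: sH.1].
- by split=> // /KH.
have Ng : N T2 g by case: Hg => [/HN//|/KH/HN].
have [t Tt Kt] : exists2 t, [set 1; S2] t & K (g / t); last first.
  by exists t => //; split=> //; exact: KH.
apply: N2_cover Ng => //; first by left.
have ex (s t : Gamma) : [set 1; S2] t -> s = t ->
    exists2 t', [set 1; S2] t' & K (s / t').
  by move=> Tt ->; exists t; rewrite ?divgg//; exact: sK.1.
move=> t Tt.
have Nt : N T2 t by case: Tt => ->; [exact: N2_1|exact: N2_S2].
split.
- by exists t => //; apply: (@absorb K) => //; exact: nK.
- case: Tt => ->; first by apply: (ex _ S2); [right|rewrite mul1g].
  by apply: (ex _ 1); [left|rewrite S2_sq].
- by exists t => //; apply: (@absorb K) => //; exact: nK.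
Qed.

Lemma S1_R0 : S1 ^ R0 = S2. Proof. by []. Qed.

Lemma S2_R0 : S2 ^ R0 = S1.
Proof. by rewrite /S2 -conjgM gen_sq conjg1. Qed.

Lemma S3_R0 : S3 ^ R0 = S3.
Proof. by rewrite /S3 conjgE gen_20 mulKg. Qed.

Lemma conj_N2 H : subgroup H -> N T2 `<=` normaliser H ->
  subgroup (conj_set H R0) /\ N T2 `<=` normaliser (conj_set H R0).
Proof.
move=> sH nH; split.
  split=> [|_ _ [x Hx <-] [y Hy <-]].
    by exists 1; [exact: sH.1|rewrite conj1g].
  by exists (x / y); [exact: sH.2|rewrite conjMg conjVg].
move=> g Ng; rewrite normaliser_conj; exists (g ^ R0^-1).
  by apply: nH; apply: normaliserJ Ng; exact: N_normal.
by rewrite -conjgM mulVg conjg1.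
Qed.

Lemma conj_R0P H g : conj_set H R0 (g ^ R0) <-> H g.
Proof.
by split=> [[h Hh /conjg_inj <-]//|Hg]; exists g.
Qed.

Lemma N2_conj_R0 H : H `<=` N T2 -> conj_set H R0 `<=` N T2.
Proof. by move=> HN _ [h /HN Nh <-]; apply: normaliserJ Nh; exact: N_normal. Qed.

(** N(2) / H is generated by the image of S_3, which R_0 centralises. *)
Lemma R0_normalises_S12 H : subgroup H -> H `<=` N T2 ->
  N T2 `<=` normaliser H -> H S1 -> H S2 -> normaliser H R0.
Proof.
move=> sH HN nH HS1 HS2; rewrite /normaliser /=.
have [sH' nH'] := conj_N2 sH nH; set H' := conj_set H R0 in sH' nH' *.
have H'S1 : H' S1 by rewrite -S2_R0; apply/conj_R0P.
have H'S2 : H' S2 by apply/conj_R0P.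
have H'S3 : H' S3 <-> H S3 by rewrite -{1}S3_R0; exact: conj_R0P.
apply: (@eq_by_transversal [set 1; S3]) => // [g Hg|t [] ->]; last 2 first.
- by split=> _; [exact: sH.1|exact: sH'.1].
- exact: H'S3.
have Ng : N T2 g by case: Hg => [/(N2_conj_R0 HN)|/HN].
have sK := subgroupI sH' sH; apply: N2_cover Ng => //; first by left.
have nK : N T2 `<=` normaliser (H' `&` H).
  by move=> h Nh; apply: normaliserI; [exact: nH'|exact: nH].
have ex (s t : Gamma) : [set 1; S3] t -> s = t ->
    exists2 t', [set 1; S3] t' & (H' `&` H) (s / t').
  by move=> Tt ->; exists t; rewrite ?divgg//; exact: sK.1.
move=> t Tt.
have Nt : N T2 t by case: Tt => ->; [exact: N2_1|exact: N2_R2].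
split.
- by exists t => //; apply: (@absorb (H' `&` H)); [exact: nK|].
- by exists t => //; apply: (@absorb (H' `&` H)); [exact: nK|].
- case: Tt => ->; first by apply: (ex _ S3); [right|rewrite mul1g].
  by apply: (ex _ 1); [left|rewrite gen_sq].
Qed.

(** N(2) / H is a dihedral quotient of <S_1, S_2> by a group of rotations, and
    conjugation by R_0, which exchanges S_1 and S_2, inverts the rotations. *)
Lemma R0_normalises_S3 H : subgroup H -> H `<=` N T2 ->
  N T2 `<=` normaliser H -> H S3 -> ~ H S1 -> ~ H S2 -> normaliser H R0.
Proof.
move=> sH HN nH HS3 HS1 HS2; rewrite /normaliser /=.
have [sH' nH'] := conj_N2 sH nH; set H' := conj_set H R0 in sH' nH' *.
have H'S3 : H' S3 by rewrite -S3_R0; exact/conj_R0P.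
have [n _ HE] := dih_traceP sH (gen_sq _ : S1 * S1 = 1) S2_sq (nH _ N2_R1) (nH
  _ N2_S2) HS1 HS2.
apply: (@eq_by_transversal (range (alt S1 S2))) => // [g Hg|_ [l _ <-]]; last first.
  have altJ : alt S1 S2 l = (alt S2 S1 l) ^ R0.
    rewrite /alt conjMg -zpowJ conjMg S1_R0 S2_R0; case: l.2 => //.
    by rewrite conj1g.
  have -> : H' (alt S1 S2 l) <-> H (alt S2 S1 l) by rewrite altJ; exact: conj_R0P.
  rewrite alt_swap//; last 2 first.
  - exact: gen_sq.
  - exact: S2_sq.
  rewrite !HE; case: l {altJ} => k []; rewrite /dih_cong /=; last by split=> -[].
  case: n {HE} => [n|]; first by rewrite !dvdzE abszN.
  by split=> -[_ k0]; split=> //; apply/eqP;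
    rewrite -GRing.oppr_eq0 ?k0 ?GRing.opprK; apply/eqP.
have Ng : N T2 g by case: Hg => [/(N2_conj_R0 HN)|/HN].
have sK := subgroupI sH' sH; apply: N2_cover Ng => //.
  by exists (0%R, true) => //; rewrite /alt mulg1.
have step l l' s : alt S1 S2 l * s = alt S1 S2 l' ->
    exists2 t', range (alt S1 S2) t' & (H' `&` H) (alt S1 S2 l * s / t').
  by move=> ->; exists (alt S1 S2 l'); [exists l'|rewrite divgg; exact: sK.1].
move=> t [l _ <-]; split.
- by apply/step/alt_step_a; [exact: gen_sq|exact: S2_sq].
- by apply/step/alt_step_b; exact: S2_sq.
- exists (alt S1 S2 l); [by exists l|apply: (@absorb (H' `&` H)) => //].
  by apply: normaliserI; [apply: nH'|apply: nH]; exact: N2_alt12.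
Qed.

End DihedralQuotients.

(** * Regular maps with boundary *)

Section RegularMaps.
Local Open Scope classical_set_scope.
Local Open Scope group_scope.
Implicit Types (M : emap) (H K : set Gamma).
Arguments N T : simpl never.
Arguments act : simpl never.

Definition kernel M : set Gamma := [set g | forall x : M, act x g = x].

Lemma kernel_subgroup M : subgroup (kernel M).
Proof.
split=> [x|g h Kg Kh x]; first exact: act1.
by rewrite actM Kg -{2}(actK x h^-1) invgK Kh.
Qed.

Lemma kernel_normal M : setT `<=` normaliser (kernel M).
Proof.
move=> g _; apply/normaliserP => h.
suff E k l : kernel M k -> kernel M (k ^ l).
  by split=> [/(E _ g^-1)|/E//]; rewrite -conjgM mulgV conjg1.
by move=> Kk x; rewrite conjgE !actM Kk actVK.
Qed.

Lemma kernel_stab M (x : M) : kernel M `<=` stab x.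
Proof. by move=> g; exact. Qed.

Lemma stab_kernel M (x : M) : setT `<=` normaliser (stab x) -> stab x = kernel M.
Proof.
move=> nx; apply/seteqP; split=> [g gx y|]; last exact: kernel_stab.
have [h <-] := act_trans x y;
  have : stab x (g ^ h^-1) by apply: normaliserJ gx; exact: nx.
by rewrite /stab /= conjgE invgK !actM => E; rewrite -[in RHS]E actVK.
Qed.

Lemma in_class1P M (x : M) : in_class T1 M <-> setT `<=` normaliser (stab x).
Proof.
rewrite (in_classP x (@N_normal T1)) /N; split=> [-> //|nx].
by apply/seteqP; split.
Qed.

(** When R_0 acts trivially, each element of Gamma acts like an element of the
    dihedral group <R_1, R_2>. *)
Lemma stab_eq_kernel M (x : M) : kernel M R0 ->
  (forall l, stab x (alt R1 R2 l) -> kernel M (alt R1 R2 l)) ->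
  stab x = kernel M.
Proof.
move=> K0 KA; apply/seteqP; split=> [g gx|]; last exact: kernel_stab.
have sK := kernel_subgroup M.
have [_ [l _ <-] Kl] := R0_normal_cover g sK (@kernel_normal M) K0.
apply/(same_coset sK Kl)/KA.
exact/(same_coset (stab_subgroup x) (kernel_stab x Kl)).
Qed.

Lemma dih_trace_nat H a b n : subgroup H ->
  (forall m : nat, H ((a * b) ^+ m) <-> dih_cong n (Posz m, true)) ->
  (forall k, ~ H (alt a b (k, false))) -> dih_trace H a b n.
Proof.
move=> sH Hm Hr [k []]; last by split=> [/Hr|[]].
rewrite /alt mulg1; case: k => m; first exact: Hm.
rewrite /= expVgn subgroupVE// Hm NegzE; case: n {Hm} => [n|]; rewrite /dih_cong /=.
  by rewrite !dvdzE abszN.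
by split=> -[_ E]; split=> //; lia.
Qed.

Lemma dual_act M (x : dual_map M) i :
  act x (gen i) = act (x : M) (gen (if i == i0 then i2 else if i == i1 then i1
    else i0)).
Proof.
rewrite [LHS]/(act (x : M) (delta (gen i))) delta_genE.
by elim/I3E: i.
Qed.

Section DualCircuit.
Variables (V : Type) (v0 : V) (next prev : V -> V).
Hypotheses (nextK : cancel next prev) (prevK : cancel prev next).
Hypothesis conn : forall v w, exists k, iter k next v = w \/ iter k prev v = w.
Variable n : natinf.
Hypothesis order_v0 : forall m, iter m next v0 = v0 -> dih_cong n (Posz m, true).
Hypothesis order_next : forall m v, dih_cong n (Posz m, true) -> iter m next v = v.

Let C : emap := circuit v0 nextK prevK conn.
Let E : emap := dual_map C.

Let actE (x : E) i :
  act x (gen i) = circuit_gen next prev (if i == i0 then i2 else if i == i1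
    then i1 else i0) x.
Proof. by rewrite (@dual_act C); exact: invol_map_gen. Qed.

Let act_rot m (x : E) : act x ((R1 * R2) ^+ m) =
  (iter m (if x.2 then prev else next) x.1, x.2).
Proof.
elim: m => [|m IH]; first by rewrite expg0 act1; case: x.
rewrite expgSr actM IH actM !actE; case: x {IH} => v [] //=.
Qed.

Let alt_flip (x : E) k : (act x (alt R1 R2 (k, false))).2 = ~~ x.2.
Proof.
have rot_side (y : E) m : (act y (zpow (R1 * R2) m)).2 = y.2.
  case: m => m; first by rewrite act_rot.
  rewrite /= expVgn -{2}(actVK y ((R1 * R2) ^+ m.+1)).
  by move: (act _ _) => z; rewrite act_rot.
rewrite /alt /= actM actE -(rot_side x k); case: (act x _) => v [] //=.
Qed.

Let x0 : E := (v0, false).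

(** In the dual of a circuit, R_1 R_2 is a rotation by one step: backwards for the
    flags whose side is true, forwards for the others. *)
Lemma dual_circuit_trace : dih_trace (stab x0) R1 R2 n /\ stab x0 = kernel E.
Proof.
have nflip (x : E) k : ~ stab x (alt R1 R2 (k, false)).
  by move=> /(congr1 snd) /=; rewrite alt_flip; case: x.2.
have Kn m : dih_cong n (Posz m, true) -> kernel E ((R1 * R2) ^+ m).
  move=> mn x; rewrite act_rot; case: x => v []; rewrite /= ?order_next//.
  rewrite -{1}(order_next v mn); congr (_, _).
  by elim: m {mn} => // m IH; rewrite iterSr iterS nextK.
have tr0 : dih_trace (stab x0) R1 R2 n.
  apply: dih_trace_nat => [|m|k]; [exact: stab_subgroup| |exact: nflip].
  split=> [|/Kn]; last exact.
  by rewrite /stab /= act_rot /= => -[/order_v0].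
split=> //; apply: stab_eq_kernel => [x|l].
  by rewrite actE; case: x => v [].
move=> /tr0; have trK : dih_trace (kernel E) R1 R2 n.
  apply: dih_trace_nat => [|m|k].
  - exact: kernel_subgroup.
  - by split=> [/(_ x0)|/Kn//]; rewrite act_rot => -[/order_v0].
  - by move=> /(_ x0); exact: nflip.
by move=> /trK.
Qed.

End DualCircuit.

Definition subA n := ncl setT (R0 |` power_relator (R1 * R2) n).

Lemma mapC_dual n : natinf_pos n ->
  dih_trace (subA n) R1 R2 n /\ exists x : dual_map (mapC n), stab x = subA n.
Proof.
move=> n0; suff [x [xE xK]] : exists x : dual_map (mapC n),
    dih_trace (stab x) R1 R2 n /\ stab x = kernel (dual_map (mapC n)).
  have E : stab x = subA n.
    apply: mapA_subgroupP => //; first exact: stab_subgroup.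
      by rewrite xK; exact: kernel_normal.
    rewrite xK => y; rewrite (@dual_act (mapC n)).
    by case: (n) (y) => [k|] z; rewrite [LHS]invol_map_gen; case: z => v [].
  by split; [rewrite -E|exists x].
case: n n0 => [k k0|_].
- exists ((ord0, false) : dual_map (mapC (Some k))).
  have up m (v : 'I_k.-1.+1) : val (iter m (@ordS k.-1.+1) v) = ((v + m) %%
    k.-1.+1)%N.
    elim: m => [|m IH]; first by rewrite addn0 modn_small.
    by rewrite iterS /= IH -addn1 modnDml -addnA addn1.
  apply: dual_circuit_trace => [m /(congr1 val)|m v [_ mk]].
    by rewrite up add0n /= prednK// => mk; split=> //=; rewrite dvdzE /= /dvdn mk.
  apply: val_inj; rewrite up; move: mk; rewrite /= dvdzE /= -{1}(prednK k0).
  by move=> /dvdnP[q ->]; rewrite addnC modnMDl modn_small.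
- exists ((0%R, false) : dual_map (mapC None)).
  have up m (v : int) : iter m (fun z => z + 1)%R v = (v + Posz m)%R.
    by elim: m => [|m IH]; rewrite ?GRing.addr0// iterS IH -GRing.addrA -addn1.
  apply: dual_circuit_trace => [m|m v [_ /= m0]]; rewrite up;
    last by rewrite m0 GRing.addr0.
  by rewrite GRing.add0r => m0; split.
Qed.

Lemma subA_trace n : natinf_pos n -> dih_trace (subA n) R1 R2 n.
Proof. by case/mapC_dual. Qed.

Lemma map_iso_mapA M n :
  map_iso M (mapA n) <-> exists x : M, stab x = subA n.
Proof. exact: map_iso_coset (@ncl_subgroup _ _). Qed.

Lemma mapC_dual_mapA n : natinf_pos n -> map_iso (mapC n) (dual_map (mapA n)).
Proof. by move=> n0; apply/map_iso_dual/map_iso_mapA; case: (mapC_dual n0). Qed.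

Lemma subA_normal n : setT `<=` normaliser (subA n).
Proof. exact: ncl_norm. Qed.

Lemma subA_R0 n : subA n R0.
Proof. by apply: sub_ncl; left. Qed.

(** * The map B and its quotients *)

Lemma mapB_act (x : mapB) i : act x (gen i) = K2_gen i x.
Proof. exact: invol_map_gen. Qed.

Lemma N3_sub_normal H : subgroup H -> setT `<=` normaliser H -> H R1 -> N3 `<=` H.
Proof. by move=> sH nH HR1; apply: ncl_min => // g ->. Qed.

Lemma N_subgroup T : subgroup (N T).
Proof.
case: T; [by []|exact: (@index2_subgroup _ i0)|exact: (@index2_subgroup _ i2)|
  exact: (@index2_subgroup _ i0)].
Qed.

Lemma N3_sub_N T : N3 `<=` N T.
Proof.
apply: N3_sub_normal; [exact: N_subgroup|exact: N_normal|].
by case: T => //; [exact/(@index2_gen _ i0)|exact/(@index2_gen _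
  i2)|exact/(@index2_gen _ i0)].
Qed.

Lemma N3_kernel_B : N3 `<=` kernel mapB.
Proof.
apply: N3_sub_normal; [exact: kernel_subgroup|exact: kernel_normal|].
by move=> x; rewrite mapB_act.
Qed.

Lemma stab_mapB (x : mapB) : stab x = N3.
Proof.
have N30 i : i != i1 -> ~ N3 (gen i).
  by move=> ii1 /N3_kernel_B/(_ (true, true)); rewrite mapB_act; move: ii1;
    elim/I3E: i.
apply: eq_above_N3 => //; [exact: stab_subgroup|exact: ncl_subgroup| | | |].
- by move=> g /N3_kernel_B; exact.
- split=> [|/(N30 i0 isT)//]; rewrite /stab /= mapB_act.
  by case: x => -[] b //.
- split=> [|/(N30 i2 isT)//]; rewrite /stab /= mapB_act.
  by case: x => b [].
- split=> [|/N3_kernel_B/(_ (true, true))]; rewrite /stab /= actM !mapB_act //.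
  by case: x => -[] b //.
Qed.

Lemma mapB_mapN3 : map_iso mapB mapN3.
Proof.
apply/map_iso_coset; first exact: ncl_subgroup.
by exists (true, true); exact: stab_mapB.
Qed.

Definition K2_shift (c : bool * bool) (x : mapB) : mapB :=
  (x.1 (+) c.1, x.2 (+) c.2).

Lemma K2_shiftK c : involutive (K2_shift c).
Proof. by case: c => [[] []] [[] []]. Qed.

Lemma K2_shift_act c : equivariant (K2_shift c).
Proof.
move=> x; elim/gamma_ind => [|g i IH]; first by rewrite !act1.
rewrite !actM -IH !mapB_act; elim/I3E: i; case: c {IH} => [[] []];
  by case: (act x g) => [[] []].
Qed.

Lemma K2_shift_aut c : aut mapB (K2_shift c).
Proof.
split; last exact: K2_shift_act.
by exists (K2_shift c); exact: K2_shiftK.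
Qed.

Lemma aut_K2_shift f : aut mapB f -> exists c, f = K2_shift c.
Proof.
move=> [_ fE]; exists ((f (false, false)).1, (f (false, false)).2).
apply/funext; apply: (equivariant_eq fE (K2_shift_act _)).
exact: (surjective_pairing (f (false, false))).
Qed.

Definition K2_group (c : bool * bool) : autgroup mapB.
Proof.
exists [set id; K2_shift c].
- move=> f [] ->; last exact: K2_shift_aut.
  by split=> //; exists id.
- by left.
- move=> f g [] -> [] ->; [by left|by right|by right|left].
  by apply/funext => x; exact: K2_shiftK.
- move=> f [] ->; first by exists id => //; left.
  by exists (K2_shift c); [right|exact: K2_shiftK].
Defined.

Lemma K2_shift_inj c d : K2_shift c = K2_shift d -> c = d.
Proof.
by move=> /(congr1 (fun f => f (false, false))); case: c d => [[] []] [[] []].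
Qed.

Lemma K2_shift_id c : K2_shift c = id -> c = (false, false).
Proof.
by move=> /(congr1 (fun f => f (false, false))); case: c => [[] []].
Qed.

Lemma K2_group_C2 c : c != (false, false) -> C2_of (K2_group c).
Proof.
move=> c0; apply/eq_cardSP; exists id; first by left.
have -> : agset (K2_group c) `\ id = [set K2_shift c].
  apply/seteqP; split=> [f [[->|->//] nid]|f ->]; first by case: nid.
  split; first by right.
  by move=> /K2_shift_id E; rewrite E eqxx in c0.
exact: card_set1.
Qed.

Lemma C2_K2_group A : C2_of A ->
  exists2 c, c != (false, false) & agset A = agset (K2_group c).
Proof.
move=> /eq_cardSP[f Af /eq_cardSP[g [Ag gf]]].
rewrite II0 card_eq0 => /eqP/seteqP[A2 _].
have Afg h : agset A h -> h = f \/ h = g.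
  by move=> Ah; apply: contrapT => /not_orP[hf hg]; apply: (A2 h).
have [c gc] := aut_K2_shift (ag_aut Ag).
have [d fd] := aut_K2_shift (ag_aut Af).
case: (Afg _ (ag1 A)) => idE.
- exists c; first by apply: contra_notN gf => /eqP c0; rewrite gc c0 -idE;
    apply/funext => -[[] []].
  rewrite /= -gc idE; apply/seteqP; split=> [h /Afg[]->|h []->]; by [left|right|].
- exists d; first by apply: contra_notN gf => /eqP d0; rewrite fd d0 -idE;
    apply/funext => -[[] []].
  rewrite /= -fd idE; apply/seteqP; split=> [h /Afg[]->|h []->]; by [left|right|].
Qed.

Definition K2_class (c : bool * bool) : map_class :=
  if c.1 then (if c.2 then T2P else T2s) else (if c.2 then T2 else T1).

Lemma quotient_stab M (A : autgroup M) (x : M) (B : quotient_map A) g :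
  sval B = orbit_of A x ->
  stab B g <-> exists2 f, agset A f & act x g = f x.
Proof.
move=> BE.
have orbE (y z : M) : orbit_of A y = orbit_of A z <-> exists2 f,
  agset A f & y = f z.
  split=> [E|[f Af ->]].
    have : orbit_of A y y by exists id => //; exact: ag1.
    by rewrite E => -[f Af <-]; exists f.
  apply/seteqP; split=> [_ [h Ah <-]|_ [h Ah <-]].
    by exists (h \o f) => //; exact: agM.
  have [k Ak fK] := agV Af.
  by exists (h \o k); [exact: agM|rewrite /= fK].
rewrite -orbE; split=> [/(congr1 sval)|E]; first by rewrite /= BE orbit_ofM.
by apply: quo_flag_inj; rewrite /= BE orbit_ofM.
Qed.

(** The quotient by the automorphism x |-> x + c is the map N(T) for which the
    generator of the four-group <R_0, R_2> acting as c belongs to N(T). *)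
Lemma K2_quotient (A : autgroup mapB) c : c != (false, false) ->
  agset A = agset (K2_group c) -> map_iso (quotient_map A) (mapN (K2_class c)).
Proof.
move=> c0 AE; apply/map_iso_coset; first exact: N_subgroup.
pose x : mapB := (false, false).
have xQ : range (orbit_of A) (orbit_of A x) by exists x.
pose B : quotient_map A := exist _ _ xQ; exists B.
have BP g : stab B g <-> act x g = x \/ act x g = c.
  rewrite (@quotient_stab _ _ x)// AE; split=> [[f [] -> ->]|]; first by left.
    by right; case: (c) => [[] []].
  move=> [->|->]; first by exists id => //; left.
  by exists (K2_shift c); [right|case: (c) => [[] []]].
have NE T i : N T (gen i) <-> N T (1 * gen i) by rewrite mul1g.
have N1 T : N T 1 by exact: (N_subgroup T).1.
apply: eq_above_N3.
- exact: stab_subgroup.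
- exact: N_subgroup.
- by move=> g /N3_kernel_B gB; apply/BP; left; exact: gB.
- exact: N3_sub_N.
- rewrite BP mapB_act NE; case: c c0 {AE BP B} => [[] []] //= _.
  + by rewrite /K2_class N2P_mul /=; split=> [[]//|/(_ (N1 _))].
  + by rewrite /K2_class N2s_mul /=; split=> _ //; right.
  + by rewrite /K2_class N2_mul /=; split=> [[]//|/(_ (N1 _))].
- rewrite BP mapB_act NE; case: c c0 {AE BP B} => [[] []] //= _.
  + by rewrite /K2_class N2P_mul /=; split=> [[]//|/(_ (N1 _))].
  + by rewrite /K2_class N2s_mul /=; split=> [[]//|/(_ (N1 _))].
  + by rewrite /K2_class N2_mul /=; split=> _ //; right.
- rewrite BP actM !mapB_act -[R0]mul1g; case: c c0 {AE BP B} => [[] []] //= _.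
  + rewrite /K2_class N2P_mul /= N2P_mul /= notK.
    by split=> _ //; right.
  + rewrite /K2_class N2s_mul /= N2s_mul /=.
    by split=> [[]//|/(_ (N1 _))].
  + rewrite /K2_class N2_mul /= N2_mul /=.
    by split=> [[]//|/(_ (N1 _))].
Qed.

Lemma K2_quotients_complete (A : autgroup mapB) : C2_of A ->
  exists2 c, c != (false, false) & agset A = agset (K2_group c) /\
    map_iso (quotient_map A) (mapN (K2_class c)).
Proof.
move=> /C2_K2_group[c c0 AE]; exists c => //; split=> //.
exact: K2_quotient.
Qed.

(** * The classification for T = 1 *)

Definition subD := ncl setT [set R0; R2].

Lemma mapT_stab (x : mapT) : stab x = setT.
Proof.
have eqT (y z : unit) : y = z by case: y z => -[].
by apply/seteqP; split=> // g _; exact: eqT.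
Qed.

Lemma subD_subgroup : subgroup subD.
Proof. exact: ncl_subgroup. Qed.

Lemma N_R0 T : N T R0 <-> (if T is (T1 | T2s) then True else False).
Proof.
case: T => //; rewrite -[R0]mul1g; first by rewrite N2_mul; split=> // /(_ N2_1).
  by rewrite N2s_mul; split=> // _; exact: (N_subgroup T2s).1.
by rewrite N2P_mul; split=> // /(_ (N_subgroup T2P).1).
Qed.

Lemma N_R2 T : N T R2 <-> (if T is (T1 | T2) then True else False).
Proof.
case: T => //; rewrite -[R2]mul1g; first by rewrite N2_mul; split=> // _;
  exact: N2_1.
  by rewrite N2s_mul; split=> // /(_ (N_subgroup T2s).1).
by rewrite N2P_mul; split=> // /(_ (N_subgroup T2P).1).
Qed.

Lemma N_R02 T : N T (R0 * R2) <-> (if T is (T1 | T2P) then True else False).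
Proof.
case: T => //.
- by rewrite N2_mul /= N_R0.
- by rewrite N2s_mul /= N_R0; split=> // /(_ I).
- by rewrite N2P_mul /= N_R0; split=> // _.
Qed.

Lemma dual_subgroup H : subgroup H -> setT `<=` normaliser H ->
  subgroup (delta @` H) /\ setT `<=` normaliser (delta @` H).
Proof.
move=> sH nH.
have dE g : (delta @` H) g <-> H (delta g).
  split=> [[h Hh <-]|Hg]; first by rewrite deltaK.
  by exists (delta g); rewrite ?deltaK.
have dV g : delta g^-1 = (delta g)^-1.
  by apply: (mulgI (delta g)); rewrite -deltaM !mulgV delta1.
split=> [|g _].
  split=> [|g h]; first by apply/dE; rewrite delta1; exact: sH.1.
  by rewrite !dE deltaM dV; exact: sH.2.
apply/normaliserP => h; rewrite !dE;
  have /normaliserP/(_ (delta h)) <- := nH (delta g) I.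
by rewrite !conjgE !deltaM dV.
Qed.

(** The normal subgroup stab x contains some R_i. If it contains R_1, it lies
    above N(3) and is one of the preimages of the five subgroups of a four-group.
    Otherwise, up to duality, it contains R_0 and is the preimage of a normal
    subgroup of the infinite dihedral group Gamma / ncl R_0 which avoids R_1. *)
Lemma class1_iso M : in_class T1 M -> has_boundary M ->
  [\/ exists2 n, natinf_pos n & map_iso M (mapA n) \/ map_iso M (mapC n),
      map_iso M mapB,
      exists2 T, T <> T1 & map_iso M (mapN T) |
      map_iso M mapD \/ map_iso M mapT].
Proof.
move=> c1 /has_boundaryP[x [i Hi]].
have nH := (in_class1P x).1 c1; have sH := stab_subgroup x.
have [HR1|HR1] := pselect (stab x R1).
  have N3H : N3 `<=` stab x by exact: N3_sub_normal.
  have isoN T : (stab x R0 <-> N T R0) -> (stab x R2 <-> N T R2) ->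
      (stab x (R0 * R2) <-> N T (R0 * R2)) -> map_iso M (mapN T).
    move=> E0 E2 E02; apply/map_iso_coset; first exact: N_subgroup.
    by exists x; apply: eq_above_N3 => //; [exact: N_subgroup|exact: N3_sub_N].
  have [HR0|HR0] := pselect (stab x R0); have [HR2|HR2] := pselect (stab x R2).
  - apply: Or44; right; apply: (@map_iso_of_stab _ _ x (tt : mapT)).
    by rewrite mapT_stab; apply: (eq_above_N3 sH) => //; split=> // _;
      exact: subgroupM.
  - apply: Or43; exists T2s => //; apply: isoN; rewrite ?N_R0 ?N_R2 ?N_R02//.
    split=> // HR02; apply: HR2; rewrite -[R2](mulKg R0); apply: subgroupM => //.
    exact: subgroupV.
  - apply: Or43; exists T2 => //; apply: isoN; rewrite ?N_R0 ?N_R2 ?N_R02//.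
    by split=> // HR02; apply: HR0; rewrite -[R0](mulgK R2); exact: sH.2.
  - have [HR02|HR02] := pselect (stab x (R0 * R2)).
      by apply: Or43; exists T2P => //; apply: isoN; rewrite ?N_R0 ?N_R2 ?N_R02.
    apply: Or42; apply: map_iso_trans (map_iso_sym mapB_mapN3).
    apply/map_iso_coset; first exact: ncl_subgroup.
    exists x; apply: eq_above_N3 => //; first exact: ncl_subgroup.
    + by split=> // /N3H.
    + by split=> // /N3H.
    + by split=> // /N3H.
have [HR0|HR0] := pselect (stab x R0); have [HR2|HR2] := pselect (stab x R2).
- apply: Or44; left; apply/map_iso_coset; first exact: subD_subgroup.
  by exists x; exact: mapD_subgroupP.
- have [n n0 nE] := dih_traceP sH (gen_sq i1) (gen_sq i2) (nH _ I) (nH _ I) HR1 HR2.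
  by apply: Or41; exists n => //; left; apply/map_iso_mapA; exists x;
    exact: mapA_subgroupP.
- apply: Or41; have [sD nD] := dual_subgroup sH nH.
  have D0 : stab (x : dual_map M) R0 by rewrite stab_dual; exists R2;
    rewrite ?delta_genE.
  have D1 : ~ stab (x : dual_map M) R1.
    by rewrite stab_dual => -[g Hg /(congr1 delta)];
      rewrite deltaK delta_genE => gE; apply: HR1; rewrite -[R1]gE.
  have D2 : ~ stab (x : dual_map M) R2.
    by rewrite stab_dual => -[g Hg /(congr1 delta)];
      rewrite deltaK delta_genE => gE; apply: HR0; rewrite -[R0]gE.
  rewrite -stab_dual in sD nD.
  have [n n0 nE] := dih_traceP sD (gen_sq i1) (gen_sq i2) (nD _ I) (nD _ I) D1 D2.
  exists n => //; right; apply: map_iso_trans (map_iso_sym (mapC_dual_mapA n0)).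
  by apply/map_iso_dual/map_iso_mapA; exists x; exact: mapA_subgroupP.
- by exfalso; move: Hi; elim/I3E: i.
Qed.

Lemma class1_of_stab M M' (y : M') i : map_iso M M' ->
  setT `<=` normaliser (stab y) -> stab y (gen i) ->
  in_class T1 M /\ has_boundary M.
Proof.
move=> iso ny yi; split; last exact: has_boundary_iso iso yi.
by have [x xE] := map_iso_stab y iso; apply/(in_class1P x); rewrite xE.
Qed.

Lemma iso_class1 M :
  [\/ exists2 n, natinf_pos n & map_iso M (mapA n) \/ map_iso M (mapC n),
      map_iso M mapB,
      exists2 T, T <> T1 & map_iso M (mapN T) |
      map_iso M mapD \/ map_iso M mapT] ->
  in_class T1 M /\ has_boundary M.
Proof.
have coset H i : subgroup H -> setT `<=` normaliser H -> H (gen i) ->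
    map_iso M (coset_map H) -> in_class T1 M /\ has_boundary M.
  move=> sH nH Hi iso; have [y yE] := stab_coset_map sH.
  by apply: (class1_of_stab (y := y) (i := i) iso); rewrite yE.
have cosetA n := coset (subA n) i0 (@ncl_subgroup _ _) (@subA_normal n)
  (@subA_R0 n).
case=> [[n n0 [/cosetA//|iso]]|iso|[T _ iso]|[iso|iso]].
- have iso' := map_iso_trans iso (mapC_dual_mapA n0).
  have [y yE] := stab_coset_map (@ncl_subgroup setT (R0 |` power_relator (R1 *
    R2) n)).
  have [sD nD] := dual_subgroup (@ncl_subgroup _ _) (@subA_normal n).
  apply: (class1_of_stab (y := (y : dual_map (mapA n))) (i := i2) iso').
    by rewrite stab_dual yE.
  by rewrite stab_dual yE; exists R0; [exact: subA_R0|rewrite delta_genE].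
- apply: (class1_of_stab (y := (true, true) : mapB) (i := i1) iso).
    by rewrite stab_mapB; exact: ncl_norm.
  by rewrite stab_mapB; exact: sub_ncl.
- apply: (coset (N T) i1 _ _ _ iso); [exact: N_subgroup|exact: N_normal|].
  by apply: N3_sub_N; exact: sub_ncl.
- apply: (coset subD i0 _ _ _ iso); [exact: subD_subgroup|exact: ncl_norm|].
  by apply: sub_ncl; left.
- by apply: (class1_of_stab (y := tt : mapT) (i := i0) iso);
    rewrite mapT_stab// => g _; apply/normaliserP.
Qed.

Lemma K2_classE T : T <> T1 -> exists2 c, c != (false, false) & K2_class c = T.
Proof.
by case: T => // _; [exists (false, true)|exists (true, false)|exists (true, true)].
Qed.

Lemma quotient_mapN M :
  (exists2 A : autgroup mapB, C2_of A & map_iso M (quotient_map A)) <->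
  exists2 T, T <> T1 & map_iso M (mapN T).
Proof.
split=> [[A /K2_quotients_complete[c c0 [_ iso]] iso']|[T /K2_classE[c c0 <-] iso]].
  exists (K2_class c); last exact: map_iso_trans iso.
  by case: c c0 {iso} => [[] []].
exists (K2_group c); first exact: K2_group_C2.
exact: map_iso_trans (map_iso_sym (K2_quotient c0 erefl)).
Qed.

Lemma class1P M : in_class T1 M /\ has_boundary M <->
  [\/ exists2 n, natinf_pos n & map_iso M (mapA n) \/ map_iso M (mapC n),
      map_iso M mapB,
      exists2 A : autgroup mapB, C2_of A & map_iso M (quotient_map A) |
      map_iso M mapD \/ map_iso M mapT].
Proof.
split=> [[c1 /(class1_iso c1)]|h].
  by case=> [?|?|/quotient_mapN ?|?];
    [exact: Or41|exact: Or42|exact: Or43|exact: Or44].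
by apply: iso_class1; case: h => [?|?|/quotient_mapN ?|?];
  [exact: Or41|exact: Or42|exact: Or43|exact: Or44].
Qed.

Lemma K2_three_quotients : exists A1 A2 A3 : autgroup mapB,
  [/\ C2_of A1 /\ map_iso (quotient_map A1) (mapN T2),
      C2_of A2 /\ map_iso (quotient_map A2) (mapN T2s),
      C2_of A3 /\ map_iso (quotient_map A3) (mapN T2P),
      [/\ agset A1 <> agset A2, agset A1 <> agset A3 & agset A2 <> agset A3] &
      forall A : autgroup mapB, C2_of A ->
        [\/ agset A = agset A1, agset A = agset A2 | agset A = agset A3]].
Proof.
have G c d : c != (false,
  false) -> c <> d -> agset (K2_group c) <> agset (K2_group d).
  move=> c0 cd /seteqP[/(_ (K2_shift c) (or_intror erefl))].
  by case=> [/K2_shift_id E|/K2_shift_inj//]; rewrite E eqxx in c0.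
exists (K2_group (false, true)), (K2_group (true, false)), (K2_group (true, true)).
split.
- by split; [exact: K2_group_C2|exact: (@K2_quotient _ (false, true))].
- by split; [exact: K2_group_C2|exact: (@K2_quotient _ (true, false))].
- by split; [exact: K2_group_C2|exact: (@K2_quotient _ (true, true))].
- by split; exact: G.
- move=> A /K2_quotients_complete[[[] []] // _ [-> _]];
    by [exact: Or33|exact: Or32|exact: Or31].
Qed.

Lemma mapT_mapN1 : map_iso mapT (mapN T1).
Proof. by apply/map_iso_coset => //; exists tt; rewrite mapT_stab. Qed.

End RegularMaps.

(** * Splitting the edges of a map whose edges are semi-edges *)

Section Doubling.
Local Open Scope classical_set_scope.
Local Open Scope group_scope.
Arguments N T : simpl never.
Arguments act : simpl never.

Section Double.
Variable M : emap.
Hypothesis M0 : kernel M R0.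

(** The semi-edges of M become edges with a new vertex at their free end: each
    flag splits into a flag at the old vertex (false) and a flag at the new one
    (true), and the corners at the new vertices lie along the boundary. *)
Definition double_gen (i : 'I_3) (z : M * bool) : M * bool :=
  if i == i0 then (z.1, ~~ z.2) else
  if i == i1 then (if z.2 then z else (act z.1 R1, z.2)) else (act z.1 R2, z.2).

Lemma double_sq i z : double_gen i (double_gen i z) = z.
Proof.
by case: z => x b; elim/I3E: i; case: b; rewrite /double_gen /= ?act_gen_sq.
Qed.

Lemma double_02 z :
  double_gen i2 (double_gen i0 z) = double_gen i0 (double_gen i2 z).
Proof. by []. Qed.

Lemma double_inh : inhabited (M * bool).
Proof. by have [x] := flag_inh M; constructor; exact: (x, true). Qed.

Lemma double_trans z w :
  exists u, foldl (fun y i => double_gen i y) z u = w.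
Proof.
pose reach z w := exists u, foldl (fun y i => double_gen i y) z u = w.
have tr z' y' w' : reach z' y' -> reach y' w' -> reach z' w'.
  by move=> [u <-] [v <-]; exists (u ++ v); rewrite foldl_cat.
have flip x b c : reach (x, b) (x, c).
  by case: b c => [] []; by [exists [::] | exists [:: i0]].
have step x i : reach (x, true) (act x (gen i), true).
  elim/I3E: i; [by exists [::]; rewrite M0|by exists [:: i0; i1;
    i0]|by exists [:: i2]].
case: z w => [x b] [y c];
  apply: (tr _ _ _ (flip x b true) (tr _ _ _ _ (flip y true c))).
have [g <-] := act_trans x y; elim/gamma_ind: g => [|g i IH].
  by rewrite act1; exact: flip.
by rewrite actM; exact: (tr _ _ _ IH (step _ _)).
Qed.

Definition double : emap :=
  invol_map double_sq double_02 double_inh double_trans.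

Lemma double_act (z : double) i : act z (gen i) = double_gen i z.
Proof. exact: invol_map_gen. Qed.

Lemma double_side (z : double) g : (act z g).2 = z.2 <-> N T2 g.
Proof.
elim/gamma_ind: g => [|g i IH]; first by rewrite act1; split=> // _; exact: N2_1.
rewrite actM double_act N2_mul -(propext IH); move: (act z g) => [x b] {IH}.
elim/I3E: i; rewrite /double_gen //=; last by case: b.
by case: b z.2 => [] [].
Qed.

Definition outer_kernel : set Gamma :=
  [set g | forall x, act ((x, true) : double) g = (x, true)].

Lemma outer_kernel_subgroup : subgroup outer_kernel.
Proof.
split=> [x|g h Kg Kh x]; first exact: act1.
by rewrite actM Kg -{1}(Kh x) actK.
Qed.

Lemma outer_kernel_N2 : outer_kernel `<=` N T2.
Proof.
move=> g Kg; have [x] := flag_inh M.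
by apply/(double_side ((x, true) : double)); rewrite Kg.
Qed.

Lemma outer_kernel_norm : N T2 `<=` normaliser outer_kernel.
Proof.
suff E k l : outer_kernel k -> N T2 l -> outer_kernel (k ^ l).
  move=> g Ng; apply/normaliserP => h; split=> [|/E]; last exact.
  move=> /E/(_ (subgroupV N2_subgroup Ng)).
  by rewrite -conjgM mulgV conjg1.
move=> Kk Nl x; rewrite conjgE !actM.
have : (act ((x, true) : double) l^-1).2 = true.
  by apply/(double_side ((x, true) : double)); exact: subgroupV N2_subgroup Nl.
by case E : (act _ l^-1) => [y []] // _; rewrite Kk -E actVK.
Qed.

Lemma outer_S1 : outer_kernel S1.
Proof. by move=> x; rewrite double_act. Qed.

Lemma outer_S2 x : act ((x, true) : double) S2 = (act x R1, true).
Proof. by rewrite /S2 conjgE (invol_inv (gen_sq _)) !actM !double_act. Qed.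

(** On the flags at the new vertices, S_1 acts trivially while S_2 and S_3 act as
    R_1 and R_2 do on M. *)
Lemma outer_alt x l :
  act ((x, true) : double) (alt S2 S3 l) = (act x (alt R1 R2 l), true).
Proof.
pose P g h := forall x, act ((x, true) : double) g = (act x h, true).
have PM g h g' h' : P g h -> P g' h' -> P (g * g') (h * h').
  by move=> E E' y; rewrite !actM E E'.
have PV g h : P g h -> P g^-1 h^-1.
  by move=> E y; rewrite -{1}(actVK y h) -E actK.
have P1 : P 1 1 by move=> y; rewrite !act1.
have PZ k : P (zpow (S2 * S3) k) (zpow (R1 * R2) k).
  have P23 : P (S2 * S3) (R1 * R2).
    by apply: PM => y; [exact: outer_S2|rewrite double_act].
  elim/int_rect: k => [//|k IH|k IH].
    by rewrite -addn1 PoszD !zpowS; exact: PM.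
  by rewrite -addn1 PoszD GRing.opprD !zpowB1; apply: PM => //; exact: PV.
apply: PM; first exact: PZ.
by case: l.2 => // y; rewrite double_act.
Qed.

Lemma outer_kernel_alt l : outer_kernel (alt S2 S3 l) <-> kernel M (alt R1 R2 l).
Proof.
by split=> E x; have := E x; rewrite outer_alt; [case|move=> ->].
Qed.

Lemma stab_double (x : M) : stab x = kernel M ->
  stab ((x, true) : double) = outer_kernel.
Proof.
move=> xK; apply/seteqP; split=> [g gx|g]; last exact.
have Ng : N T2 g by apply/(double_side ((x, true) : double)); rewrite gx.
have sO := outer_kernel_subgroup.
have [|t [l _ <-]|_ [l _ <-] Ol] := @N2_cover (range (alt S2 S3)) _ sO _ _ g Ng.
- by exists (0%R, true) => //; rewrite /alt mulg1.
- have step l' s : alt S2 S3 l * s = alt S2 S3 l' ->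
      exists2 t', range (alt S2 S3) t' & outer_kernel (alt S2 S3 l * s / t').
    by move=> ->; exists (alt S2 S3 l'); [exists l'|rewrite divgg; exact: sO.1].
  split.
  + exists (alt S2 S3 l); [by exists l|apply: (@absorb outer_kernel)].
      by apply: outer_kernel_norm; exact: N2_alt23.
    exact: outer_S1.
  + by apply/step/alt_step_a; [exact: S2_sq|exact: gen_sq].
  + by apply/step/alt_step_b; exact: gen_sq.
apply/(same_coset sO Ol)/outer_kernel_alt; rewrite -xK.
have : stab ((x, true) : double) (alt S2 S3 l).
  have Ox : stab ((x, true) : double) (g / alt S2 S3 l) := Ol x.
  exact/(same_coset (stab_subgroup _) Ox).
by rewrite /stab /= outer_alt => -[].
Qed.

End Double.

(** * The classification for T = 2 *)

Definition subM2 n := ncl (N T2) (S1 |` power_relator (S2 * S3) n).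
Definition subM20 := ncl (N T2) [set S1; S3].

Lemma mapA_R0 n : kernel (mapA n) R0.
Proof.
have [y yE] := stab_coset_map (@ncl_subgroup setT (R0 |` power_relator (R1 *
  R2) n)).
have <- : stab y = kernel (mapA n).
  by apply: stab_kernel; rewrite yE; exact: ncl_norm.
by rewrite yE; exact: subA_R0.
Qed.

Lemma mapA_kernel n (x : mapA n) : stab x = subA n /\ stab x = kernel (mapA n).
Proof.
have [y yE] := stab_coset_map (@ncl_subgroup setT (R0 |` power_relator (R1 *
  R2) n)).
have yK : stab y = kernel (mapA n).
  by apply: stab_kernel; rewrite yE; exact: ncl_norm.
have xK : stab x = kernel (mapA n).
  apply: stab_kernel; have [g <-] := act_trans y x.
  rewrite stab_act yE (_ : conj_set _ _ = subA n); first exact: subA_normal.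
  exact: (@subA_normal n g I).
by split=> //; rewrite xK -yK yE.
Qed.

Lemma mapD_kernel (x : mapD) : stab x = subD /\ stab x = kernel mapD.
Proof.
have [y yE] := stab_coset_map subD_subgroup.
have nD : setT `<=` normaliser subD by exact: ncl_norm.
have yK : stab y = kernel mapD by apply: stab_kernel; rewrite yE.
have xK : stab x = kernel mapD.
  apply: stab_kernel; have [g <-] := act_trans y x.
  by rewrite stab_act yE (_ : conj_set _ _ = subD)//; exact: (nD g I).
by split=> //; rewrite xK -yK yE.
Qed.

Lemma subD_R1 : ~ subD R1.
Proof.
suff subH : subD `<=` index2 [:: i0; i2].
  by move=> /subH /(@index2_gen [:: i0; i2] i1 i1 isT).
apply: ncl_min; first exact: (@index2_subgroup _ i1).
  by move=> g [] ->; exact/(@index2_gen _ i1).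
exact: (@index2_normal _ i1).
Qed.

Lemma mapD_R0 : kernel mapD R0.
Proof.
have [x] := flag_inh mapD; have [xD <-] := mapD_kernel x.
by rewrite xD; apply: sub_ncl; left.
Qed.

Lemma outer_mapA n : natinf_pos n -> outer_kernel (@mapA_R0 n) = subM2 n.
Proof.
move=> n0; apply: mapM2_subgroupP; [exact: outer_kernel_subgroup|
  exact: outer_kernel_N2|exact: outer_kernel_norm|exact: outer_S1|].
move=> l; rewrite outer_kernel_alt; have [x] := flag_inh (mapA n).
by have [xA <-] := mapA_kernel x; rewrite xA; exact: subA_trace.
Qed.

Lemma outer_mapD : outer_kernel mapD_R0 = subM20.
Proof.
have [x] := flag_inh mapD; have [xD xK] := mapD_kernel x.
have DR2 : kernel mapD R2 by rewrite -xK xD; apply: sub_ncl; right.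
apply: mapM20_subgroupP; [exact: outer_kernel_subgroup|
  exact: outer_kernel_N2|exact: outer_kernel_norm|exact: outer_S1| |].
- by move=> y; rewrite double_act /double_gen /= DR2.
- move=> /(_ x); rewrite outer_S2 => -[xR1]; apply: subD_R1.
  by rewrite -xD.
Qed.

Lemma mapM2_double n : natinf_pos n -> map_iso (mapM2 n) (double (@mapA_R0 n)).
Proof.
move=> n0; apply: map_iso_sym; apply/map_iso_coset; first exact: ncl_subgroup.
have [x] := flag_inh (mapA n); have [_ xK] := mapA_kernel x.
by exists (x, true); rewrite stab_double// outer_mapA.
Qed.

Lemma mapM20_double : map_iso mapM20 (double mapD_R0).
Proof.
apply: map_iso_sym; apply/map_iso_coset; first exact: ncl_subgroup.
have [x] := flag_inh mapD; have [_ xK] := mapD_kernel x.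
by exists (x, true); rewrite stab_double// outer_mapD.
Qed.

Lemma subM2_trace n : natinf_pos n -> dih_trace (subM2 n) S2 S3 n.
Proof.
move=> n0 l; rewrite -outer_mapA// outer_kernel_alt.
have [x] := flag_inh (mapA n); have [xA <-] := mapA_kernel x.
by rewrite xA; exact: subA_trace.
Qed.

Lemma subM2_S1 n : subM2 n S1.
Proof. by apply: sub_ncl; left. Qed.

Lemma subM2_S2 n : natinf_pos n -> ~ subM2 n S2.
Proof.
move=> n0; have -> : S2 = alt S2 S3 (1%R, false).
  by rewrite /alt /= expg1 -mulgA gen_sq mulg1.
by move=> /(subM2_trace n0)[].
Qed.

Lemma subM20_S2 : ~ subM20 S2.
Proof.
rewrite -outer_mapD; have [x] := flag_inh mapD => /(_ x).
rewrite outer_S2 => -[xR1]; apply: subD_R1.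
by have [<- _] := mapD_kernel x.
Qed.

Lemma normaliser_N2 H : subgroup H -> N T2 `<=` normaliser H -> H S1 -> ~ H S2 ->
  normaliser H = N T2.
Proof.
move=> sH nH HS1 HS2; apply: normaliser_eq_N2 => // nR0; apply: HS2.
exact: normaliserJ nR0 HS1.
Qed.

(** Up to the choice of x, the stabiliser contains S_1 = R_1 or S_3 = R_2, for R_0
    does not normalise it. For the same reason it can neither contain both S_1
    and S_2, nor contain S_3 without one of them; conjugating by R_0 if
    necessary, it contains S_1 but not S_2. *)
Lemma class2_iso M : in_class T2 M -> has_boundary M ->
  (exists2 n, natinf_pos n & map_iso M (mapM2 n)) \/ map_iso M mapM20.
Proof.
move=> c2 /has_boundaryP[x [i Hi]].
have props (y : M) : [/\ subgroup (stab y), stab y `<=` N T2 &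
    N T2 `<=` normaliser (stab y)].
  split; [exact: stab_subgroup| |by rewrite c2].
  by rewrite -(c2 y); exact: sub_normaliser (stab_subgroup y).
have nR0 (y : M) : ~ normaliser (stab y) R0 by rewrite c2; exact: N2_R0.
have iso20 (y : M) : stab y S1 -> stab y S3 -> map_iso M mapM20.
  have [sy yN ny] := props y => y1 y3.
  apply/map_iso_coset; first exact: ncl_subgroup.
  exists y; apply: mapM20_subgroupP => // y2.
  by apply: (nR0 y); exact: R0_normalises_S12.
have [sH HN nH] := props x.
have [H1|H1] := pselect (stab x S1).
  have [H3|H3] := pselect (stab x S3); first by right; exact: iso20 H1 H3.
  have H2 : ~ stab x S2 by move=> H2; apply: (nR0 x); exact: R0_normalises_S12.
  have [n n0 nE] := dih_traceP sH S2_sq (gen_sq i2) (nH _ N2_S2) (nH _ N2_R2) H2 H3.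
  left; exists n => //; apply/map_iso_coset; first exact: ncl_subgroup.
  by exists x; exact: mapM2_subgroupP.
have H3 : stab x S3.
  move: Hi; elim/I3E: i => // /HN /N2_R0//.
have [H2|H2] := pselect (stab x S2); last first.
  by exfalso; apply: (nR0 x); exact: R0_normalises_S3.
right; apply: (iso20 (act x R0)); rewrite stab_act.
  by rewrite -S2_R0; exists S2.
by rewrite -S3_R0; exists S3.
Qed.

Lemma class2P M : in_class T2 M /\ has_boundary M <->
  (exists2 n, natinf_pos n & map_iso M (mapM2 n)) \/ map_iso M mapM20.
Proof.
split=> [[]|]; first exact: class2_iso.
have coset H : subgroup H -> N T2 `<=` normaliser H -> H S1 -> ~ H S2 ->
    map_iso M (coset_map H) -> in_class T2 M /\ has_boundary M.
  move=> sH nH H1 H2 iso; have [y yE] := stab_coset_map sH.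
  split; last by apply: (has_boundary_iso (y := y) (i := i1)) => //; rewrite yE.
  have [x xE] := map_iso_stab y iso; apply/(in_classP x (@N_normal T2)).
  by rewrite xE yE; exact: normaliser_N2.
case=> [[n n0]|]; apply: coset.
- exact: ncl_subgroup.
- exact: ncl_norm.
- exact: subM2_S1.
- exact: subM2_S2.
- exact: ncl_subgroup.
- exact: ncl_norm.
- by apply: sub_ncl; left.
- exact: subM20_S2.
Qed.

Lemma class2_R1 M : in_class T2 M -> has_boundary M ->
  exists x : M, stab x R1.
Proof.
move=> c2 b2; have coset H : subgroup H -> H S1 -> map_iso M (coset_map H) ->
    exists x : M, stab x R1.
  move=> sH H1 iso; have [y yE] := stab_coset_map sH.
  by have [x xE] := map_iso_stab y iso; exists x; rewrite xE yE.
case: (class2_iso c2 b2) => [[n n0]|]; apply: coset.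
- exact: ncl_subgroup.
- exact: subM2_S1.
- exact: ncl_subgroup.
- by apply: sub_ncl; left.
Qed.

(** * Duality and Petrie duality *)

Lemma in_class_twist s (s1 : s 1 = 1) (sM : {morph s : x y / x * y})
    (sK : involutive s) T T' M : (forall g, N T (s g) <-> N T' g) ->
  in_class T (twist s1 sM sK M) <-> in_class T' M.
Proof.
move=> NE.
have imE H g : (s @` H) g <-> H (s g).
  split=> [[h Hh <-]|Hg]; first by rewrite sK.
  by exists (s g); rewrite ?sK.
have sV g : s g^-1 = (s g)^-1.
  by apply: (mulgI (s g)); rewrite -sM !mulgV s1.
have nE H g : normaliser (s @` H) (s g) <-> normaliser H g.
  have sJ h k : s (h ^ k) = s h ^ s k by rewrite !conjgE !sM sV.
  split=> /normaliserP E; apply/normaliserP => h.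
    by move: (E (s h)); rewrite !imE -sJ !sK.
  by rewrite !imE sJ sK E.
split=> cl x.
  apply/seteqP; split=> g.
    by move=> /nE; rewrite -(stab_twist s1 sM sK) cl => /NE.
  by move=> /NE; rewrite -(cl x) stab_twist => /nE.
have NE' g : N T' (s g) <-> N T g by rewrite -NE sK.
rewrite stab_twist; apply/seteqP; split=> g.
  by rewrite -{1}(sK g) => /nE; rewrite cl => /NE'.
by move=> /NE'; rewrite -(cl x) => /nE; rewrite sK.
Qed.

Lemma has_boundary_dual M : has_boundary (dual_map M) <-> has_boundary M.
Proof.
rewrite !has_boundaryP; split=> -[x [i xi]].
  by move: xi; rewrite /stab /= dual_act => xi; exists x; eexists; exact: xi.
exists x, (if i == i0 then i2 else if i == i1 then i1 else i0).
by rewrite /stab /= dual_act; move: xi; elim/I3E: i.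
Qed.

Lemma class2sP M : in_class T2s M /\ has_boundary M <->
  (exists2 n, natinf_pos n & map_iso M (mapM2s n)) \/ map_iso M mapM2s0.
Proof.
rewrite -(in_class_twist delta1 deltaM deltaK M N2_delta) -has_boundary_dual.
rewrite class2P /mapM2s0 map_iso_dual; split=> -[[n n0 iso]|iso];
  [left|by right|left|by right];
  by exists n => //; move: iso; rewrite /mapM2s map_iso_dual.
Qed.

Lemma petrie_act M (x : petrie_map M) i :
  act x (gen i) = act (x : M) (if i == i0 then R0 * R2 else gen i).
Proof. by rewrite [LHS]/(act (x : M) (petrie (gen i))) petrie_genE. Qed.

(** Only R_1 lies in N(2^P), so that Petrie duality, which fixes R_1, preserves
    boundaries in this class. *)
Lemma class2PP M : in_class T2P M /\ has_boundary M <->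
  (exists2 n, natinf_pos n & map_iso M (mapM2P n)) \/ map_iso M mapM2P0.
Proof.
have NP g : N T2s (petrie g) <-> N T2P g by rewrite -N2s_petrie petrieK.
transitivity (in_class T2s (petrie_map M) /\ has_boundary (petrie_map M)).
  rewrite (in_class_twist petrie1 petrieM petrieK M NP).
  split=> -[cP bM]; split=> //; apply/has_boundaryP.
    move/has_boundaryP: bM => [x [i xi]]; exists x, i1;
      rewrite /stab /= petrie_act /=.
    have : N T2P (gen i) by rewrite -(cP x);
      exact: sub_normaliser (stab_subgroup x) _ xi.
    by move: xi; elim/I3E: i => //; rewrite ?N_R0 ?N_R2.
  have c2 : in_class T2 (dual_map (petrie_map M)).
    apply/(in_class_twist delta1 deltaM deltaK _ N2_delta).
    exact/(in_class_twist petrie1 petrieM petrieK M NP).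
  have [|x] := class2_R1 c2; first exact/has_boundary_dual.
  by rewrite /stab /= dual_act /= petrie_act /= => xR1; exists x, i1.
rewrite class2sP /mapM2P0 map_iso_petrie; split=> -[[n n0 iso]|iso];
  [left|by right|left|by right];
  by exists n => //; move: iso; rewrite /mapM2P map_iso_petrie.
Qed.

End Doubling.

(** * Continuity of explicit formulas *)

Section Continuity.
Import Order.TTheory GRing.Theory Num.Theory.
Local Open Scope classical_set_scope.
Local Open Scope ring_scope.
Variable R : realType.

Lemma row_continuous (T : topologicalType) (f : T -> 'rV[R]_3) :
  (forall j, continuous (fun x => f x ord0 j)) -> continuous f.
Proof.
move=> fc x A [P nP sub].
have : \forall y \near x, forall (i : 'I_1) (j : 'I_3), P i j (f y i j).
  apply: filter_forall => i; apply: filter_forall => j.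
  by have := nP i j; rewrite ord1; exact: fc.
by apply: filterS => y Py; exact: sub.
Qed.

Lemma coordC j : continuous (fun t : 'rV[R]_3 => t ord0 j).
Proof. exact: coord_continuous. Qed.

Lemma pair_continuous (T U V : topologicalType) (f : T -> U) (g : T -> V) :
  continuous f -> continuous g -> continuous (fun x => (f x, g x)).
Proof. by move=> fc gc x; apply: cvg_pair; [exact: fc|exact: gc]. Qed.

Section RealFunctions.
Variables (T : topologicalType) (f g : T -> R).
Hypotheses (fc : continuous f) (gc : continuous g).

Lemma continuous_cst (c : R) : continuous (fun _ : T => c).
Proof. exact: cst_continuous. Qed.

Lemma continuous_add : continuous (fun x => f x + g x).
Proof. by move=> x; apply: continuousD; [exact: fc|exact: gc]. Qed.

Lemma continuous_mul : continuous (fun x => f x * g x).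
Proof. by move=> x; apply: continuousM; [exact: fc|exact: gc]. Qed.

Lemma continuous_opp : continuous (fun x => - f x).
Proof. by move=> x; apply: continuousN; exact: fc. Qed.

Lemma continuous_inv : (forall x, f x != 0) -> continuous (fun x => (f x)^-1).
Proof. by move=> f0 x; apply: continuousV; [exact: f0|exact: fc]. Qed.

Lemma continuous_of_comp (F : R -> R) :
  continuous F -> continuous (fun x => F (f x)).
Proof. by move=> Fc x; apply: continuous_comp; [exact: fc|exact: Fc]. Qed.

End RealFunctions.

Lemma within_continuous_comp (T U V : topologicalType) (A : set T) (B : set U)
    (f : T -> U) (g : U -> V) : {within A, continuous f} ->
  (forall x, A x -> B (f x)) -> {within B, continuous g} ->
  {within A, continuous (fun x => g (f x))}.
Proof.
move=> /subspace_continuousP fc AB /subspace_continuousP gc.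
apply/subspace_continuousP => x Ax C nC.
have := fc x Ax _ (gc _ (AB x Ax) _ nC); rewrite /nbhs /=.
change (nbhs x [set z | A z -> B (f z) -> C (g (f z))] ->
  nbhs x [set z | A z -> C (g (f z))]).
by apply: filterS => z zC Az; apply: zC => //; exact: AB.
Qed.

Lemma continuous_sqrt (T : topologicalType) (f : T -> R) :
  continuous f -> continuous (fun x => Num.sqrt (f x)).
Proof. by move=> fc; apply: (continuous_of_comp fc); exact: sqrt_continuous. Qed.

End Continuity.

Ltac cont :=
  lazymatch goal with
  | |- context [continuous_at _ ?F] =>
    lazymatch F with
    | (fun t => fun_of_matrix t _ _) => exact: coordC
    | (fun t => (@?f t, @?g t)) => apply: pair_continuous; cont
    | (fun t => @?f t + @?g t)%R => apply: continuous_add; cont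
    | (fun t => @?f t * @?g t)%R => apply: continuous_mul; cont
    | (fun t => - @?f t)%R => apply: continuous_opp; cont
    | (fun t => Num.sqrt (@?f t)) => apply: continuous_sqrt; cont
    | (fun t => ?c) => exact: continuous_cst
    | _ => idtac
    end
  end.

(** * Barycentric tilings *)

Section Tilings.
Import Order.TTheory GRing.Theory Num.Theory.
Local Open Scope classical_set_scope.
Local Open Scope ring_scope.
Variable R : realType.
Implicit Types (M : emap) (t s u : 'rV[R]_3).
Arguments N T : simpl never.
Arguments act : simpl never.

Definition row3 (a b c : R) : 'rV[R]_3 :=
  \row_j (if j == i0 then a else if j == i1 then b else c).

Lemma row3E a b c : (row3 a b c ord0 i0 = a) * (row3 a b c ord0 i1 = b) *
  (row3 a b c ord0 i2 = c).
Proof. by rewrite !mxE. Qed.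

Lemma row3_eq s t : s ord0 i0 = t ord0 i0 -> s ord0 i1 = t ord0 i1 ->
  s ord0 i2 = t ord0 i2 -> s = t.
Proof. by move=> *; apply/rowP; apply: I3E. Qed.

Lemma sum3E (F : 'I_3 -> R) : \sum_i F i = F i0 + F i1 + F i2.
Proof.
rewrite !big_ord_recr big_ord0 /= add0r.
by congr (F _ + F _ + F _); apply: val_inj.
Qed.

Lemma triangleE t : triangle t <->
  [/\ 0 <= t ord0 i0, 0 <= t ord0 i1, 0 <= t ord0 i2 &
      t ord0 i0 + t ord0 i1 + t ord0 i2 = 1].
Proof.
rewrite /triangle /= sum3E; split=> [[t0 t1]|[h0 h1 h2 ht]]; first by split.
by split=> //; exact: I3E.
Qed.

(** ** The gluing relation *)

Lemma glued_refl M t (x : M) : glued t x x.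
Proof. by exists 1%g; [move=> H [[]]|exact: act1]. Qed.

Lemma glued_gen M t (x : M) i : t ord0 i = 0 -> glued t x (act x (gen i)).
Proof. by move=> ti; exists (gen i) => // H [sH sub]; apply: sub; exists i. Qed.

(** The gluing at a point is generated by the reflections in the sides through
    that point. *)
Lemma glued_rel M (T : Type) (F : M -> T) (E : T -> T -> Prop) t (x y : M) :
  (forall a, E a a) -> (forall a b, E a b -> E b a) ->
  (forall a b c, E a b -> E b c -> E a c) ->
  (forall z i, t ord0 i = 0 -> E (F z) (F (act z (gen i)))) ->
  glued t x y -> E (F x) (F y).
Proof.
move=> Er Es Et Eg [g gt <-].
apply: (gt [set h | forall z, E (F z) (F (act z h))]); split.
  split=> [z|h k Hh Hk z]; first by rewrite act1.
  rewrite actM; apply: Et (Hh z) _; apply: Es.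
  by rewrite -{2}[act z h](actVK _ k); exact: Hk.
by move=> _ [i ti <-] z; exact: Eg.
Qed.

Lemma glued_sym M t (x y : M) : glued t x y -> glued t y x.
Proof.
move=> [g gt <-]; exists g^-1%g; last exact: actK.
move=> H HA; have [sH _] := HA; apply: subgroupV => //; exact: gt.
Qed.

Lemma glued_trans M t (x y z : M) : glued t x y -> glued t y z -> glued t x z.
Proof.
move=> [g gt <-] [h ht <-]; exists (g * h)%g; last exact: actM.
by move=> H HA; have [sH _] := HA; apply: subgroupM => //; [exact: gt|exact: ht].
Qed.

Lemma glued_map M M' (F : M -> M') s t (x y : M) :
  (forall z i, t ord0 i = 0 -> glued s (F z) (F (act z (gen i)))) ->
  glued t x y -> glued s (F x) (F y).
Proof.
move=> Fg; apply: (glued_rel (E := @glued R M' s)) => //.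
- exact: glued_refl.
- exact: glued_sym.
- exact: glued_trans.
Qed.

Lemma glued_equivariant M M' (F : M -> M') t (x y : M) :
  equivariant F -> glued t x y -> glued t (F x) (F y).
Proof. by move=> FE [g gt <-]; exists g => //; rewrite FE. Qed.

(** ** Constructing tilings *)

Definition tiling M (X : topologicalType) (h : M -> 'rV[R]_3 -> X) :=
  [/\ forall x, {within @triangle R, continuous (h x)},
      forall x i t, triangle t -> t ord0 i = 0 -> h (act x (gen i)) t = h x t &
      forall x y s t, triangle s -> triangle t -> h x s = h y t ->
        s = t /\ glued s x y].

Lemma tilingP M (X : topologicalType) (h : M -> 'rV[R]_3 -> X) : tiling h ->
  forall x y s t, triangle s -> triangle t ->
    (h x s = h y t <-> s = t /\ glued s x y).
Proof.
move=> [_ hg hi] x y s t ts tt; split; first exact: hi.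
move=> [<- xy]; apply: (glued_rel (F := fun z => h z s) (E := eq) _ _ _ _ xy) => //.
- by move=> a b c -> ->.
- by move=> z i si; rewrite hg.
Qed.

Lemma lies_on_tiling M (X : topologicalType) (S : set X)
    (h : M -> 'rV[R]_3 -> X) : tiling h ->
  (forall x t, triangle t -> S (h x t)) ->
  (forall p, S p -> exists x, exists2 t, triangle t & h x t = p) ->
  (forall p, S p -> finite_set [set x | (h x @` @triangle R) p] ->
     exists2 U, nbhs p U &
       finite_set [set x | h x @` @triangle R `&` U !=set0]) ->
  lies_on R M S.
Proof.
move=> ht hS Sh hf; exists h; split=> //; [by case: ht|exact: tilingP|].
apply/seteqP; split=> [_ [x _ [t tt <-]]|p /Sh[x [t tt <-]]]; first exact: hS.
by exists x => //; exists t.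
Qed.

Lemma lies_on_finite M (X : topologicalType) (S : set X)
    (h : M -> 'rV[R]_3 -> X) : finite_set [set: M] -> tiling h ->
  (forall x t, triangle t -> S (h x t)) ->
  (forall p, S p -> exists x, exists2 t, triangle t & h x t = p) ->
  lies_on R M S.
Proof.
move=> fM ht hS Sh; apply: (lies_on_tiling ht hS Sh) => p _ _.
by exists setT; [exact: filterT|apply: sub_finite_set fM].
Qed.

(** The triangles of M' are pieces of the triangles of M, phi x being the affine
    chart of the piece x of the triangle pi x. Composed with these charts, an
    embedding of M becomes one of M', and it stays locally finite because each
    triangle is cut into finitely many pieces. *)
Lemma lies_on_refine M M' (X : topologicalType) (S : set X)
    (pi : M' -> M) (phi : M' -> 'rV[R]_3 -> 'rV[R]_3) :
  (forall x, continuous (phi x)) ->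
  (forall x t, triangle t -> triangle (phi x t)) ->
  (forall x u, triangle u ->
     exists x', exists2 t, triangle t & pi x' = x /\ phi x' t = u) ->
  (forall x i t, triangle t -> t ord0 i = 0 ->
     phi (act x (gen i)) t = phi x t /\
     glued (phi x t) (pi (act x (gen i))) (pi x)) ->
  (forall x y s t, triangle s -> triangle t -> phi x s = phi y t ->
     glued (phi x s) (pi x) (pi y) -> s = t /\ glued s x y) ->
  (forall x, finite_set [set x' | pi x' = x]) ->
  lies_on R M S -> lies_on R M' S.
Proof.
move=> phic phit phis phig phii fib [h [hc hE hS hf]].
exists (fun x t => h (pi x) (phi x t)); split.
- move=> x; apply: (within_continuous_comp (B := @triangle R)) (hc _).
    exact: continuous_subspaceT.
  exact: phit.
- move=> x y s t ts tt; split.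
    by case/(hE _ _ _ _ (phit _ _ ts) (phit _ _ tt)); exact: phii.
  move=> [<- xy].
  apply: (glued_rel (F := fun z => h (pi z) (phi z s)) (E := eq) _ _ _ _ xy) => //.
    by move=> a b c -> ->.
  move=> z i si; have [pE pg] := phig z i s ts si.
  by apply/esym/hE; [exact: phit|exact: phit|rewrite pE].
- rewrite -hS; apply/seteqP; split=> p.
    by move=> [x _ [t tt <-]]; exists (pi x) => //; exists (phi x t) => //;
      exact: phit.
  move=> [x _ [u tu <-]]; have [x' [t tt [<- <-]]] := phis x u tu.
  by exists x' => //; exists t.
- move=> p Sp fp; have : finite_set [set x | (h x @` @triangle R) p].
    apply: sub_finite_set (finite_image pi fp) => x [u tu <-].
    have [x' [t tt [xE uE]]] := phis x u tu.
    by exists x' => //; exists t => //=; rewrite xE uE.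
  move=> /(hf p Sp)[U nU fU]; exists U => //.
  apply: sub_finite_set (bigcup_finite fU (fun x _ => fib x)).
  move=> x [q [[t tt <-] Uq]]; exists (pi x) => //.
  by exists (h (pi x) (phi x t)); split=> //; exists (phi x t) => //; exact: phit.
Qed.

(** Permuting the generators amounts to renaming the corners of the triangles,
    that is, to permuting the barycentric coordinates. *)
Lemma lies_on_corners M M' (X : topologicalType) (S : set X)
    (f : M' -> M) (g : M -> M') (p q : 'I_3 -> 'I_3) :
  cancel f g -> cancel g f -> cancel p q -> cancel q p ->
  (forall x i, f (act x (gen i)) = act (f x) (gen (p i))) ->
  lies_on R M S -> lies_on R M' S.
Proof.
move=> fg gf pq qp fE.
have qb (F : 'I_3 -> R) : \sum_j F (q j) = \sum_j F j.
  by rewrite [RHS](reindex_inj (can_inj qp)).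
pose phi (t : 'rV[R]_3) : 'rV[R]_3 := \row_j t ord0 (q j).
apply: (@lies_on_refine _ _ _ _ f (fun=> phi)).
- move=> _; apply: row_continuous => j; under eq_fun do rewrite mxE; exact: coordC.
- move=> _ t [t0 t1]; split=> [i|]; first by rewrite mxE.
  by under eq_bigr do rewrite mxE; rewrite (qb (fun j => t ord0 j)).
- move=> x u [u0 u1]; exists (g x); exists (\row_j u ord0 (p j)).
    split=> [i|]; first by rewrite mxE.
    by under eq_bigr do rewrite mxE; rewrite -qb; under eq_bigr do rewrite qp.
  by split=> //; apply/rowP => j; rewrite !mxE qp.
- move=> x i t tt ti; split=> //; rewrite fE; apply/glued_sym/glued_gen.
  by rewrite mxE pq.
- move=> x y s t _ _ E xy; split.
    by apply/rowP => j; move/rowP/(_ (p j)): E; rewrite !mxE pq.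
  rewrite -(fg x) -(fg y); apply: glued_map xy => z i; rewrite mxE => si.
  have -> : g (act z (gen i)) = act (g z) (gen (q i)).
    by rewrite -{1}(gf z) -{1}(qp i) -fE fg.
  exact: glued_gen.
- by move=> x; apply: sub_finite_set (finite_set1 (g x)) => y <-; rewrite fg.
Qed.

Lemma lies_on_iso M M' (X : topologicalType) (S : set X) :
  map_iso M' M -> lies_on R M S -> lies_on R M' S.
Proof.
move=> [f [[g fg gf] fE]].
by apply: (@lies_on_corners M M' X S f g id id) => // x i; rewrite fE.
Qed.

Definition swap02 (i : 'I_3) : 'I_3 :=
  if i == i0 then i2 else if i == i1 then i1 else i0.

Lemma swap02K : involutive swap02.
Proof. exact: I3E. Qed.

Lemma lies_on_dual M (X : topologicalType) (S : set X) :
  lies_on R M S -> lies_on R (dual_map M) S.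
Proof.
apply: (@lies_on_corners M (dual_map M) X S id id swap02 swap02) => //.
- exact: swap02K.
- exact: swap02K.
- exact: dual_act.
Qed.

Section DoubleTiling.
Variables (M : emap) (M0 : kernel M R0).

(** The new vertex cuts the side from corner 0 to corner 1 of each triangle at
    its midpoint, which becomes the midpoint of the new edge. *)
Definition half (b : bool) t : 'rV[R]_3 :=
  if b then row3 (t ord0 i1 / 2) (t ord0 i0 + t ord0 i1 / 2) (t ord0 i2)
  else row3 (t ord0 i0 + t ord0 i1 / 2) (t ord0 i1 / 2) (t ord0 i2).

Lemma lies_on_double (X : topologicalType) (S : set X) :
  lies_on R M S -> lies_on R (double M0) S.
Proof.
have halfE b t : [/\ half b t ord0 i0 = (if b then t ord0 i1 / 2 else t ord0 i0
  + t ord0 i1 / 2),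
    half b t ord0 i1 = (if b then t ord0 i0 + t ord0 i1 / 2 else t ord0 i1 / 2) &
    half b t ord0 i2 = t ord0 i2].
  by rewrite /half; case: b; rewrite !row3E.
apply: (@lies_on_refine M (double M0) X S fst (fun z => half z.2)).
- move=> [x b] /=; have c2 : continuous (fun t : 'rV[R]_3 => t ord0 i1 / 2).
    by cont.
  have c02 : continuous (fun t : 'rV[R]_3 => t ord0 i0 + t ord0 i1 / 2).
    by cont.
  apply: row_continuous; apply: I3E; rewrite /half; case: b;
    under eq_fun do rewrite row3E; by [exact: c2|exact: c02|exact: coordC].
- move=> [x b] t /triangleE[t0 t1 t2 te]; apply/triangleE;
    have [-> -> ->] := halfE b t.
  by case: b => /=; split; lra.
- move=> x u /triangleE[u0 u1 u2 ue]; have [c|c] := leP (u ord0 i1) (u ord0 i0).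
    exists (x, false), (row3 (u ord0 i0 - u ord0 i1) (2 * u ord0 i1) (u ord0 i2)).
      by apply/triangleE; rewrite !row3E; split; lra.
    by split=> //=; have [h0 h1 h2] := halfE false (row3 (u ord0 i0 - u ord0
      i1) (2 * u ord0 i1) (u ord0 i2));
      apply: row3_eq; rewrite ?h0 ?h1 ?h2 !row3E; lra.
  exists (x, true), (row3 (u ord0 i1 - u ord0 i0) (2 * u ord0 i0) (u ord0 i2)).
    by apply/triangleE; rewrite !row3E; split; lra.
  by split=> //=; have [h0 h1 h2] := halfE true (row3 (u ord0 i1 - u ord0 i0)
    (2 * u ord0 i0) (u ord0 i2));
    apply: row3_eq; rewrite ?h0 ?h1 ?h2 !row3E; lra.
- move=> [x b] i t /triangleE[t0 t1 t2 te]; rewrite double_act /double_gen.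
  have [h0 h1 h2] := halfE b t; elim/I3E: i => ti /=.
  + split; last exact: glued_refl.
    by have [k0 k1 k2] := halfE (~~ b) t; apply: row3_eq;
      rewrite ?h0 ?h1 ?h2 ?k0 ?k1 ?k2 ?ti; case: (b) => /=; lra.
  + case: b h0 h1 h2 => h0 h1 h2 /=; split=> //; first exact: glued_refl.
    by apply/glued_sym/glued_gen; rewrite h1 ti; lra.
  + by split=> //; apply/glued_sym/glued_gen; rewrite h2.
- move=> [x b] [y c] s t /triangleE[s0 s1 s2 se] /triangleE[t0 t1 t2 te] /= E xy.
  have [h0 h1 h2] := halfE b s; have [k0 k1 k2] := halfE c t.
  rewrite -E in k0 k1 k2; rewrite h0 in k0; rewrite h1 in k1; rewrite h2 in k2.
  have move_x : glued s ((x, b) : double M0) (y, b).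
    apply: (@glued_map _ (double M0) (fun z => (z, b)) s (half b s)) xy => z.
    have gen0 (w : double M0) : s ord0 i0 = 0 -> glued s w (w.1, ~~ w.2).
      by move=> ?; rewrite -[(_, _)]/(double_gen i0 w) -double_act;
        exact: glued_gen.
    apply: I3E; rewrite ?h0 ?h1 ?h2 => si.
    + by rewrite M0; exact: glued_refl.
    + case: b {h0 h1 h2 k0 k1 k2 E} si => si; last first.
        by rewrite /= -[(act _ R1, _)]/(double_gen i1 ((z,
          false) : double M0)) -double_act; apply: glued_gen; lra.
      apply: glued_trans (gen0 (z, true) _) _; first by lra.
      apply: glued_trans (glued_sym (gen0 (act z R1, true) _)); last by lra.
      by rewrite /= -[(act _ R1, _)]/(double_gen i1 ((z,
        false) : double M0)) -double_act; apply: glued_gen; lra.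
    + by rewrite -[(act _ R2, _)]/(double_gen i2 ((z,
        b) : double M0)) -double_act; exact: glued_gen.
  case: (eqVneq b c) k0 k1 => [<- k0 k1|bc k0 k1].
    by split=> //; case: b {h0 h1 h2 E xy move_x} k0 k1 => k0 k1;
      apply: row3_eq; lra.
  have cE : c = ~~ b by case: b c bc {h0 h1 h2 E xy move_x k0 k1} => [] [].
  rewrite {}cE in k0 k1 *.
  have st : s = t by case: b {h0 h1 h2 E xy move_x bc} k0 k1 => /= k0 k1;
    apply: row3_eq; lra.
  split=> //; apply: glued_trans move_x _.
  rewrite -[(y, ~~ b)]/(double_gen i0 ((y, b) : double M0)) -double_act.
  apply: glued_gen.
  by case: b {h0 h1 h2 E xy bc} k0 k1 => /= k0 k1; lra.
- move=> x; apply: (sub_finite_set (B := [set (x, true); (x, false)]));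
    last exact: finite_set2.
  by move=> [y []] /= ->; [left|right].
Qed.

End DoubleTiling.

(** A function h constant along the fibres of the covering f descends to M'. It is
    injective up to gluing there as soon as overlapping triangles of M can be
    glued after moving one of them within its fibre. *)
Lemma tiling_descend M M' (X : topologicalType)
    (f : M -> M') (h : M -> 'rV[R]_3 -> X) :
  equivariant f -> (forall y, exists x, f x = y) ->
  (forall x, {within @triangle R, continuous (h x)}) ->
  (forall x i t, triangle t -> t ord0 i = 0 -> h (act x (gen i)) t = h x t) ->
  (forall x y t, triangle t -> f x = f y -> h x t = h y t) ->
  (forall x y s t, triangle s -> triangle t -> h x s = h y t ->
     exists2 z, f z = f y & s = t /\ glued s x z) ->
  exists2 h' : M' -> 'rV[R]_3 -> X, tiling h' &
    forall x t, triangle t -> h' (f x) t = h x t.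
Proof.
move=> fE fs hc hg wd hi.
pose l y := projT1 (cid (fs y)); have lE y : f (l y) = y by rewrite /l; case: cid.
exists (fun y t => h (l y) t); last by move=> x t tt; apply: wd => //; rewrite lE.
split=> [y|y i t tt ti|x y s t ts tt /(hi _ _ _ _ ts tt)[z zE [st xz]]].
- exact: hc.
- by rewrite -(hg (l y) i)//; apply: wd => //; rewrite fE !lE.
- by split=> //; rewrite -(lE x) -(lE y) -zE; exact: glued_equivariant.
Qed.

End Tilings.

(** * Models of the maps *)

Section Models.
Local Open Scope classical_set_scope.
Local Open Scope group_scope.
Arguments N T : simpl never.
Arguments act : simpl never.
Implicit Types (M : emap).

(** The infinite dihedral group <R_1, R_2>, as a map on which R_0 acts
    trivially. *)
Definition line_gen (i : 'I_3) (l : int * bool) : int * bool :=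
  if i == i1 then step_a l else if i == i2 then step_b l else l.

Lemma line_sq i l : line_gen i (line_gen i l) = l.
Proof. by elim/I3E: i; rewrite /line_gen /= ?step_aK ?step_bK. Qed.

Lemma line_02 l : line_gen i2 (line_gen i0 l) = line_gen i0 (line_gen i2 l).
Proof. by []. Qed.

Lemma line_inh : inhabited (int * bool).
Proof. by constructor; exact: (0%R, true). Qed.

Lemma line_trans l l' : exists u, foldl (fun z i => line_gen i z) l u = l'.
Proof.
pose reach l l' := exists u, foldl (fun z i => line_gen i z) l u = l'.
have tr l1 l2 l3 : reach l1 l2 -> reach l2 l3 -> reach l1 l3.
  by move=> [u <-] [v <-]; exists (u ++ v); rewrite foldl_cat.
have flip k b c : reach (k, b) (k, c).
  by case: b c => [] []; by [exists [::] | exists [:: i2]].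
have up (k : int) (m : nat) : reach (k, true) (k + Posz m, true)%R.
  elim: m => [|m IH]; first by rewrite GRing.addr0; exact: flip.
  apply: (tr _ _ _ IH); exists [:: i1; i2]; rewrite /line_gen /= /step_a /step_b /=.
  by rewrite -GRing.addrA -addn1.
have down (k : int) (m : nat) : reach (k, false) (k - Posz m, false)%R.
  elim: m => [|m IH]; first by rewrite GRing.subr0; exact: flip.
  apply: (tr _ _ _ IH); exists [:: i1; i2]; rewrite /line_gen /= /step_a /step_b /=.
  by rewrite -addn1 PoszD GRing.opprD GRing.addrA.
case: l l' => k b [k' c]; have [kk'|kk'] := Order.TotalTheory.leP k k'.
  have -> : (k' = k + Posz `|k' - k|%N)%R by lia.
  exact: tr (flip k b true) (tr _ _ _ (up k _) (flip _ true c)).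
have -> : (k' = k - Posz `|k' - k|%N)%R by lia.
exact: tr (flip k b false) (tr _ _ _ (down k _) (flip _ false c)).
Qed.

Definition line : emap := invol_map line_sq line_02 line_inh line_trans.

Lemma line_act (l : line) i : act l (gen i) = line_gen i l.
Proof. exact: invol_map_gen. Qed.

Lemma line_R0 : kernel line R0.
Proof. by move=> l; rewrite line_act. Qed.

Definition line_cong n (l l' : line) : Prop :=
  l.2 = l'.2 /\ dih_cong n ((l.1 - l'.1)%R, true).

(** Reading the normal forms of the dihedral group from a base flag commutes with
    the generators; the fibres are the cosets of the rotations fixing that
    flag. *)
Lemma line_cover M (x0 : M) n : kernel M R0 ->
  dih_trace (stab x0) R1 R2 n ->
  exists f : line -> M, [/\ equivariant f, forall y, exists l, f l = y &
    forall l l', f l = f l' <-> line_cong n l l'].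
Proof.
move=> M0 trn; pose f (l : line) := act x0 (alt R1 R2 l); exists f.
have fE : equivariant f.
  move=> l; elim/gamma_ind => [|g i IH]; first by rewrite !act1.
  rewrite !actM -IH line_act /f; move: (act l g) => {l IH} l.
  elim/I3E: i; rewrite /line_gen /=.
  - by rewrite M0.
  - by rewrite -actM (alt_step_a (gen_sq i1) (gen_sq i2)).
  - by rewrite -actM (alt_step_b _ (gen_sq i2)).
split=> // [y|[k b] [k' b']].
  have [g <-] := act_trans x0 y; exists (act ((0%R, true) : line) g).
  by rewrite fE /f /alt mulg1 act1.
have fV l l' : f l = f l' <-> stab x0 (alt R1 R2 l * (alt R1 R2 l')^-1).
  rewrite /stab /= actM; split=> [E|E].
    by rewrite -[act x0 _]/(f l) E actK.
  by rewrite -[LHS](actVK _ (alt R1 R2 l')) E.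
rewrite fV /line_cong /= -(trn ((k - k')%R, true)) {1}/alt /=.
have zB : zpow (R1 * R2) (k - k')%R = zpow (R1 * R2) k / zpow (R1 * R2) k'.
  by rewrite zpowD zpowN.
have Vb : R2^-1 = R2 by rewrite (invol_inv (gen_sq i2)).
have refl j : ~ stab x0 (zpow (R1 * R2) j * R2) by move=> /(trn (j, false))[].
rewrite /alt /= mulg1 zB; case: b b' => [] []; rewrite ?mulg1.
- by split=> [|[]].
- split=> [|[]//]; rewrite invgM Vb -zpowN zpow_invol ?gen_sq//.
  by rewrite mulgA -(zpowD _ k (- - k')%R) => S; case: (refl _ S).
- split=> [|[]//]; rewrite -mulgA -zpowN zpow_invol ?gen_sq//.
  by rewrite mulgA -(zpowD _ k (- - k')%R) => S; case: (refl _ S).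
- rewrite invgM !mulgA mulgK; tauto.
Qed.

Lemma line_mapA n : natinf_pos n ->
  exists f : line -> mapA n, [/\ equivariant f, forall y, exists l, f l = y &
    forall l l', f l = f l' <-> line_cong n l l'].
Proof.
move=> n0; have [x] := flag_inh (mapA n); have [xA xK] := mapA_kernel x.
apply: (line_cover (x0 := x)); first by rewrite -xK xA; exact: subA_R0.
by rewrite xA; exact: subA_trace.
Qed.

Lemma mapA_line : map_iso (mapA None) line.
Proof.
have [f [fE fs fi]] := @line_mapA None isT.
apply: map_iso_sym; exists f; split=> //.
have [g gE] : exists g, forall y, f (g y) = y.
  by exists (fun y => projT1 (cid (fs y))) => y; case: cid.
have finj : injective f.
  move=> [k b] [k' b'] /fi[/= -> [_ /= E]]; congr pair.
  by rewrite -(GRing.subrK k' k) E GRing.add0r.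
by exists g => // l; apply: finj; rewrite gE.
Qed.

Lemma mapA_finite n : (0 < n)%N -> finite_set [set: mapA (Some n)].
Proof.
move=> n0; have [f [fE fs fi]] := @line_mapA (Some n) n0.
have fin : finite_set ([set Posz k | k in `I_n] `*` [set: bool]).
  by apply: finite_setX; [apply: finite_image;
    exact: finite_II|exact: finite_finset].
apply: sub_finite_set (finite_image f fin) => y _.
have [[k b] <-] := fs y; exists ((k %% Posz n)%Z, b).
  split=> //=; exists `|(k %% Posz n)%Z|%N; last by lia.
  by rewrite /=; lia.
apply/fi; split=> //; split=> //=; rewrite {2}(divz_eq k (Posz n)).
by rewrite GRing.opprD GRing.addrCA GRing.subrr GRing.addr0 dvdzE abszN -dvdzE
  dvdz_mull.
Qed.

(** ** Maps with two flags *)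

Definition flip_gen (a : seq 'I_3) (i : 'I_3) (b : bool) : bool := b (+) (i \in a).

Section Flip.
Variables (a : seq 'I_3) (j : 'I_3).
Hypothesis ja : j \in a.

Lemma flip_sq i b : flip_gen a i (flip_gen a i b) = b.
Proof. by rewrite /flip_gen -addbA addbb addbF. Qed.

Lemma flip_02 b : flip_gen a i2 (flip_gen a i0 b) = flip_gen a i0 (flip_gen a i2 b).
Proof. by rewrite /flip_gen addbAC. Qed.

Lemma flip_trans b c : exists u, foldl (fun z i => flip_gen a i z) b u = c.
Proof.
have [->|bc] := eqVneq b c; first by exists [::].
by exists [:: j]; rewrite /= /flip_gen ja; case: b c bc => [] [].
Qed.

Definition flip_map : emap :=
  invol_map flip_sq flip_02 (inhabits true) flip_trans.

Lemma flip_act (b : flip_map) i : act b (gen i) = b (+) (i \in a).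
Proof. exact: invol_map_gen. Qed.

(** Such an H is the kernel of the parity of the number of letters from a. *)
Lemma coset_flip_map (H : set Gamma) : subgroup H ->
  (forall g i, H (g * gen i) <-> (if i \in a then ~ H g else H g)) ->
  map_iso (coset_map H) flip_map.
Proof.
move=> sH HE; apply/map_iso_sym/map_iso_coset => //; exists true.
have E g : act (true : flip_map) g = `[< H g >].
  elim/gamma_ind: g => [|g i IH]; first by rewrite act1; apply/esym/asboolP;
    exact: sH.1.
  rewrite actM flip_act IH; apply/idP/asboolP; rewrite HE; case: (i \in a);
    rewrite ?addbF ?addbT ?negb_involutive.
  - by move/negP => nH /asboolP.
  - by move/asboolP.
  - by move=> nH; apply/negP => /asboolP.
  - by move/asboolP.
by apply/seteqP; split=> g; rewrite /stab /= E => /asboolP.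
Qed.

End Flip.

Lemma mapN2_flip : map_iso (mapN T2) (@flip_map [:: i0] i0 isT).
Proof.
apply: coset_flip_map; first exact: N2_subgroup.
by move=> g i; rewrite N2_mul; elim/I3E: i.
Qed.

Lemma mapN2s_flip : map_iso (mapN T2s) (@flip_map [:: i2] i2 isT).
Proof.
apply: coset_flip_map; first exact: (N_subgroup T2s).
by move=> g i; rewrite N2s_mul; elim/I3E: i.
Qed.

Lemma mapN2P_flip : map_iso (mapN T2P) (@flip_map [:: i0; i2] i0 isT).
Proof.
apply: coset_flip_map; first exact: (N_subgroup T2P).
by move=> g i; rewrite N2P_mul; elim/I3E: i.
Qed.

Lemma mapD_flip : map_iso mapD (@flip_map [:: i1] i1 isT).
Proof.
have E : index2 [:: i0; i2] = subD.
  apply: mapD_subgroupP; first exact: (@index2_subgroup _ i1).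
  - exact: (@index2_normal _ i1).
  - exact/(@index2_gen _ i1).
  - exact/(@index2_gen _ i1).
  - by move/(@index2_gen [:: i0; i2] i1 i1 isT).
rewrite /mapD -/subD -E; apply: coset_flip_map;
  first exact: (@index2_subgroup _ i1).
by move=> g i; rewrite (@index2_mul _ i1)//; elim/I3E: i.
Qed.

Lemma mapA1_flip : map_iso (mapA (Some 1%N)) (@flip_map [:: i1; i2] i1 isT).
Proof.
have sI : subgroup (index2 [:: i0]) by exact: (@index2_subgroup _ i1).
have mul g i : index2 [:: i0] (g * gen i) <->
    (if i \in [:: i1; i2] then ~ index2 [:: i0] g else index2 [:: i0] g).
  by rewrite (@index2_mul _ i1)//; elim/I3E: i.
have E : index2 [:: i0] = subA (Some 1%N).
  apply: mapA_subgroupP => //; first exact: (@index2_normal _ i1).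
    exact/(@index2_gen _ i1).
  have zI k : index2 [:: i0] (zpow (R1 * R2) k).
    by apply: subgroup_zpow => //; rewrite mul /= (@index2_gen _ i1).
  move=> [k []]; rewrite /alt /dih_cong /= ?mulg1 ?mul /= ?dvd1z.
    by split.
  by split=> [|[]//]; move/(_ (zI k)).
by rewrite /mapA -/(subA _) -E; exact: coset_flip_map.
Qed.

(** ** Functoriality *)

Lemma map_iso_dual2 M M' : map_iso M M' -> map_iso (dual_map M) (dual_map M').
Proof. by move=> [f [fb fE]]; exists f; split=> // x g; exact: fE. Qed.

Lemma map_iso_petrie2 M M' :
  map_iso M M' -> map_iso (petrie_map M) (petrie_map M').
Proof. by move=> [f [fb fE]]; exists f; split=> // x g; exact: fE. Qed.

Definition double_fun M M' (f : M -> M') (z : M * bool) : M' * bool := (f z.1, z.2).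

Lemma double_equivariant M M' (M0 : kernel M R0) (M'0 : kernel M' R0)
    (f : M -> M') : equivariant f ->
  @equivariant (double M0) (double M'0) (double_fun f).
Proof.
move=> fE z; elim/gamma_ind => [|g i IH]; first by rewrite !act1.
rewrite !actM -IH !double_act; move: (act z g) => [x b].
by elim/I3E: i; case: b; rewrite /double_fun /double_gen /= ?fE.
Qed.

Lemma map_iso_double M M' (M0 : kernel M R0) (M'0 : kernel M' R0) :
  map_iso M M' -> map_iso (double M0) (double M'0).
Proof.
move=> [f [[g fg gf] fE]]; exists (double_fun f).
split; last exact: double_equivariant.
by exists (double_fun g) => -[x b]; rewrite /double_fun /= ?fg ?gf.
Qed.

Definition petrie_double M (M0 : kernel M R0) : emap :=
  petrie_map (dual_map (double M0)).

Lemma petrie_double_act M (M0 : kernel M R0) (z : petrie_double M0) i :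
  act z (gen i) =
  if i == i0 then (act z.1 R2, ~~ z.2) else
  if i == i1 then (if z.2 then z else (act z.1 R1, z.2)) else (z.1, ~~ z.2).
Proof.
rewrite petrie_act; elim/I3E: i => /=.
- by rewrite actM !dual_act /= !double_act.
- by rewrite dual_act /= double_act.
- by rewrite dual_act /= double_act.
Qed.

Lemma petrie_double_equivariant M M' (M0 : kernel M R0) (M'0 : kernel M' R0)
    (f : M -> M') : equivariant f ->
  @equivariant (petrie_double M0) (petrie_double M'0) (double_fun f).
Proof. by move=> fE z g; exact: (@double_equivariant M M' M0 M'0). Qed.

Lemma mapM2P_model n : natinf_pos n ->
  map_iso (mapM2P n) (petrie_double (@mapA_R0 n)).
Proof.
by move=> n0; apply/map_iso_petrie2/map_iso_dual2/mapM2_double.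
Qed.

Lemma flip1_R0 : kernel (@flip_map [:: i1] i1 isT) R0.
Proof. by move=> b; rewrite flip_act; case: b. Qed.

Lemma mapM2P0_model : map_iso mapM2P0 (petrie_double flip1_R0).
Proof.
apply/map_iso_petrie2/map_iso_dual2; apply: map_iso_trans mapM20_double _.
exact/map_iso_double/mapD_flip.
Qed.

Lemma double_finite M : finite_set [set: M] -> finite_set [set: M * bool].
Proof.
move=> fin; apply: (sub_finite_set (B := [set: M] `*` [set: bool])) => //.
by apply: finite_setX => //; exact: finite_finset.
Qed.

End Models.

(** * Tilings of the disc by one, two and four triangles *)

Section SmallTilings.
Import Order.TTheory GRing.Theory Num.Theory.
Local Open Scope classical_set_scope.
Local Open Scope ring_scope.
Variable R : realType.
Implicit Types (M : emap) (t s u : 'rV[R]_3) (p : R * R).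
Arguments N T : simpl never.
Arguments act : simpl never.

Definition sg (b : bool) : R := if b then 1 else - 1.

Lemma sg_norm (x : R) : exists b, x = sg b * `|x|.
Proof.
have [x0|x0] := leP 0 x; first by exists true; rewrite ger0_norm// mul1r.
by exists false; rewrite ltr0_norm// mulN1r opprK.
Qed.

Lemma sqrt_inj (x y : R) : 0 <= x -> 0 <= y -> Num.sqrt x = Num.sqrt y -> x = y.
Proof. by move=> x0 y0 E; rewrite -(sqr_sqrtr x0) E sqr_sqrtr. Qed.

Lemma sqr_inj (x y : R) : 0 <= x -> 0 <= y -> x ^+ 2 = y ^+ 2 -> x = y.
Proof. by move=> x0 y0 E;
  rewrite -(ger0_norm x0) -sqrtr_sqr E sqrtr_sqr ger0_norm. Qed.

Lemma sqr_le1 (x : R) : 0 <= x <= 1 -> x ^+ 2 <= 1.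
Proof. by move=> /andP[x0 x1]; rewrite expr_le1. Qed.

Lemma tiling_comp M (X X' : topologicalType) (S : set X)
    (h : M -> 'rV[R]_3 -> X) (q : X -> X') : tiling h ->
  (forall x t, triangle t -> S (h x t)) -> {within S, continuous q} ->
  (forall a b, S a -> S b -> q a = q b -> a = b) ->
  tiling (fun x t => q (h x t)).
Proof.
move=> [hc hg hi] hS qc qi; split.
- by move=> x; apply: (within_continuous_comp (hc x)) qc; exact: hS.
- by move=> x i t tt ti; rewrite hg.
- by move=> x y s t ts tt /(qi _ _ (hS _ _ ts) (hS _ _ tt)); exact: hi.
Qed.

Definition half_disc : set (R * R) :=
  [set p | p.1 ^+ 2 + p.2 ^+ 2 <= 1 /\ 0 <= p.2].

(** Stretching the vertical chords maps the upper half-disc onto the disc. *)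
Definition unfold p : R * R := (p.1, 2 * p.2 - Num.sqrt (1 - p.1 ^+ 2)).

Lemma unfold_continuous : continuous unfold.
Proof.
have c1 : continuous (fun p : R * R => p.1) by move=> p; exact: cvg_fst.
have c2 : continuous (fun p : R * R => p.2) by move=> p; exact: cvg_snd.
have c11 : continuous (fun p : R * R => p.1 ^+ 2) by exact: (continuous_mul c1 c1).
apply: pair_continuous => //; apply: continuous_add;
  first by apply: continuous_mul => //; exact: continuous_cst.
apply/continuous_opp/continuous_sqrt/continuous_add; first exact: continuous_cst.
exact: continuous_opp.
Qed.

Lemma unfold_inj : injective unfold.
Proof. by move=> [a b] [c d] [-> E]; congr pair; lra. Qed.

(** Along a vertical chord, membership in the disc becomes a linear condition on
    the ordinate. *)
Lemma chord (x y : R) : x ^+ 2 + y ^+ 2 <= 1 ->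
  [/\ 0 <= Num.sqrt (1 - x ^+ 2), Num.sqrt (1 - x ^+ 2) ^+ 2 = 1 - x ^+ 2 &
      - Num.sqrt (1 - x ^+ 2) <= y <= Num.sqrt (1 - x ^+ 2)].
Proof.
move=> xy; have x1 : 0 <= 1 - x ^+ 2 by rewrite subr_ge0; apply: le_trans xy;
  rewrite lerDl sqr_ge0.
split; [exact: sqrtr_ge0|exact: sqr_sqrtr|].
by rewrite -ler_norml -sqrtr_sqr ler_wsqrtr//; lra.
Qed.

Lemma in_disc_chord (x y r : R) : 0 <= r -> r ^+ 2 = 1 - x ^+ 2 -> - r <= y <= r ->
  x ^+ 2 + y ^+ 2 <= 1.
Proof.
move=> r0 rE yr; have : y ^+ 2 <= r ^+ 2 by rewrite -(real_normK (num_real y))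
  ler_sqr ?nnegrE// ler_norml.
by lra.
Qed.

Lemma unfold_disc p : half_disc p -> closed_disc R (unfold p).
Proof.
move=> [p1 p0]; have [r0 rE pr] := @chord p.1 p.2 p1.
by apply: (in_disc_chord r0 rE) => /=; lra.
Qed.

Lemma disc_unfold p : closed_disc R p -> exists2 p', half_disc p' & unfold p' = p.
Proof.
case: p => x y /= xy; have [r0 rE yr] := @chord x y xy.
exists (x, (y + Num.sqrt (1 - x ^+ 2)) / 2).
  by split=> /=; last lra; apply: (in_disc_chord r0 rE); lra.
by congr pair => /=; lra.
Qed.

Lemma lies_on_half_disc M (h : M -> 'rV[R]_3 -> R * R) : finite_set [set: M] ->
  tiling h -> (forall x t, triangle t -> half_disc (h x t)) ->
  (forall p, half_disc p -> exists x, exists2 t, triangle t & h x t = p) ->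
  lies_on R M (closed_disc R).
Proof.
move=> fM ht hS Sh; apply: (@lies_on_finite R M _ _ (fun x t => unfold (h x
  t))) => //.
- apply: (tiling_comp ht hS) => [|a b _ _ /unfold_inj//].
  exact: continuous_subspaceT unfold_continuous.
- by move=> x t tt; exact/unfold_disc/hS.
- move=> p /disc_unfold[p' /Sh[x [t tt <-]] <-]; by exists x, t.
Qed.

(** The triangle parametrises the upper half-disc through a - c and 2 sqrt (a c),
    which have norm a + c. *)
Lemma half_disc_param (x y : R) : x ^+ 2 + y ^+ 2 <= 1 -> 0 <= y ->
  exists a c, [/\ 0 <= a, 0 <= c, a + c <= 1, a - c = x & 2 * Num.sqrt (a * c) = y].
Proof.
move=> xy y0; pose s := Num.sqrt (x ^+ 2 + y ^+ 2).
have xy0 : 0 <= x ^+ 2 + y ^+ 2 by rewrite addr_ge0 ?sqr_ge0.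
have s0 : 0 <= s by exact: sqrtr_ge0.
have sE : s ^+ 2 = x ^+ 2 + y ^+ 2 by exact: sqr_sqrtr.
have s1 : s <= 1 by rewrite -(sqrtr1 R) ler_wsqrtr.
have /andP[xs sx] : - s <= x <= s.
  by rewrite -ler_norml -sqrtr_sqr ler_wsqrtr// lerDl sqr_ge0.
exists ((s + x) / 2), ((s - x) / 2); split; try lra.
have -> : (s + x) / 2 * ((s - x) / 2) = (y / 2) ^+ 2 by lra.
by rewrite sqrtr_sqr ger0_norm; lra.
Qed.

Lemma half_disc_param_inj (a c a' c' : R) : 0 <= a -> 0 <= c -> 0 <= a' -> 0 <=
  c' ->
  a - c = a' - c' -> a * c = a' * c' -> a = a' /\ c = c'.
Proof.
move=> a0 c0 a'0 c'0 d m; have : a + c = a' + c'; last by lra.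
apply: sqr_inj; [lra|lra|].
have -> : (a + c) ^+ 2 = (a - c) ^+ 2 + 4 * (a * c) by lra.
by rewrite d m; lra.
Qed.

Lemma half_disc_param_norm (a c : R) : 0 <= a -> 0 <= c ->
  (a - c) ^+ 2 + (2 * Num.sqrt (a * c)) ^+ 2 = (a + c) ^+ 2.
Proof.
move=> a0 c0; have := sqr_sqrtr (mulr_ge0 a0 c0).
by move: (Num.sqrt _) => r; lra.
Qed.

Lemma lies_on_mapT : lies_on R mapT (closed_disc R).
Proof.
pose h (_ : mapT) t : R * R := (t ord0 i1 - t ord0 i2,
  2 * Num.sqrt (t ord0 i1 * t ord0 i2)).
apply: (@lies_on_half_disc _ h).
- by apply: sub_finite_set (finite_set1 (tt : mapT)) => -[].
- split.
  + move=> x; apply: continuous_subspaceT; rewrite /h; cont.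
  + by [].
  + move=> [] [] s t /triangleE[s0 s1 s2 se] /triangleE[t0 t1 t2 te] [d m].
    split; last exact: glued_refl.
    have m' : Num.sqrt (s ord0 i1 * s ord0 i2) = Num.sqrt (t ord0 i1 * t ord0
      i2) by lra.
    have [] := half_disc_param_inj s1 s2 t1 t2 d (sqrt_inj (mulr_ge0 s1 s2)
      (mulr_ge0 t1 t2) m').
    by move=> e1 e2; apply: row3_eq; lra.
- move=> x t /triangleE[t0 t1 t2 te]; split; last by rewrite mulr_ge0// sqrtr_ge0.
  by rewrite half_disc_param_norm//=; apply: sqr_le1; lra.
- move=> [x y] [/= xy y0]; have [a [c [a0 c0 ac xE yE]]] := half_disc_param xy y0.
  exists tt; exists (row3 (1 - a - c) a c).
    by apply/triangleE; rewrite !row3E; split; lra.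
  by rewrite /h !row3E xE yE.
Qed.

Lemma sg_sqr b : sg b ^+ 2 = 1.
Proof. by case: b; rewrite /sg ?sqrrN expr1n. Qed.

Lemma sg_mul_eq b c (x y : R) : 0 <= x -> 0 <= y -> sg b * x = sg c * y ->
  x = y /\ (b = c \/ x = 0).
Proof. by move=> x0 y0; case: b c => [] [] /=; rewrite /sg => E; split;
  try lra; try (by left); right; lra. Qed.

Lemma flip_finite (a : seq 'I_3) j (ja : j \in a) : finite_set [set: flip_map ja].
Proof. exact: (@finite_finset bool). Qed.

(** Two triangles sharing one side: the squares of the coordinates of a point of
    the upper half-disc are two barycentric coordinates of that point. *)
Lemma lies_on_flip1 : lies_on R (@flip_map [:: i1] i1 isT) (closed_disc R).
Proof.
pose h (b : @flip_map [:: i1] i1 isT) t : R * R := (sg b * Num.sqrt (t ord0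
  i1), Num.sqrt (t ord0 i2)).
apply: (@lies_on_half_disc _ h); first exact: flip_finite.
- split.
  + move=> x; apply: continuous_subspaceT; rewrite /h; cont.
  + move=> b; apply: I3E => t _ ti; rewrite flip_act /h ?addbF//.
    by rewrite ti sqrtr0 !mulr0.
  + move=> b c s t /triangleE[s0 s1 s2 se] /triangleE[t0 t1 t2 te] [].
    move=> /(sg_mul_eq (sqrtr_ge0 _) (sqrtr_ge0 _))[/(sqrt_inj s1 t1) e1 bc]
      /(sqrt_inj s2 t2) e2.
    have st : s = t by apply: row3_eq; lra.
    split=> //; case: bc => [->|s10]; first exact: glued_refl.
    have [->|bc] := eqVneq b c; first exact: glued_refl.
    have -> : c = act b (gen i1) by rewrite flip_act; case: b c bc => [] [].
    by apply: glued_gen; rewrite -(sqr_sqrtr s1) s10 expr0n.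
- move=> b t /triangleE[t0 t1 t2 te]; split; last exact: sqrtr_ge0.
  by rewrite /= exprMn sg_sqr mul1r !sqr_sqrtr//; lra.
- move=> [x y] [/= xy y0]; have [b xE] := sg_norm x.
  exists b; exists (row3 (1 - x ^+ 2 - y ^+ 2) (x ^+ 2) (y ^+ 2)).
    by apply/triangleE; rewrite !row3E; split; rewrite ?sqr_ge0//; lra.
  by rewrite /h !row3E !sqrtr_sqr -xE ger0_norm.
Qed.

Lemma lies_on_mapB : lies_on R mapB (closed_disc R).
Proof.
pose h (x : mapB) t : R * R := (sg x.1 * Num.sqrt (t ord0 i0),
  sg x.2 * Num.sqrt (t ord0 i2)).
apply: (@lies_on_finite _ _ _ _ h);
  first exact: (@finite_finset (bool * bool)%type).
- split.
  + move=> x; apply: continuous_subspaceT; rewrite /h; cont.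
  + move=> b; apply: I3E => t _ ti; rewrite mapB_act /h /K2_gen //=.
      by rewrite ti sqrtr0 !mulr0.
    by rewrite ti sqrtr0 !mulr0.
  + move=> [b b'] [c c'] s t /triangleE[s0 s1 s2 se] /triangleE[t0 t1 t2 te] [].
    move=> /(sg_mul_eq (sqrtr_ge0 _) (sqrtr_ge0 _))[/(sqrt_inj s0 t0) e0 bc].
    move=> /(sg_mul_eq (sqrtr_ge0 _) (sqrtr_ge0 _))[/(sqrt_inj s2 t2) e2 bc'].
    have st : s = t by apply: row3_eq; lra.
    split=> //; apply: (@glued_trans _ _ _ _ ((c, b') : mapB)).
      case: bc => /= [->|s00]; first exact: glued_refl.
      have [->|bc] := eqVneq b c; first exact: glued_refl.
      have -> : (c, b') = act ((b,
        b') : mapB) (gen i0) by rewrite mapB_act /K2_gen /=; case: b c bc => [] [].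
      by apply: glued_gen; rewrite -(sqr_sqrtr s0) s00 expr0n.
    case: bc' => /= [->|s20]; first exact: glued_refl.
    have [->|bc'] := eqVneq b' c'; first exact: glued_refl.
    have -> : (c, c') = act ((c,
      b') : mapB) (gen i2) by rewrite mapB_act /K2_gen /=; case: b' c' bc' => [] [].
    by apply: glued_gen; rewrite -(sqr_sqrtr s2) s20 expr0n.
- move=> b t /triangleE[t0 t1 t2 te].
  by rewrite /closed_disc /= !exprMn !sg_sqr !mul1r !sqr_sqrtr//; lra.
- move=> [x y] xy; have {}xy : x ^+ 2 + y ^+ 2 <= 1 := xy.
  have [b xE] := sg_norm x; have [c yE] := sg_norm y.
  exists (b, c); exists (row3 (x ^+ 2) (1 - x ^+ 2 - y ^+ 2) (y ^+ 2)).
    by apply/triangleE; rewrite !row3E; split; rewrite ?sqr_ge0//; lra.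
  by rewrite /h /= !row3E !sqrtr_sqr -xE -yE.
Qed.

(** The four triangles form two pairs, mirror images of each other in the
    horizontal diameter, along which they are glued. The two triangles of a pair
    are glued along two sides and surround their common corner 1: they are the
    two halves of the disc, compressed vertically into the upper half-disc. *)
Lemma lies_on_mapM2P0 : lies_on R mapM2P0 (closed_disc R).
Proof.
apply: lies_on_iso mapM2P0_model _.
pose x t : R := t ord0 i0 - t ord0 i2.
pose y t : R := 2 * Num.sqrt (t ord0 i0 * t ord0 i2).
pose r t : R := Num.sqrt (1 - x t ^+ 2).
pose Y b t : R := (sg b * y t + r t) / 2.
pose h (z : petrie_double flip1_R0) t : R * R := (x t, sg z.1 * Y z.2 t).
have tri t : triangle t -> [/\ 0 <= y t, y t <= r t, r t ^+ 2 = 1 - x t ^+ 2 &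
    x t ^+ 2 + y t ^+ 2 = (1 - t ord0 i1) ^+ 2].
  move=> /triangleE[t0 t1 t2 te].
  have E : x t ^+ 2 + y t ^+ 2 = (1 - t ord0 i1) ^+ 2.
    by rewrite half_disc_param_norm//; congr (_ ^+ 2); lra.
  have [|r0 rE yr] := @chord (x t) (y t).
    by rewrite E; apply: sqr_le1; lra.
  by split=> //; [rewrite mulr_ge0// sqrtr_ge0|case/andP: yr].
have Y0 b t : triangle t -> 0 <= Y b t.
  by move=> /tri[y0 yr _ _]; rewrite /Y; case: b; rewrite /sg; lra.
have xc : continuous x by rewrite /x; cont.
have yc : continuous y by rewrite /y; cont.
have rc : continuous r.
  by apply/continuous_sqrt/continuous_add;
    [exact: continuous_cst|apply/continuous_opp/(continuous_mul xc xc)].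
have actE (z : petrie_double flip1_R0) i : act z (gen i) = if i == i1 then
    (if z.2 then z else (~~ z.1, z.2)) else (z.1, ~~ z.2).
  by rewrite petrie_double_act; case: z => f b; elim/I3E: i => /=;
    rewrite ?flip_act ?addbT ?addbF.
have gl01 (f : bool) s : s ord0 i0 * s ord0 i2 = 0 -> forall b c,
    glued s ((f, b) : petrie_double flip1_R0) (f, c).
  move=> /eqP; rewrite mulf_eq0 => si b c; have [->|bc] := eqVneq b c;
    first exact: glued_refl.
  have cE : c = ~~ b by case: b c bc => [] [].
  by case/orP: si => /eqP si;
    [have := actE (f, b) i0|have := actE (f, b) i2]; rewrite /= -cE => <-;
      exact: glued_gen.
apply: (@lies_on_finite _ _ _ _ h);
  first exact: (@finite_finset (bool * bool)%type).
- split.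
  + move=> z; apply: continuous_subspaceT; apply: pair_continuous => //.
    apply: continuous_mul; first exact: continuous_cst.
    apply: continuous_mul; last exact: continuous_cst.
    by apply: continuous_add => //; apply: continuous_mul => //;
      exact: continuous_cst.
  + move=> [f b] i t tt ti; have [y0 yr rE nE] := tri t tt; rewrite actE /h.
    have yy : i != i1 -> y t = 0.
      by move: ti; rewrite /y; elim/I3E: i => // ti _;
        rewrite ti ?mul0r ?mulr0 sqrtr0 mulr0.
    case: ifPn => [/eqP ii|/yy yt0]; last by rewrite /Y yt0 !mulr0.
    case: b => //=; congr pair; rewrite ii in ti.
    rewrite ti subr0 expr1n in nE.
    have ry : r t = y t by apply: sqr_inj; lra.
    by rewrite /Y ry mulN1r addNr mul0r !mulr0.
  + move=> [f b] [g c] s t ts tt [xE /(sg_mul_eq (Y0 _ _ ts) (Y0 _ _ tt))[YE fg]].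
    have [ys yrs rEs nEs] := tri s ts; have [yt yrt rEt nEt] := tri t tt.
    have rr : r s = r t by rewrite /r xE.
    have yy : y s = y t by move: YE; rewrite /Y rr; case: (b) (c) => [] [];
      rewrite /sg; lra.
    have /triangleE[s0 s1 s2 se] := ts; have /triangleE[t0 t1 t2 te] := tt.
    have mm : s ord0 i0 * s ord0 i2 = t ord0 i0 * t ord0 i2.
      by apply: sqrt_inj; rewrite ?mulr_ge0//; move: yy; rewrite /y; lra.
    have [e0 e2] := half_disc_param_inj s0 s2 t0 t2 xE mm.
    have st : s = t by apply: row3_eq; lra.
    split=> //.
    have y0m : y s = 0 -> s ord0 i0 * s ord0 i2 = 0.
      move=> E; have : Num.sqrt (s ord0 i0 * s ord0 i2) = 0 by move: E;
        rewrite /y; lra.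
      by move=> E'; rewrite -(sqr_sqrtr (mulr_ge0 s0 s2)) E' expr0n.
    have same f' : glued s ((f', b) : petrie_double flip1_R0) (f', c).
      have [->|bc] := eqVneq b c; first exact: glued_refl.
      apply/gl01/y0m; move: YE; rewrite /Y rr; case: (b) (c) bc => [] [] //;
        rewrite /sg; lra.
    have [<-|fg'] := eqVneq f g; first exact: same.
    case: fg => [E|Ys0]; first by rewrite E eqxx in fg'.
    apply: glued_trans (same f) _.
    have low f' : glued s ((f', c) : petrie_double flip1_R0) (f', false).
      case: (c) YE => [|_]; last exact: glued_refl.
      by move=> YE; apply/gl01/y0m; move: Ys0; rewrite YE /Y yy /sg; lra.
    apply: glued_trans (low f) (glued_trans _ (glued_sym (low g))).
    have := actE (f, false) i1; rewrite /= (_ : ~~ f = g);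
      last by case: (f) (g) fg' => [] [].
    move=> <-; apply: glued_gen.
    have : r s ^+ 2 = y s ^+ 2.
      by move: Ys0; rewrite /Y; case: (b); rewrite /sg => E;
        [have -> : r s = - y s by lra|have -> : r s = y s by lra]; rewrite ?sqrrN.
    move=> ry; have : 1 - s ord0 i1 = 1 by apply: sqr_inj; lra.
    by lra.
- move=> [f b] t tt; have [y0 yr rE nE] := tri t tt.
  rewrite /closed_disc /=; apply: (@in_disc_chord _ _ (r t)) => //;
    first exact: sqrtr_ge0.
  by rewrite /Y; case: f; case: b; rewrite /sg; lra.
- move=> [a b] ab; have {}ab : a ^+ 2 + b ^+ 2 <= 1 := ab.
  have [r0 rE br] := @chord a b ab.
  have [f bE] := sg_norm b;
    have [c yE] := sg_norm (2 * `|b| - Num.sqrt (1 - a ^+ 2)).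
  have nb : 0 <= `|b| <= Num.sqrt (1 - a ^+ 2) by rewrite normr_ge0 ler_norml.
  have [|a' [c' [a'0 c'0 ac xE y'E]]] := @half_disc_param a `|2 * `|b| -
    Num.sqrt (1 - a ^+ 2)| _ (normr_ge0 _).
    rewrite real_normK ?num_real//; apply: (in_disc_chord r0 rE); lra.
  exists (f, c); exists (row3 a' (1 - a' - c') c').
    by apply/triangleE; rewrite !row3E; split; lra.
  have xr : x (row3 a' (1 - a' - c') c') = a by rewrite /x !row3E.
  rewrite /h /Y /r xr /y !row3E y'E -yE; congr pair.
  by rewrite [RHS]bE /=; congr (_ * _); lra.
Qed.

End SmallTilings.

(** * Polar coordinates *)

Section Polar.
Import Order.TTheory GRing.Theory Num.Theory.
Local Open Scope classical_set_scope.
Local Open Scope ring_scope.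
Variable R : realType.
Implicit Types (x y a b : R).

Lemma cos_periodz x (m : int) : cos (x + (pi *+ 2) *~ m) = cos x.
Proof.
case: m => m; first exact: (periodicn (@cosD2pi R)).
by rewrite NegzE mulrNz -{2}(subrK ((pi *+ 2) *~ m.+1) x);
  rewrite (periodicn (@cosD2pi R)).
Qed.

Lemma sin_periodz x (m : int) : sin (x + (pi *+ 2) *~ m) = sin x.
Proof.
case: m => m; first exact: (periodicn (@sinD2pi R)).
by rewrite NegzE mulrNz -{2}(subrK ((pi *+ 2) *~ m.+1) x);
  rewrite (periodicn (@sinD2pi R)).
Qed.

Lemma angle_eq a b : cos a = cos b -> sin a = sin b ->
  exists m : int, a = b + (pi *+ 2) *~ m.
Proof.
move=> ca sa; have p0 : 0 < pi *+ 2 :> R by rewrite pmulrn_lgt0// pi_gt0.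
pose m := Num.floor ((a - b) / (pi *+ 2)); exists m.
pose d := a - b - (pi *+ 2) *~ m.
have dE : a - b = d + (pi *+ 2) *~ m by rewrite /d subrK.
have c1 : cos d = 1.
  by rewrite -(cos_periodz d m) -dE cosB ca sa -!expr2 cos2Dsin2.
have /andP[m0 m1] := floor_itv ((a - b) / (pi *+ 2)).
rewrite -/m in m0 m1.
have mE : (pi *+ 2) *~ m = m%:~R * (pi *+ 2) :> R by rewrite mulrzl.
have d0 : 0 <= d by rewrite subr_ge0 mE -ler_pdivlMr.
have d1 : d < pi *+ 2.
  by move: m1; rewrite ltr_pdivrMr// intrD1 mulrDl mul1r /d mE; lra.
have s0 : sin (d / 2) = 0.
  have := cos_mulr2n (d / 2);
    have -> : (d / 2) *+ 2 = d by rewrite -mulr_natr divfK ?pnatr_eq0.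
  rewrite c1; have := cos2Dsin2 (d / 2) => E1 E2.
  by apply/eqP; rewrite -sqrf_eq0; apply/eqP; lra.
suff d00 : d = 0 by rewrite -[a](subrK b) dE d00 add0r addrC.
apply/eqP; rewrite eq_le d0 andbT leNgt; apply/negP => dp.
have : 0 < sin (d / 2) by apply: sin_gt0_pi; lra.
by rewrite s0 ltxx.
Qed.

Lemma polar_inj (r r' : R) a b : 0 <= r -> 0 <= r' ->
  r * cos a = r' * cos b -> r * sin a = r' * sin b ->
  r = r' /\ (r = 0 \/ exists m : int, a = b + (pi *+ 2) *~ m).
Proof.
move=> r0 r'0 ec es.
have sq (p c : R) : (p * cos c) ^+ 2 + (p * sin c) ^+ 2 = p ^+ 2.
  by rewrite !exprMn -mulrDr cos2Dsin2 mulr1.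
have rE : r = r' by apply: sqr_inj => //; rewrite -(sq r a) -(sq r' b) ec es.
split=> //; have [->|rN0] := eqVneq r 0; [by left|right].
apply: angle_eq; apply: (mulfI rN0); first by rewrite ec rE.
by rewrite es rE.
Qed.

Lemma polar_surj x y : exists a, let r := Num.sqrt (x ^+ 2 + y ^+ 2) in
  x = r * cos a /\ y = r * sin a.
Proof.
pose r := Num.sqrt (x ^+ 2 + y ^+ 2).
have xy0 : 0 <= x ^+ 2 + y ^+ 2 by rewrite addr_ge0 ?sqr_ge0.
have rE : r ^+ 2 = x ^+ 2 + y ^+ 2 by exact: sqr_sqrtr.
have [r0|rN0] := eqVneq r 0.
  exists 0 => /=; rewrite -/r r0 !mul0r.
  have : x ^+ 2 + y ^+ 2 == 0 by rewrite -rE r0 expr0n.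
  by rewrite paddr_eq0 ?sqr_ge0// !sqrf_eq0 => /andP[/eqP-> /eqP->].
have rp : 0 < r by rewrite lt_neqAle eq_sym rN0 sqrtr_ge0.
pose c := x / r; pose s := y / r.
have xE : x = r * c by rewrite mulrC divfK.
have yE : y = r * s by rewrite mulrC divfK.
have cs : c ^+ 2 + s ^+ 2 = 1.
  apply: (mulfI (expf_neq0 2 rN0)); rewrite mulr1 mulrDr -!exprMn -xE -yE;
    exact/esym.
have [_ _ /andP[c1 c2]] : [/\ 0 <= 0 :> R, 0 <= 0 :> R & -1 <= c <= 1].
  split=> //; rewrite -ler_norml -(ler_pXn2r (n := 2)) ?nnegrE//.
  by rewrite expr1n real_normK ?num_real// -cs lerDl sqr_ge0.
have c12 : -1 <= c <= 1 by rewrite c1.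
have ca : cos (acos c) = c by apply: acosK; rewrite in_itv.
have sa : sin (acos c) = `|s| by rewrite sin_acos// -sqrtr_sqr -cs addrC addKr.
have [s0|s0] := leP 0 s.
  by exists (acos c); rewrite ca sa ger0_norm.
by exists (- acos c); rewrite cosN sinN ca sa ltr0_norm// opprK.
Qed.

(** Polar coordinates stay continuous at the origin because the radius f damps the
    oscillations of the angle. *)
Lemma continuous_damped (T : topologicalType) (f g : T -> R) (F : R -> R) :
  continuous f -> continuous g -> continuous F -> (forall z, `|F z| <= 1) ->
  continuous (fun x : T => f x * F (g x / f x)).
Proof.
move=> fc gc Fc F1 x; have [fx|fx] := eqVneq (f x) 0; last first.
  apply: continuousM; first exact: fc.
  apply: continuous_comp; last exact: Fc.
  by apply: continuousM; [exact: gc|apply: continuousV; [|exact: fc]].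
rewrite /continuous_at fx mul0r; apply/cvgr0Pnorm_lt => e e0.
have /cvgr0Pnorm_lt/(_ e e0) : f y @[y --> x] --> 0 by rewrite -fx; exact: fc.
apply: filterS => y; apply: le_lt_trans.
by rewrite normrM -{2}(mulr1 `|f y|) ler_wpM2l.
Qed.

End Polar.

(** * The maps A_n *)

Section StarTilings.
Import Order.TTheory GRing.Theory Num.Theory.
Local Open Scope classical_set_scope.
Local Open Scope ring_scope.
Variable R : realType.
Implicit Types (M : emap) (t s u : 'rV[R]_3) (p : R * R) (l : line).
Arguments N T : simpl never.
Arguments act : simpl never.
Local Notation sg := (sg R).

(** The triangles of the line are unrolled on the real axis: at distance
    u = 1 - t_0 from the common vertex, those of the edge k fill the segment of
    length u centred at k u, their edges being at its centre. *)
Definition pos l t : R := l.1%:~R * (1 - t ord0 i0) + sg l.2 / 2 * t ord0 i2.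

Lemma pos_continuous l : continuous (pos l).
Proof. rewrite /pos; cont. Qed.

Lemma pos_gen l i t : triangle t -> t ord0 i = 0 -> pos (act l (gen i)) t = pos l t.
Proof.
move=> /triangleE[t0 t1 t2 te]; rewrite line_act; case: l => k b.
elim/I3E: i => ti //; rewrite /pos /line_gen /=; last by rewrite ti !mulr0.
have -> : t ord0 i2 = 1 - t ord0 i0 by lra.
by case: b; rewrite /= ?intrD ?intrB /sg; lra.
Qed.

(** The segments of length u centred at k u and k' u meet only if k and k' differ
    by at most 1, and then at a common end if k and k' are distinct. *)
Lemma pos_overlap (k k' : int) (b b' : bool) (u x x' : R) : 0 < u ->
  0 <= x <= u -> 0 <= x' <= u ->
  k%:~R * u + sg b / 2 * x = k'%:~R * u + sg b' / 2 * x' ->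
  x = x' /\ [\/ k = k' /\ (b = b' \/ x = 0),
    [/\ k' = k + 1, b, ~~ b' & x = u] | [/\ k' = k - 1, ~~ b, b' & x = u]].
Proof.
move=> u0 xu xu' E; pose d := k' - k.
have k'E : k' = k + d by rewrite /d addrCA subrr addr0.
have dE : d%:~R * u = sg b / 2 * x - sg b' / 2 * x'.
  by move: E; rewrite k'E intrD; lra.
have hb c y : 0 <= y <= u -> - (u / 2) <= sg c / 2 * y <= u / 2.
  by case: c; rewrite /sg; lra.
have := hb b x xu; have := hb b' x' xu' => h1 h2.
have d1 : d <= 1.
  rewrite leNgt; apply/negP => d2;
    have : 2 <= d%:~R :> R by rewrite (ler_int R 2); lia.
  by move=> d2'; have := mulr_ge0 (ltW u0) (_ : 0 <= d%:~R - 2 :> R);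
    rewrite subr_ge0 => /(_ d2'); lra.
have d2 : -1 <= d.
  rewrite leNgt; apply/negP => d2;
    have : d%:~R <= -2 :> R by rewrite (ler_int R _ (-2)); lia.
  by move=> d2'; have := mulr_ge0 (ltW u0) (_ : 0 <= - 2 - d%:~R :> R);
    rewrite subr_ge0 => /(_ d2'); lra.
have [dd|[dd|dd]] : d = -1 \/ d = 0 \/ d = 1 by lia.
- rewrite dd in dE; rewrite k'E dd {k'E E h1 h2 d1 d2 hb dd d}.
  by case: b b' dE => [] []; rewrite /sg => dE; split; try lra; apply: Or33;
    split=> //; lra.
- rewrite dd in dE; rewrite k'E dd addr0 {k'E E h1 h2 d1 d2 hb dd d}.
  case: b b' dE => [] []; rewrite /sg => dE; split; try lra; apply: Or31;
    split=> //;
    by [left|right; lra].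
- rewrite dd in dE; rewrite k'E dd {k'E E h1 h2 d1 d2 hb dd d}.
  by case: b b' dE => [] []; rewrite /sg => dE; split; try lra; apply: Or32;
    split=> //; lra.
Qed.

(** At the common vertex all the flags are glued, R_0 acting trivially. *)
Lemma line_glued_apex t l l' : t ord0 i1 = 0 -> t ord0 i2 = 0 -> glued t l l'.
Proof.
move=> t1 t2; have [g <-] := act_trans l l'; elim/gamma_ind: g => [|g i IH].
  by rewrite act1; exact: glued_refl.
rewrite actM; apply: glued_trans IH _; elim/I3E: i.
- by rewrite line_R0; exact: glued_refl.
- exact: glued_gen.
- exact: glued_gen.
Qed.

Lemma pos_inj l l' s t : triangle s -> triangle t -> s ord0 i0 = t ord0 i0 ->
  pos l s = pos l' t -> s = t /\ glued s l l'.
Proof.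
move=> /triangleE[s0 s1 s2 se] /triangleE[t0 t1 t2 te] e0.
case: l l' => k b [k' b']; rewrite /pos /= -e0 => E.
have [u0|uN] := eqVneq (1 - s ord0 i0) 0.
  split; first by apply: row3_eq; lra.
  by apply: line_glued_apex; lra.
have u0 : 0 < 1 - s ord0 i0 by rewrite lt_neqAle eq_sym uN; lra.
have [||e2 cases] := pos_overlap u0 _ _ E; [lra|lra|].
have st : s = t by apply: row3_eq; lra.
split=> //; case: cases => [[<- [<-|s20]]|[-> bT b'F e]|[-> bF b'T e]].
- exact: glued_refl.
- have [<-|bb'] := eqVneq b b'; first exact: glued_refl.
  have := @line_act (k, b) i2; rewrite /line_gen /= /step_b /= (_ : ~~ b = b');
    last by case: (b) (b') bb' => [] [].
  by move=> <-; exact: glued_gen.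
- have := @line_act (k, b) i1;
    rewrite /line_gen /= /step_a /= bT (_ : ~~ true = b'); last by case: (b') b'F.
  by move=> <-; apply: glued_gen; lra.
- have := @line_act (k, b) i1; rewrite /line_gen /= /step_a /= (negbTE bF) b'T.
  by move=> <-; apply: glued_gen; lra.
Qed.

Lemma pos_surj (u x : R) : 0 <= u <= 1 -> (u = 0 -> x = 0) ->
  exists l, exists2 t, triangle t & t ord0 i0 = 1 - u /\ pos l t = x.
Proof.
move=> /andP[u0 u1] ux; have [uE|uN] := eqVneq u 0.
  exists (0, true), (row3 1 0 0).
    by apply/triangleE; rewrite !row3E; split; lra.
  by rewrite /pos !row3E /= uE ux//; split; lra.
have up : 0 < u by rewrite lt_neqAle eq_sym uN.
pose k := Num.floor (x / u + 2^-1).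
have /andP[k0 k1] := floor_itv (x / u + 2^-1); rewrite -/k intrD1 in k0 k1.
have [b rE] := sg_norm (x / u - k%:~R); set r := `|x / u - k%:~R| in rE.
have r0 : 0 <= r by exact: normr_ge0.
have r1 : r <= 2^-1 by rewrite ler_norml; lra.
have xE : x = (x / u) * u by rewrite divfK.
have ru : 0 <= r * u by rewrite mulr_ge0.
have ru1 : r * u <= 2^-1 * u by rewrite ler_pM2r.
exists (k, b), (row3 (1 - u) (u - 2 * (r * u)) (2 * (r * u))).
  by apply/triangleE; rewrite !row3E; split; lra.
rewrite /pos !row3E /=; split=> //; rewrite xE.
have -> : x / u = k%:~R + sg b * r by rewrite -rE; lra.
by lra.
Qed.

(** ** Finite valency: sectors of the disc *)

Section Finite.
Variables (n : nat) (n0 : (0 < n)%N).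

Let w : R := (pi *+ 2) / n%:R.

(** Wrapping the real axis round the circle of radius u, with period n u. *)
Definition wheel (x u : R) : R * R := (u * cos (w * x / u), u * sin (w * x / u)).

Let nN0 : n%:R != 0 :> R.
Proof. by rewrite pnatr_eq0 -lt0n. Qed.

Let wn : w * n%:R = pi *+ 2.
Proof. by rewrite divfK. Qed.

Lemma wheel_turn (x u : R) (m : int) :
  wheel (x + m%:~R * n%:R * u) u = wheel x u.
Proof.
rewrite /wheel; have [->|uN] := eqVneq u 0; first by rewrite !mul0r.
have -> : w * (x + m%:~R * n%:R * u) / u = w * x / u + (pi *+ 2) *~ m.
  rewrite mulrDr mulrDl; congr (_ + _); rewrite mulrA mulfK// -wn -[RHS]mulrzl.
  by rewrite mulrCA mulrA mulrAC.
by rewrite cos_periodz sin_periodz.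
Qed.

Lemma wheel_inj (x x' u u' : R) : 0 <= u -> 0 <= u' ->
  wheel x u = wheel x' u' ->
  u = u' /\ (u = 0 \/ exists m : int, x = x' + m%:~R * n%:R * u).
Proof.
move=> u0 u'0 [/polar_inj E /(E u0 u'0)[uE [E0|[m mE]]]]; first by split=> //; left.
split=> //; rewrite -uE in mE *; have [->|uN] := eqVneq u 0; [by left|right;
  exists m].
have wN : w != 0 by rewrite mulf_neq0 ?invr_eq0// mulrn_eq0 /= gt_eqF// pi_gt0.
apply: (mulfI wN); apply: (mulIf (x := u^-1)); first by rewrite invr_eq0.
rewrite mE mulrDr mulrDl; congr (_ + _); rewrite mulrA mulfK// -wn -[LHS]mulrzl.
by rewrite mulrCA mulrA mulrAC.
Qed.

Lemma wheel_surj p : exists x, let u := Num.sqrt (p.1 ^+ 2 + p.2 ^+ 2) in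
  wheel x u = p /\ (u = 0 -> x = 0).
Proof.
case: p => a b /=; have [c /= [aE bE]] := polar_surj a b.
set u := Num.sqrt _ in aE bE *; exists (c * u / w).
have wN : w != 0 by rewrite mulf_neq0 ?invr_eq0// mulrn_eq0 /= gt_eqF// pi_gt0.
split=> [|->]; last by rewrite mulr0 mul0r.
rewrite /wheel; have [u0|uN] := eqVneq u 0.
  by rewrite aE bE u0 !mul0r.
have -> : w * (c * u / w) / u = c by rewrite [w * _]mulrC divfK// mulfK.
by rewrite -aE -bE.
Qed.

Lemma lies_on_mapA_finite : lies_on R (mapA (Some n)) (closed_disc R).
Proof.
have [f [fE fs fi]] := @line_mapA (Some n) n0.
pose h l t : R * R := wheel (pos l t) (1 - t ord0 i0).
have fpos l l' t : f l = f l' -> exists m : int,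
    pos l t = pos l' t + m%:~R * n%:R * (1 - t ord0 i0).
  move=> /fi[/= b [_ /dvdzP[m /= mE]]]; exists m.
  rewrite /pos b -[l.1](subrK l'.1) mE !intrD intrM -pmulrn.
  by move: (sg _ / 2 * _) => z; lra.
have hc l : continuous (h l).
  have uc : continuous (fun t : 'rV[R]_3 => 1 - t ord0 i0) by cont.
  have xc : continuous (fun t => w * pos l t).
    by apply: continuous_mul; [exact: continuous_cst|exact: pos_continuous].
  apply: pair_continuous.
    apply: continuous_damped => //; [exact: continuous_cos|exact: cos_max].
  apply: continuous_damped => //; [exact: continuous_sin|exact: sin_max].
have u01 t : triangle t -> 0 <= 1 - t ord0 i0 <= 1.
  by move=> /triangleE[t0 t1 t2 te]; lra.
have [||||h' ht h'E] := @tiling_descend R line (mapA (Some n)) _ f h fE fs.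
- by move=> l; exact: continuous_subspaceT.
- by move=> l i t tt ti; rewrite /h pos_gen.
- by move=> l l' t tt /(fpos _ _ t)[m mE]; rewrite /h mE wheel_turn.
- move=> l l' s t ts tt /wheel_inj[||us ut].
  + by case/andP: (u01 _ ts).
  + by case/andP: (u01 _ tt).
  have e0 : s ord0 i0 = t ord0 i0 by lra.
  case: ut => [u0|[m mE]].
    exists l' => //; apply: pos_inj => //; rewrite /pos -e0 u0 !mulr0 !add0r.
    have /triangleE[s0 s1 s2 se] := ts; have /triangleE[t0 t1 t2 te] := tt.
    have -> : s ord0 i2 = 0 by lra.
    have -> : t ord0 i2 = 0 by lra.
    by rewrite !mulr0.
  exists (l'.1 + m * Posz n, l'.2).
    apply/fi; split=> //; split=> //=; apply/dvdzP; exists m.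
    by rewrite addrAC subrr add0r.
  apply: pos_inj => //; rewrite mE /pos -e0 /= intrD intrM -pmulrn.
  by move: (sg _ / 2 * _) => z; lra.
apply: (lies_on_finite (mapA_finite n0) ht).
- move=> x t tt; have [l <-] := fs x; rewrite h'E// /closed_disc /= !exprMn.
  rewrite -mulrDr cos2Dsin2 mulr1; exact/sqr_le1/u01.
- move=> p pD; have [x /= [xE x0]] := wheel_surj p.
  set u := Num.sqrt _ in xE x0; have u1 : 0 <= u <= 1.
    by rewrite sqrtr_ge0 /= -(sqrtr1 R) ler_wsqrtr.
  have [l [t tt [t0 tx]]] := pos_surj u1 x0.
  by exists (f l), t => //; rewrite h'E// /h tx t0 opprB addrC subrK.
Qed.

End Finite.

(** ** Infinite valency: the half-plane *)

(** In the upper half-plane model, the triangles of the line are bounded by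
    vertical lines, with the common vertex at infinity. The Cayley transform of
    the point of abscissa x / u and height (1 - u) / u depends polynomially on
    x and u, apart from the denominator x ^ 2 + 1. *)
Definition cayley (x u : R) : R * R :=
  (1 - 2 * (u * (x ^+ 2 + 1)^-1), - (2 * x * (u * (x ^+ 2 + 1)^-1))).

Lemma sqrD1_gt0 (x : R) : 0 < x ^+ 2 + 1.
Proof. by apply: ltr_wpDl; rewrite ?sqr_ge0. Qed.

Lemma cayley_inj (x u x' u' : R) : (u = 0 -> x = 0) -> (u' = 0 -> x' = 0) ->
  cayley x u = cayley x' u' -> x = x' /\ u = u'.
Proof.
move=> ux ux' []; have := sqrD1_gt0 x; have := sqrD1_gt0 x'.
move=> d'0 d0 e1 e2; have iN : (x ^+ 2 + 1)^-1 != 0 by rewrite invr_eq0 gt_eqF.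
have i'N : (x' ^+ 2 + 1)^-1 != 0 by rewrite invr_eq0 gt_eqF.
have ev : u * (x ^+ 2 + 1)^-1 = u' * (x' ^+ 2 + 1)^-1 by lra.
have [u0|uN] := eqVneq u 0.
  have u'0 : u' = 0 by apply/eqP; move/eqP: ev;
    rewrite u0 mul0r eq_sym mulf_eq0 (negbTE i'N) orbF.
  by rewrite ux// ux'// u0 u'0.
have xE : x = x'.
  by apply: (mulIf (mulf_neq0 uN iN)); rewrite {2}ev; lra.
by split=> //; rewrite xE in ev iN; exact: (mulIf iN).
Qed.

Lemma cayley_disc (x u : R) : 0 <= u <= 1 -> closed_disc R (cayley x u).
Proof.
move=> /andP[u0 u1]; rewrite /closed_disc /cayley /=.
set i := (_ + 1)^-1; have d0 := sqrD1_gt0 x.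
have i0 : 0 <= i by rewrite invr_ge0 ltW.
pose v := u * i; have v0 : 0 <= v by rewrite mulr_ge0.
have vu : v * (x ^+ 2 + 1) = u by rewrite divfK// gt_eqF.
have vv : v * (v * (x ^+ 2 + 1)) = v * u by rewrite vu.
have vw : 0 <= v * (1 - u) by rewrite mulr_ge0// subr_ge0.
by rewrite -/v; lra.
Qed.

Lemma cayley_surj p : closed_disc R p ->
  exists x u : R, [/\ 0 <= u <= 1, u = 0 -> x = 0 & cayley x u = p].
Proof.
case: p => a b; rewrite /closed_disc /= => ab.
have b2 := sqr_ge0 b; have a2 := sqr_ge0 a.
have [a1|a1] := eqVneq a 1.
  have b0 : b = 0 by apply/eqP; rewrite -sqrf_eq0; apply/eqP; rewrite a1 in ab; lra.
  by exists 0, 0; split=> //; [lra|rewrite /cayley a1 b0; congr pair; lra].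
have al1 : a <= 1 by rewrite leNgt; apply/negP => ag;
  have := mulr_gt0 (_ : 0 < a - 1) (_ : 0 < a - 1);
    rewrite subr_gt0 => /(_ ag ag); lra.
have v0 : 0 < 1 - a by rewrite subr_gt0 lt_neqAle a1.
pose x := - b / (1 - a); pose u := (1 - a) / 2 * (x ^+ 2 + 1).
have xE : x * (1 - a) = - b by rewrite divfK// gt_eqF.
have d0 := sqrD1_gt0 x.
have uv : u * (x ^+ 2 + 1)^-1 = (1 - a) / 2 by rewrite mulfK// gt_eqF.
have up : 0 < u by rewrite mulr_gt0// divr_gt0.
exists x, u; split=> [||]; last by rewrite /cayley uv; congr pair; lra.
  rewrite ltW//= -(ler_pM2l v0) /u.
  have -> : (1 - a) * ((1 - a) / 2 * (x ^+ 2 + 1)) = ((x * (1 - a)) ^+ 2 + (1 -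
    a) ^+ 2) / 2 by lra.
  by rewrite xE; lra.
by move=> u0; rewrite u0 ltxx in up.
Qed.

Lemma line_bounded_finite (B : R) : finite_set [set l : line | `|l.1%:~R : R| <= B].
Proof.
pose n := Num.bound B; have Bn : B < n%:R by exact: unstable.ltr_bound.
have fin : finite_set ([set Posz k - Posz n | k in `I_(n + n)] `*` [set: bool]).
  by apply: finite_setX; [apply: finite_image;
    exact: finite_II|exact: finite_finset].
apply: sub_finite_set fin => -[k b] /= kB; split=> //=.
have : `|k%:~R : R| < n%:R by exact: le_lt_trans Bn.
rewrite -intr_norm pmulrn ltr_int => kn.
by exists (absz (k + Posz n)) => /=; lia.
Qed.

Lemma line_infinite : ~ finite_set [set: line].
Proof.
move=> fin; have : finite_set [set: nat]; last exact: infinite_nat.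
have inj : {in (fun m : nat => (Posz m, true) : line) @^-1` [set: line] &,
    injective (fun m : nat => (Posz m, true) : line)} by move=> m m' _ _ [].
by apply: sub_finite_set (finite_preimage inj fin).
Qed.

Lemma lies_on_line : lies_on R line (closed_disc R).
Proof.
pose h l t : R * R := cayley (pos l t) (1 - t ord0 i0).
have u01 t : triangle t -> 0 <= 1 - t ord0 i0 <= 1.
  by move=> /triangleE[t0 t1 t2 te]; lra.
have u0 l t : triangle t -> 1 - t ord0 i0 = 0 -> pos l t = 0.
  move=> /triangleE[t0 t1 t2 te] ut; rewrite /pos ut (_ : t ord0 i2 = 0);
    last by lra.
  by lra.
have vc l : continuous (fun t : 'rV[R]_3 => (1 - t ord0 i0) * (pos l t ^+ 2 +
  1)^-1).
  apply: continuous_mul; first by cont.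
  apply: continuous_inv; last by move=> x; rewrite gt_eqF// sqrD1_gt0.
  apply: continuous_add; last exact: continuous_cst.
  exact: (continuous_mul (@pos_continuous l) (@pos_continuous l)).
have hc l : continuous (h l).
  apply: pair_continuous.
    apply: continuous_add; first exact: continuous_cst.
    apply/continuous_opp/continuous_mul; [exact: continuous_cst|exact: vc].
  apply/continuous_opp/continuous_mul; last exact: vc.
  by apply: continuous_mul; [exact: continuous_cst|exact: pos_continuous].
have ht : tiling h.
  split=> [l|l i t tt ti|l l' s t ts tt E]; first exact: continuous_subspaceT.
    by rewrite /h pos_gen.
  have [xE uE] := cayley_inj (u0 l _ ts) (u0 l' _ tt) E.
  by apply: pos_inj => //; lra.
apply: (lies_on_tiling ht).
- by move=> l t tt; apply: cayley_disc; exact: u01.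
- move=> p /cayley_surj[x [u [u1 ux <-]]];
    have [l [t tt [t0 tx]]] := pos_surj u1 ux.
  by exists l, t => //; rewrite /h tx t0 opprB addrC subrK.
- case=> a b ab fin.
  (* The common vertex (1, 0) lies in infinitely many triangles. Near any other
     point, u is bounded below and the abscissa x above, which leaves finitely
     many values of k. *)
  have a1 : a != 1.
    apply/eqP => a1; apply: line_infinite; apply: sub_finite_set fin => l _ /=.
    exists (row3 1 0 0); first by apply/triangleE; rewrite !row3E; split; lra.
    rewrite /h /cayley /pos !row3E a1; congr pair; first by lra.
    suff : b ^+ 2 = 0 by move/eqP; rewrite sqrf_eq0 => /eqP->; lra.
    by have := sqr_ge0 b; move: ab; rewrite /closed_disc /= a1; lra.
  have b2 := sqr_ge0 b; have a2 := sqr_ge0 a; rewrite /closed_disc /= in ab.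
  have al1 : a <= 1 by rewrite leNgt; apply/negP => ag;
    have := mulr_gt0 (_ : 0 < a - 1) (_ : 0 < a - 1);
      rewrite subr_gt0 => /(_ ag ag); lra.
  pose e := (1 - a) / 2; have e0 : 0 < e by rewrite divr_gt0// subr_gt0
    lt_neqAle a1.
  exists [set p : R * R | p.1 < 1 - e].
    have : \forall x \near a, x < 1 - e by apply: lt_nbhsl; rewrite /e; lra.
    have c1 : continuous (fun p : R * R => p.1) by move=> p; exact: cvg_fst.
    by move=> na; exact: (c1 (a, b) _ na).
  apply: sub_finite_set (line_bounded_finite ((2 / e + 2^-1) / (e / 2))) => l /=.
  move=> [_ [[t tt <-] he]]; have /triangleE[t0 t1 t2 te] := tt.
  have := cayley_disc (pos l t) (u01 t tt); move: he;
    rewrite /h /cayley /closed_disc /=.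
  set v := (1 - t ord0 i0) * _; set x := pos l t => he hd.
  have v0 : e / 2 < v by lra.
  have vu : v * (x ^+ 2 + 1) = 1 - t ord0 i0 by rewrite /v divfK// gt_eqF//
    sqrD1_gt0.
  have vp : 0 < v by lra.
  have vle : v <= 1 - t ord0 i0.
    by rewrite -vu -{1}(mulr1 v) ler_pM2l// lerDr sqr_ge0.
  have xb : `|x| <= 2 / e.
    have : `|2 * x * v| <= 1.
      rewrite -(ler_pXn2r (n := 2)) ?nnegrE// expr1n real_normK ?num_real//.
      have := sqr_ge0 (1 - 2 * v); rewrite sqrrN in hd; lra.
    rewrite normrM normrM (gtr0_norm vp) (ger0_norm (_ : 0 <= 2 :> R)) // => xv.
    rewrite ler_pdivlMr//; have := normr_ge0 x => x0.
    have : `|x| * (e / 2) <= `|x| * v by rewrite ler_wpM2l// ltW.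
    by lra.
  rewrite ler_pdivlMr; last by lra.
  have kE : l.1%:~R * (1 - t ord0 i0) = x - sg l.2 / 2 * t ord0 i2 by rewrite
    /x /pos; lra.
  have ku : `|l.1%:~R : R| * (1 - t ord0 i0) <= 2 / e + 2^-1.
    rewrite -{1}(ger0_norm (_ : 0 <= 1 - t ord0 i0)); last by lra.
    rewrite -normrM kE; apply: le_trans (ler_normB _ _) _; apply: lerD => //.
    rewrite ler_norml; case: l.2; rewrite /sg; lra.
  apply: le_trans ku; rewrite ler_wpM2l//; lra.
Qed.

Lemma lies_on_mapA n : natinf_pos n -> lies_on R (mapA n) (closed_disc R).
Proof.
case: n => [n|_]; first exact: lies_on_mapA_finite.
by apply: lies_on_iso mapA_line _; exact: lies_on_line.
Qed.

End StarTilings.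

(** * The strip, the annulus and the Moebius band *)

Section StripTilings.
Import Order.TTheory GRing.Theory Num.Theory.
Local Open Scope classical_set_scope.
Local Open Scope ring_scope.
Variable R : realType.
Implicit Types (M : emap) (t s u : 'rV[R]_3) (p : R * R).
Arguments N T : simpl never.
Arguments act : simpl never.
Local Notation sg := (sg R).

Definition evenz (k : int) : bool := (k %% 2)%Z == 0.

Lemma evenzD (j k : int) : evenz (j + k) = (evenz j == evenz k).
Proof. by rewrite /evenz; lia. Qed.

Lemma sg_eqb b c : sg (b == c) = sg b * sg c.
Proof. by case: b c => [] []; rewrite /sg /=; lra. Qed.

Definition strip_map : emap := petrie_double line_R0.

(** The strip is a row of unit squares, the k-th one centred at (k, 1/2). Each is
    cut by its diagonals into four triangles with common corner 1: that of
    ((k, b), false) lies to the right or left of the centre, that of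
    ((k, b), true) above or below it. The side shared by two consecutive squares
    has the same corners 0 and 2 in both, so that these squares are mirror images
    of each other, whence the sign of k. *)
Definition inner_coord (c : bool) t : R :=
  if c then t ord0 i0 - t ord0 i2 else t ord0 i0 + t ord0 i2.

Definition strip_tri (z : strip_map) t : R * R :=
  (z.1.1%:~R + sg z.1.2 / 2 * inner_coord z.2 t,
   2^-1 + sg (evenz z.1.1) * sg z.1.2 / 2 * inner_coord (~~ z.2) t).

Lemma strip_act (z : strip_map) i : act z (gen i) =
  if i == i0 then (step_b z.1, ~~ z.2) else
  if i == i1 then (if z.2 then z else (step_a z.1, z.2)) else (z.1, ~~ z.2).
Proof. by rewrite petrie_double_act !line_act. Qed.

Lemma evenzS (k : int) : evenz (k + 1) = ~~ evenz k.
Proof. by rewrite /evenz; lia. Qed.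

Lemma evenzP (k : int) : evenz (k - 1) = ~~ evenz k.
Proof. by rewrite /evenz; lia. Qed.

Lemma sgN b : sg (~~ b) = - sg b.
Proof. by case: b; rewrite /sg /= ?opprK. Qed.

Lemma strip_gen (z : strip_map) i t : triangle t -> t ord0 i = 0 ->
  strip_tri (act z (gen i)) t = strip_tri z t.
Proof.
move=> /triangleE[_ _ _]; rewrite strip_act; case: z => [[k b] c].
elim/I3E: i => /=; rewrite /strip_tri /inner_coord /step_a /step_b /=;
  move: (t ord0 i0) (t ord0 i1) (t ord0 i2) => x y w te ti; subst.
- by rewrite sgN; case: c => /=; congr pair; lra.
- have -> : w = 1 - x by lra.
  by case: c => //=; case: b => /=;
    rewrite ?evenzS ?evenzP ?intrD ?intrB ?sgN /sg; congr pair; lra.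
- by case: c => /=; congr pair; lra.
Qed.

(** The right (e = true) or left side of a square is a side of a single triangle,
    whose ends are also corners of the triangles above and below. *)
Lemma strip_side (k : int) b c (e : bool) t : triangle t ->
  sg b * inner_coord c t = sg e ->
  [/\ t ord0 i1 = 0, sg b * inner_coord (~~ c) t = sg e * (t ord0 i0 - t ord0 i2) &
      glued t (((k, b), c) : strip_map) ((k, e), false)].
Proof.
move=> /triangleE[t0 t1 t2 te] E.
have e1 : t ord0 i1 = 0 by move: E; rewrite /inner_coord; case: c; case: b;
  case: e; rewrite /sg; lra.
have eB : sg b * inner_coord (~~ c) t = sg e * (t ord0 i0 - t ord0 i2).
  by move: E; rewrite /inner_coord; case: c => /=; case: b; case: e;
    rewrite /sg; lra.
split=> //; case: c E {eB}; rewrite /inner_coord => E; last first.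
  suff -> : b = e by exact: glued_refl.
  by case: b e E => [] []; rewrite /sg // => E; lra.
have [be|be] := eqVneq b e.
  rewrite be in E *; have := strip_act ((k, e), true) i2 => /= <-.
  by apply: glued_gen; move: E; case: (e); rewrite /sg; lra.
have := strip_act ((k, b), true) i0; rewrite /= /step_b /= (_ : ~~ b = e);
  last by case: (b) (e) be => [] [].
move=> <-; apply: glued_gen.
by move: E; case: (b) (e) be => [] [] //; rewrite /sg; lra.
Qed.

(** The four triangles of one square form an orbit of the four-group generated by
    R_0 and R_2, and fill its quarters. *)
Lemma strip_square (k : int) b c b' c' s t : triangle s -> triangle t ->
  sg b * inner_coord c s = sg b' * inner_coord c' t ->
  sg b * inner_coord (~~ c) s = sg b' * inner_coord (~~ c') t ->
  s = t /\ glued s (((k, b), c) : strip_map) ((k, b'), c').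
Proof.
move=> /triangleE[s0 s1 s2 se] /triangleE[t0 t1 t2 te] E1 E2.
have [e0 e2 h1 h2] : [/\ s ord0 i0 = t ord0 i0, s ord0 i2 = t ord0 i2,
   (c != c' -> s ord0 (if b == b' then i2 else i0) = 0) &
   (c = c' -> b != b' -> s ord0 i0 = 0 /\ s ord0 i2 = 0)].
  move: E1 E2 s0 s1 s2 se t0 t1 t2 te; rewrite /inner_coord.
  rewrite (fun_if (fun i => s ord0 i)).
  move: (s ord0 i0) (s ord0 i1) (s ord0 i2) (t ord0 i0) (t ord0 i1) (t ord0 i2)
    => x0 x1 x2 y0 y1 y2.
  by case: b; case: b'; case: c; case: c'; rewrite /sg /= => *; split=> // *; lra.
have st : s = t by apply: row3_eq => //; lra.
split=> //; have [ccE|cc] := eqVneq c c'.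
  rewrite -{}ccE in h2 *; have [<-|bb] := eqVneq b b'; first exact: glued_refl.
  have [s00 s20] := h2 erefl bb.
  apply: (glued_trans (glued_gen (i := i0) _ s00)).
  rewrite strip_act /= /step_b /= (_ : ~~ b = b');
    last by case: (b) (b') bb => [] [].
  have := strip_act ((k, b'), ~~ c) i2; rewrite /= negbK => <-.
  exact: glued_gen.
have cE : ~~ c = c' by case: (c) (c') cc => [] [].
have := h1 cc; case: eqVneq => [<- s20|bb s00].
  have := strip_act ((k, b), c) i2; rewrite /= cE => <-; exact: glued_gen.
have := strip_act ((k, b), c) i0; rewrite /= cE /step_b /= (_ : ~~ b = b');
  last by case: (b) (b') bb => [] [].
move=> <-; exact: glued_gen.
Qed.

Lemma inner_bound b c t : triangle t -> -1 <= sg b * inner_coord c t <= 1.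
Proof.
move=> /triangleE[]; rewrite /inner_coord.
move: (t ord0 i0) (t ord0 i1) (t ord0 i2) => x y z x0 y0 z0 e.
by case: b; case: c; rewrite /sg; lra.
Qed.

Lemma sg_cancel b (x y : R) : sg b * x = sg b * y -> x = y.
Proof. by case: b; rewrite /sg; lra. Qed.

Lemma sgT : sg true = 1. Proof. by []. Qed.

Lemma sgF : sg false = -1. Proof. by []. Qed.

Lemma strip_next (k : int) b c b' c' s t : triangle s -> triangle t ->
  strip_tri ((k, b), c) s = strip_tri ((k + 1, b'), c') t ->
  s = t /\ glued s (((k, b), c) : strip_map) ((k + 1, b'), c').
Proof.
move=> ts tt [/=]; rewrite intrD1 evenzS sgN => E1 E2.
have hs := inner_bound b c ts; have ht := inner_bound b' c' tt.
have s1 : sg b * inner_coord c s = sg true by rewrite sgT; lra.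
have t1 : sg b' * inner_coord c' t = sg false by rewrite sgF; lra.
have [sz sB sg1] := strip_side k ts s1;
  have [tz tB tg1] := strip_side (k + 1) tt t1.
have yE : sg b * inner_coord (~~ c) s = - (sg b' * inner_coord (~~ c') t).
  by apply: (@sg_cancel (evenz k)); lra.
have /triangleE[s0 _ s2 se] := ts; have /triangleE[t0 _ t2 te] := tt.
rewrite sB tB /sg in yE.
have st : s = t by apply: row3_eq; lra.
split=> //; rewrite -st in tg1.
apply: glued_trans sg1 (glued_trans _ (glued_sym tg1)).
have := strip_act ((k, true), false) i1; rewrite /= /step_a /= => <-.
exact: glued_gen.
Qed.

Lemma strip_inj (z z' : strip_map) s t : triangle s -> triangle t ->
  strip_tri z s = strip_tri z' t -> s = t /\ glued s z z'.
Proof.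
case: z z' => [[k b] c] [[k' b'] c'] ts tt E.
have [/= E1 E2] := E.
have hs := inner_bound b c ts; have ht := inner_bound b' c' tt.
have kk : `|k%:~R - k'%:~R : R| <= 1 by rewrite ler_norml; lra.
rewrite -intrB -intr_norm (ler_int R _ 1) in kk.
have [dE|[dE|dE]] : k' = k \/ k' = k + 1 \/ k = k' + 1 by lia.
- rewrite dE in E1 E2 *; apply: strip_square => //; first by lra.
  by apply: (@sg_cancel (evenz k)); lra.
- by rewrite dE in E *; exact: strip_next.
- rewrite dE in E *; have [<- g] := strip_next tt ts (esym E).
  by split=> //; exact: glued_sym.
Qed.

Lemma strip_tri_strip z t : triangle t -> strip R (strip_tri z t).
Proof.
move=> tt; have := inner_bound z.1.2 (~~ z.2) tt; rewrite /strip /strip_tri /=.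
by case: (evenz _); rewrite /(sg true) /(sg false) /=; lra.
Qed.

Lemma strip_tri_surj p : strip R p -> exists z, exists2 t,
  triangle t & strip_tri z t = p.
Proof.
case: p => x y; rewrite /strip /= => y01.
pose k := Num.floor (x + 2^-1).
have /andP[k0 k1] := floor_itv (x + 2^-1); rewrite -/k intrD1 in k0 k1.
pose X := 2 * (x - k%:~R); pose Y := sg (evenz k) * (2 * y - 1).
have X1 : `|X| <= 1 by rewrite ler_norml /X; lra.
have Y1 : `|Y| <= 1 by rewrite /Y ler_norml; case: (evenz k); rewrite /sg; lra.
have yE : y = 2^-1 + sg (evenz k) / 2 * Y by rewrite /Y; case: (evenz k);
  rewrite /sg; lra.
have xE : x = k%:~R + X / 2 by rewrite /X; lra.
have key (b c : bool) (a d : R) : `|d| <= a -> a <= 1 ->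
    (if c then Y else X) = sg b * a -> (if c then X else Y) = sg b * d ->
    exists z, exists2 t, triangle t & strip_tri z t = (x, y).
  move=> da a1 aE dE; have {}da : - a <= d <= a by rewrite -ler_norml.
  exists ((k, b), c), (row3 ((a + d) / 2) (1 - a) ((a - d) / 2)).
    by apply/triangleE; rewrite !row3E; split; lra.
  rewrite /strip_tri /inner_coord /= !row3E xE yE.
  by case: c aE dE => /= -> ->; congr pair; lra.
have [b bE] := sg_norm X; have [c cE] := sg_norm Y.
have sgn (e : bool) (u : R) : u = sg e * (sg e * u) by case: e; rewrite /sg; lra.
have nsg (e : bool) (u : R) : `|sg e * u| = `|u| by case: e;
  rewrite /sg ?mul1r// mulN1r normrN.
have [XY|XY] := leP `|Y| `|X|.
  by apply: (key b false `|X| (sg b * Y)) => //; rewrite nsg.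
apply: (key c true `|Y| (sg c * X)) => //; rewrite nsg; exact: ltW.
Qed.

Lemma strip_tri_continuous z : continuous (strip_tri z).
Proof. by rewrite /strip_tri /inner_coord; case: z => [l []] /=; cont. Qed.

Lemma strip_tiling : tiling strip_tri.
Proof.
split=> [z|z i t tt ti|z z' s t ts tt]; last exact: strip_inj.
  exact: continuous_subspaceT (@strip_tri_continuous z).
exact: strip_gen.
Qed.

Lemma lies_on_mapM2P_strip : lies_on R (mapM2P None) (strip R).
Proof.
apply: lies_on_iso (_ : map_iso _ strip_map) _.
  apply: map_iso_trans (@mapM2P_model None isT) _.
  exact/map_iso_petrie2/map_iso_dual2/map_iso_double/mapA_line.
apply: (lies_on_tiling strip_tiling);
  [exact: strip_tri_strip|exact: strip_tri_surj|].
case=> a b _ _; exists [set p : R * R | a - 1 < p.1 < a + 1].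
  have c1 : continuous (fun p : R * R => p.1) by move=> p; exact: cvg_fst.
  have na : \forall x \near a, a - 1 < x < a + 1.
    have l1 : \forall x \near a, a - 1 < x by apply: lt_nbhsr; lra.
    have l2 : \forall x \near a, x < a + 1 by apply: lt_nbhsl; lra.
    by apply: filterS2 l1 l2 => x -> ->.
  exact: (c1 (a, b) _ na).
have fin : finite_set ([set l : line | `|l.1%:~R : R| <= `|a| + 2] `*` [set: bool]).
  by apply: finite_setX; [exact: line_bounded_finite|exact: finite_finset].
apply: sub_finite_set fin => -[[k b'] c] /= [_ [[t tt <-] /=]].
have := inner_bound b' c tt; rewrite /strip_tri /= => h1 h2; split=> //=.
have := ler_norm a; have := ler_norm (- a); rewrite normrN => n1 n2.
by rewrite ler_norml; lra.
Qed.

(** ** Quotients of the strip by glide reflections *)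

Definition glide (j : int) p : R * R :=
  (p.1 + j%:~R, if evenz j then p.2 else 1 - p.2).

Lemma strip_glide (j k : int) b c t :
  strip_tri ((k + j, b), c) t = glide j (strip_tri ((k, b), c) t).
Proof.
rewrite /glide /strip_tri /= intrD evenzD sg_eqb.
by case: (evenz j); rewrite /(sg true) /(sg false); congr pair; lra.
Qed.

(** The covering of this map by the strip has the powers of the glide by n squares
    as deck transformations; the glide reverses the orientation exactly when n is
    odd, which separates the annulus from the Moebius band. *)
Lemma lies_on_strip_quotient n (X : topologicalType) (S : set X) (q : R * R -> X) :
  (0 < n)%N -> continuous q ->
  (forall p p', strip R p -> strip R p' ->
     q p = q p' <-> exists m : int, p = glide (m * Posz n) p') ->
  (forall p, strip R p -> S (q p)) ->
  (forall x, S x -> exists2 p, strip R p & q p = x) ->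
  lies_on R (mapM2P (Some n)) S.
Proof.
move=> n0 qc qE qS Sq; apply: lies_on_iso (@mapM2P_model (Some n) n0) _.
have [f [fE fs fi]] := @line_mapA (Some n) n0.
pose F : strip_map -> petrie_double (@mapA_R0 (Some n)) := double_fun f.
have FE : equivariant F by exact: petrie_double_equivariant.
have Fs y : exists z, F z = y.
  by case: y => y b; have [l <-] := fs y; exists (l, b).
have Fi z z' : F z = F z' -> exists m : int, z = ((z'.1.1 + m * Posz n,
  z'.1.2), z'.2).
  case: z z' => [[k b] c] [[k' b'] c'] [/fi[/= -> [_ /dvdzP[m /= mE]]] ->].
  by exists m; rewrite -mE addrCA subrr addr0.
have [||||h' ht h'E] := @tiling_descend R _ _ _ F (fun z t => q (strip_tri z
  t)) FE Fs.
- move=> z; apply: continuous_subspaceT => t.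
  by apply: continuous_comp; [exact: strip_tri_continuous|exact: qc].
- by move=> z i t tt ti; rewrite strip_gen.
- move=> z z' t tt /Fi[m ->]; apply/qE; try exact: strip_tri_strip.
  by exists m; rewrite strip_glide; case: z' => [[]].
- move=> z [[k b] c] s t ts tt /qE-/(_ (strip_tri_strip _ ts) (strip_tri_strip
    _ tt))[m].
  rewrite -strip_glide => /(strip_inj ts tt)[st g].
  exists ((k + m * Posz n, b), c) => //.
  congr pair; apply/fi; split=> //; split=> //=; apply/dvdzP; exists m.
  by rewrite addrAC subrr add0r.
apply: (lies_on_finite _ ht).
- exact: (double_finite (mapA_finite n0)).
- move=> y t tt; have [z <-] := Fs y; rewrite h'E//; exact/qS/strip_tri_strip.
- move=> x /Sq[p /strip_tri_surj[z [t tt <-]] <-].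
  by exists (F z), t => //; rewrite h'E.
Qed.

Section Bands.
Variables (n : nat) (n0 : (0 < n)%N).

Let w : R := (pi *+ 2) / n%:R.

Let nN0 : n%:R != 0 :> R.
Proof. by rewrite pnatr_eq0 -lt0n. Qed.

Let w0 : w != 0.
Proof. by rewrite mulf_neq0 ?invr_eq0// mulrn_eq0 /= gt_eqF// pi_gt0. Qed.

Let wn : w * n%:R = pi *+ 2.
Proof. by rewrite divfK. Qed.

Lemma turn_angle (x : R) (m : int) :
  w * (x + (m * Posz n)%:~R) = w * x + (pi *+ 2) *~ m.
Proof.
by rewrite mulrDr intrM -pmulrn -wn -[in RHS]mulrzl; congr (_ + _); rewrite mulrCA.
Qed.

Lemma turn_angle_inj (x x' : R) (m : int) :
  w * x = w * x' + (pi *+ 2) *~ m -> x = x' + (m * Posz n)%:~R.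
Proof. by rewrite -turn_angle => /(mulfI w0). Qed.

Lemma lies_on_annulus : ~~ odd n -> lies_on R (mapM2P (Some n)) (annulus R).
Proof.
move=> nev; pose q p : R * R := ((1 + p.2) * cos (w * p.1),
  (1 + p.2) * sin (w * p.1)).
have ev (m : int) : evenz (m * Posz n).
  rewrite /evenz; have : (n %% 2 = 0)%N by rewrite modn2 (negbTE nev).
  by move=> n2; rewrite (divn_eq n 2) n2 addn0 PoszM mulrA modzMl.
have c1 : continuous (fun p : R * R => p.1) by move=> p; exact: cvg_fst.
have c2 : continuous (fun p : R * R => p.2) by move=> p; exact: cvg_snd.
have cw : continuous (fun p : R * R => w * p.1).
  by apply: continuous_mul => //; exact: continuous_cst.
have cr : continuous (fun p : R * R => 1 + p.2).
  by apply: continuous_add => //; exact: continuous_cst.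
apply: (@lies_on_strip_quotient _ _ _ q n0).
- apply: pair_continuous; apply: continuous_mul => //;
    apply: (continuous_of_comp cw);
    [exact: continuous_cos|exact: continuous_sin].
- move=> [x y] [x' y']; rewrite /strip /= => y0 y'0; split=> [[]|[m [-> ->]]];
    last first.
    by rewrite /q /= ev turn_angle cos_periodz sin_periodz.
  move=> /polar_inj E /E[||yE [r0|[m /turn_angle_inj xE]]]; try lra.
  by exists m; rewrite /glide /= ev xE; congr pair; lra.
- move=> [x y]; rewrite /strip /annulus /q /= => y01.
  rewrite !exprMn -mulrDr cos2Dsin2 mulr1.
  have h0 : 0 <= y * (1 - y) by apply: mulr_ge0; lra.
  by have := sqr_ge0 y; lra.
- move=> [a b]; rewrite /annulus /= => ab.
  have [c /= [aE bE]] := polar_surj a b; set r := Num.sqrt _ in aE bE.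
  have r1 : 1 <= r by rewrite -(sqrtr1 R) ler_wsqrtr; lra.
  have r2 : r <= 2.
    by rewrite -(ger0_norm (_ : 0 <= 2 :> R))// -(sqrtr_sqr 2) ler_wsqrtr; lra.
  exists (c / w, r - 1); first by rewrite /strip /=; lra.
  by rewrite /q /= (mulrC w) divfK// addrCA subrr addr0 -aE -bE.
Qed.

Lemma half_turn (x : R) (m : int) :
  cos ((x + (pi *+ 2) *~ m) / 2) = sg (evenz m) * cos (x / 2) /\
  sin ((x + (pi *+ 2) *~ m) / 2) = sg (evenz m) * sin (x / 2).
Proof.
have -> : (x + (pi *+ 2) *~ m) / 2 = x / 2 + m%:~R * pi :> R.
  by rewrite -mulrzl; lra.
move: (x / 2) => y {x}; elim/int_rect: m => [|m [IHc IHs]|m [IHc IHs]].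
- by rewrite mul0r addr0 !mul1r.
- rewrite -addn1 PoszD evenzS sgN intrD mulrDl mul1r addrA cosDpi sinDpi IHc IHs.
  by rewrite !mulNr.
- rewrite -addn1 PoszD opprD evenzP sgN intrD mulrDl mulN1r addrA.
  have E (f : R -> R) (z : R) : (forall c,
    f (c + pi) = - f c) -> f (z - pi) = - f z.
    by move=> fE; rewrite -[in RHS](subrK pi z) fE opprK.
  by rewrite (E cos _ (@cosDpi R)) (E sin _ (@sinDpi R)) IHc IHs !mulNr.
Qed.

Lemma lies_on_moebius : odd n -> lies_on R (mapM2P (Some n)) (moebius_band R).
Proof.
move=> nodd; pose q p : R * R * R := moebius_param (w * p.1, 2 * p.2 - 1).
have ev (m : int) : evenz (m * Posz n) = evenz m.
  have : (n %% 2 = 1)%N by rewrite modn2 nodd.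
  rewrite /evenz => n2; rewrite (divn_eq n 2) n2 PoszD PoszM mulrDr mulr1 mulrA.
  by rewrite modzMDl.
have qE x y : q (x, y) = let r := 2 + (2 * y - 1) * cos (w * x / 2) in
    (r * cos (w * x), r * sin (w * x), (2 * y - 1) * sin (w * x / 2)) by [].
have q_glide (m : int) p : q (glide (m * Posz n) p) = q p.
  case: p => x y; rewrite /glide /= ev !qE turn_angle cos_periodz sin_periodz.
  have [-> ->] := half_turn (w * x) m.
  have yE : 2 * (if evenz m then y else 1 - y) - 1 = sg (evenz m) * (2 * y - 1).
    by case: (evenz m); rewrite /sg; lra.
  have ss : sg (evenz m) * sg (evenz m) = 1 by rewrite -expr2 sg_sqr.
  by rewrite yE !mulrA ![sg _ * _ * sg _]mulrAC ss !mul1r.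
have r_ge1 x y : 0 <= y <= 1 -> 1 <= 2 + (2 * y - 1) * cos (w * x / 2).
  move=> y01; have : `|(2 * y - 1) * cos (w * x / 2)| <= 1.
    rewrite normrM -(mulr1 1) ler_pM ?normr_ge0 ?cos_max// ler_norml; lra.
  by rewrite ler_norml; lra.
have c1 : continuous (fun p : R * R => p.1) by move=> p; exact: cvg_fst.
have c2 : continuous (fun p : R * R => p.2) by move=> p; exact: cvg_snd.
have cw : continuous (fun p : R * R => w * p.1).
  by apply: continuous_mul => //; exact: continuous_cst.
have cw2 : continuous (fun p : R * R => w * p.1 / 2).
  by apply: continuous_mul => //; exact: continuous_cst.
have cv : continuous (fun p : R * R => 2 * p.2 - 1).
  apply: continuous_add; last exact: continuous_cst.
  by apply: continuous_mul => //; exact: continuous_cst.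
have cc (f : R * R -> R) : continuous f -> continuous (fun p => cos (f p)).
  by move=> fc; apply: (continuous_of_comp fc); exact: continuous_cos.
have cs (f : R * R -> R) : continuous f -> continuous (fun p => sin (f p)).
  by move=> fc; apply: (continuous_of_comp fc); exact: continuous_sin.
have cr : continuous (fun p : R * R => 2 + (2 * p.2 - 1) * cos (w * p.1 / 2)).
  apply: continuous_add; first exact: continuous_cst.
  by apply: continuous_mul => //; exact: cc.
apply: (@lies_on_strip_quotient _ _ _ q n0).
- apply: pair_continuous; first apply: pair_continuous; apply: continuous_mul => //.
  + exact: cc.
  + exact: cs.
  + exact: cs.
- move=> [x y] [x' y']; rewrite /strip /= => y01 y'01; split=> [|[m ->]];
    last exact: q_glide.
  rewrite !qE /= => -[Ec Es Ez].
  have r1 := r_ge1 x _ y01; have r'1 := r_ge1 x' _ y'01.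
  have [||rE [r0|[m mE]]] := polar_inj _ _ Ec Es; try lra.
  exists m; rewrite /glide /= ev (turn_angle_inj mE); congr pair.
  have [hc hs] := half_turn (w * x') m.
  rewrite mE hs in Ez; rewrite mE hc in rE.
  have cE : (sg (evenz m) * (2 * y - 1) - (2 * y' - 1)) * cos (w * x' / 2) = 0
    by lra.
  have sE : (sg (evenz m) * (2 * y - 1) - (2 * y' - 1)) * sin (w * x' / 2) = 0
    by lra.
  have : sg (evenz m) * (2 * y - 1) - (2 * y' - 1) = 0.
    move: cE sE; move: (_ - _) => g cE sE; apply/eqP; rewrite -sqrf_eq0.
    have <- : (g * cos (w * x' / 2)) ^+ 2 + (g * sin (w * x' / 2)) ^+ 2 = g ^+ 2.
      by rewrite !exprMn -mulrDr cos2Dsin2 mulr1.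
    by rewrite cE sE expr0n addr0.
  by case: (evenz m); rewrite /sg; lra.
- move=> p; rewrite /strip /= => p01; pose k := Num.floor (p.1 / n%:R).
  have np : 0 < n%:R :> R by rewrite ltr0n.
  have /andP[k0 k1] := floor_itv (p.1 / n%:R); rewrite -/k in k0 k1.
  rewrite -(q_glide (- k) p) /q; set p' := glide _ p.
  exists (w * p'.1, 2 * p'.2 - 1) => //=; split.
    have -> : w * p'.1 = w * p.1 - w * n%:R * k%:~R.
      by rewrite /p' /= intrM intrN -pmulrn; lra.
    have wp : 0 < w by rewrite divr_gt0// pmulrn_lgt0// pi_gt0.
    have -> : w * p.1 = w * n%:R * (p.1 / n%:R) by rewrite -mulrA [n%:R *
      _]mulrC divfK.
    rewrite -mulrBr wn; rewrite intrD1 in k1.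
    have p0 : 0 < pi *+ 2 :> R by rewrite pmulrn_lgt0// pi_gt0.
    apply/andP; split; first by rewrite mulr_ge0 ?subr_ge0// ltW.
    have -> : 2 * pi = pi *+ 2 * 1 :> R by lra.
    by rewrite ler_pM2l//; lra.
  by rewrite /p' /glide /=; case: (evenz _); lra.
- move=> _ [[u v] /= [u01 v01] <-]; exists (u / w, (v + 1) / 2).
    by rewrite /strip /=; lra.
  have vE : 2 * ((v + 1) / 2) - 1 = v by lra.
  by rewrite qE (mulrC w) divfK// vE.
Qed.

End Bands.
End StripTilings.

(** * The surfaces *)

Section Surfaces.
Variable R : realType.

Lemma lies_on_mapC n : natinf_pos n -> lies_on R (mapC n) (closed_disc R).
Proof.
move=> n0; apply: lies_on_iso (mapC_dual_mapA n0) _.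
exact/lies_on_dual/lies_on_mapA.
Qed.

Lemma lies_on_mapM2 n : natinf_pos n -> lies_on R (mapM2 n) (closed_disc R).
Proof.
move=> n0; apply: lies_on_iso (mapM2_double n0) _.
exact/lies_on_double/lies_on_mapA.
Qed.

Lemma lies_on_mapD : lies_on R mapD (closed_disc R).
Proof. exact: lies_on_iso mapD_flip (lies_on_flip1 R). Qed.

Lemma lies_on_mapM20 : lies_on R mapM20 (closed_disc R).
Proof.
by apply: lies_on_iso mapM20_double _; apply/lies_on_double/lies_on_mapD.
Qed.

(** Renaming the corners relates all the maps whose two triangles are glued along
    a given number of sides. *)
Lemma lies_on_flip a b j k (ja : j \in a) (kb : k \in b) (p q : 'I_3 -> 'I_3) :
  cancel p q -> cancel q p -> (forall i, (i \in a) = (p i \in b)) ->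
  lies_on R (flip_map kb) (closed_disc R) -> lies_on R (flip_map ja)
    (closed_disc R).
Proof.
move=> pq qp pab.
apply: (@lies_on_corners R (flip_map kb) (flip_map ja) _ _ id id p q) => // x i.
by rewrite !flip_act pab.
Qed.

Definition swap (j k i : 'I_3) : 'I_3 :=
  if i == j then k else if i == k then j else i.

Lemma swapK j k : involutive (swap j k).
Proof.
move=> i; rewrite /swap; case: (eqVneq i j) => [->|ij].
  by rewrite eqxx; case: eqVneq => // ->.
by case: (eqVneq i k) => [->|ik]; rewrite ?eqxx // (negbTE ij) (negbTE ik).
Qed.

Lemma lies_on_mapN T : T <> T1 -> lies_on R (mapN T) (closed_disc R).
Proof.
case: T => // _.
- apply: lies_on_iso mapN2_flip _.
  have pab (i : 'I_3) : (i \in [:: i0]) = (swap i0 i1 i \in [:: i1]) by elim/I3E: i.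
  exact: (@lies_on_flip [:: i0] [:: i1] i0 i1 isT isT _ _ (swapK i0 i1) (swapK
    i0 i1) pab (lies_on_flip1 R)).
- apply: lies_on_iso mapN2s_flip _.
  have pab (i : 'I_3) : (i \in [:: i2]) = (swap i2 i1 i \in [:: i1]) by elim/I3E: i.
  exact: (@lies_on_flip [:: i2] [:: i1] i2 i1 isT isT _ _ (swapK i2 i1) (swapK
    i2 i1) pab (lies_on_flip1 R)).
- apply: lies_on_iso mapN2P_flip _.
  have A1 := lies_on_iso (map_iso_sym mapA1_flip) (@lies_on_mapA R (Some 1%N) isT).
  have pab (i : 'I_3) : (i \in [:: i0; i2]) = (swap i0 i1 i \in [:: i1; i2]).
    by elim/I3E: i.
  exact: (@lies_on_flip [:: i0; i2] [:: i1; i2] i0 i1 isT isT _ _ (swapK i0 i1)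
    (swapK i0 i1) pab A1).
Qed.

Lemma lies_on_quotient (A : autgroup mapB) : C2_of A ->
  lies_on R (quotient_map A) (closed_disc R).
Proof.
move=> /K2_quotients_complete[c c0 [_ iso]]; apply: lies_on_iso iso _.
by apply: lies_on_mapN; case: c c0 => [[] []].
Qed.

End Surfaces.

Theorem theorem17p3 (R : realType) :
  [/\ forall M : emap, in_class T1 M /\ has_boundary M <->
        [\/ exists2 n, natinf_pos n & map_iso M (mapA n) \/ map_iso M (mapC n),
            map_iso M mapB,
            exists2 A : autgroup mapB, C2_of A & map_iso M (quotient_map A) |
            map_iso M mapD \/ map_iso M mapT],
      forall n, natinf_pos n -> map_iso (mapC n) (dual_map (mapA n)),
      map_iso mapB mapN3,
      exists A1 A2 A3 : autgroup mapB,
        [/\ C2_of A1 /\ map_iso (quotient_map A1) (mapN T2),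
            C2_of A2 /\ map_iso (quotient_map A2) (mapN T2s),
            C2_of A3 /\ map_iso (quotient_map A3) (mapN T2P),
            [/\ agset A1 <> agset A2, agset A1 <> agset A3 & agset A2 <> agset A3] &
            forall A : autgroup mapB, C2_of A ->
              [\/ agset A = agset A1, agset A = agset A2 | agset A = agset A3]] &
      map_iso mapT (mapN T1)] /\
  [/\ forall M : emap, in_class T2 M /\ has_boundary M <->
        (exists2 n, natinf_pos n & map_iso M (mapM2 n)) \/ map_iso M mapM20,
      forall M : emap, in_class T2s M /\ has_boundary M <->
        (exists2 n, natinf_pos n & map_iso M (mapM2s n)) \/ map_iso M mapM2s0 &
      forall M : emap, in_class T2P M /\ has_boundary M <->
        (exists2 n, natinf_pos n & map_iso M (mapM2P n)) \/ map_iso M mapM2P0] /\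
  [/\ forall n, natinf_pos n ->
        [/\ lies_on R (mapA n) (closed_disc R), lies_on R (mapC n) (closed_disc R),
            lies_on R (mapM2 n) (closed_disc R) & lies_on R (mapM2s n)
              (closed_disc R)],
      [/\ lies_on R mapB (closed_disc R),
          forall A : autgroup mapB, C2_of A ->
            lies_on R (quotient_map A) (closed_disc R),
          lies_on R mapD (closed_disc R) &
          lies_on R mapT (closed_disc R)],
      [/\ lies_on R mapM20 (closed_disc R), lies_on R mapM2s0 (closed_disc R) &
          lies_on R mapM2P0 (closed_disc R)],
      forall n, (0 < n)%N ->
        if odd n then lies_on R (mapM2P (Some n)) (moebius_band R)
        else lies_on R (mapM2P (Some n)) (annulus R) &
      lies_on R (mapM2P None) (strip R)].
Proof.
split; [|split].
- split.
  + exact: class1P.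
  + exact: mapC_dual_mapA.
  + exact: mapB_mapN3.
  + exact: K2_three_quotients.
  + exact: mapT_mapN1.
- split; [exact: class2P|exact: class2sP|exact: class2PP].
- split.
  + move=> n n0; split.
    * exact: lies_on_mapA.
    * exact: lies_on_mapC.
    * exact: lies_on_mapM2.
    * exact/lies_on_dual/lies_on_mapM2.
  + split.
    * exact: lies_on_mapB.
    * exact: lies_on_quotient.
    * exact: lies_on_mapD.
    * exact: lies_on_mapT.
  + split.
    * exact: lies_on_mapM20.
    * exact/lies_on_dual/lies_on_mapM20.
    * exact: lies_on_mapM2P0.
  + move=> n n0; case: ifP => [|/negbT]; first exact: lies_on_moebius.
    exact: lies_on_annulus.
  + exact: lies_on_mapM2P_strip.
Qed.
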